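(* Suppose $\Gamma\subset\mathbb{R}^3$ is a continuous graph with finite total curvature. Then for any $\varepsilon>0$, $\Gamma$ is isotopic to a $\Gamma$-approximating polygonal graph $P$ with edges of length at most $\varepsilon$, whose total curvature is less than or equal to that of $\Gamma$.
   Context: A continuous graph $\Gamma\subset\mathbb{R}^3$ is the image under a continuous embedding of a connected finite graph (finitely many vertices; edges are simple arcs whose endpoints are vertices). The degree $d(q)$ of a vertex is the number of edges ending at it; topological vertices are those of degree $\ne2$. Isotopic means ambient isotopic in $\mathbb{R}^3$. A polygonal graph $P\subset\mathbb{R}^3$ is $\Gamma$-approximating if it is inscribed in $\Gamma$, its topological vertices are exactly those of $\Gamma$ with the same degrees, and the arcs of $P$ between two topological vertices correspond one-to-one to the edges of $\Gamma$ between those two vertices (each edge of $\Gamma$ is replaced by a polygonal path through successive points of that edge). ''Total curvature'' may be understood in terms of any definition which includes the total curvature of the edges and is continuous as a function of the unit tangent vectors at each vertex. That is: for a polygonal graph $P$ it is the sum over the vertices $q$ of contributions $c(T_1,\dots,T_{d(q)})$ depending continuously on the unit vectors $T_1,\dots,T_{d(q)}$ at $q$ pointing into the edges ending at $q$, and equal to the exterior angle $\arccos\langle T_1,-T_2\rangle$ when $d(q)=2$; for a continuous graph $\Gamma$ it is the supremum of the total curvatures of all $\Gamma$-approximating polygonal graphs. Examples include: - net total curvature NTC, with $c=\mathrm{ntc}(q)=\frac14\int_{S^2}[\sum_{i=1}^d\chi_i(e)]^+dA_{S^2}(e)$, where $\chi_i=-1$ on the hemisphere centered at $T_i$ and $+1$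 on the opposite hemisphere; - Taniyama's (maximal) total curvature TC, with $c=\sum_{1\le i<j\le d}\arccos\langle T_i,-T_j\rangle$; - cone total curvature CTC, with $c=\sup_{e\in S^2}\sum_{i=1}^d(\frac\pi2-\arccos\langle T_i,e\rangle)$. *)

(* Defs.v *)
(* MathComp / MathComp-Analysis.  R^3 is 'rV[R]_3 for an arbitrary
   R : realType.  The library norm on row vectors is the sup norm: it has the
   right topology, but lengths and angles use the Euclidean structure below. *)
From HB Require Import structures.
From mathcomp Require Import all_boot all_order all_algebra.
From mathcomp Require Import all_classical all_reals all_analysis.

Set Implicit Arguments.
Unset Strict Implicit.
Unset Printing Implicit Defensive.

Import Order.TTheory GRing.Theory Num.Theory.
Import numFieldNormedType.Exports.

Local Open Scope classical_set_scope.
Local Open Scope ring_scope.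

Section Euclidean.
Variable R : realType.
Implicit Types u v : 'rV[R]_3.

Definition dotv u v : R := \sum_i u 0 i * v 0 i.

Definition enorm u : R := Num.sqrt (dotv u u).

Definition unitv u : 'rV[R]_3 := (enorm u)^-1 *: u.

End Euclidean.

Section Isotopy.
Variable T : topologicalType.

Definition homeomorphism (f : T -> T) : Prop :=
  continuous f /\ exists g : T -> T, [/\ continuous g, cancel f g & cancel g f].

Definition ambient_isotopic (R : realType) (A B : set T) : Prop :=
  exists H : R -> T -> T,
    [/\ {within `[0, 1] `*` [set: T], continuous (fun z : R * T => H z.1 z.2)},
        forall t, t \in `[0, 1] -> homeomorphism (H t),
        forall x, H 0 x = x
      & H 1 @` A = B].

End Isotopy.

Section Graphs.
Variable R : realType.

(* Raw data of a finite graph drawn in R^3.  The edge e has the two ends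
   (e, false) and (e, true), which it reaches at the parameters 0 and 1 of its
   arc; values of garc e outside [0, 1] are irrelevant. *)
Record sgraph := SGraph {
  gvert : finType;
  gedge : finType;
  gend : gedge * bool -> gvert;
  gpos : gvert -> 'rV[R]_3;
  garc : gedge -> R -> 'rV[R]_3 }.

Implicit Types G P : sgraph.

Definition ends G (v : gvert G) : {set gedge G * bool} :=
  [set h | gend h == v].

(* A loop contributes two ends to its vertex. *)
Definition degree G (v : gvert G) : nat := #|ends v|.

Definition adjacent G : rel (gvert G) := fun u v =>
  [exists h : gedge G * bool, (gend h == u) && (gend (h.1, ~~ h.2) == v)].

Definition connected_graph G : Prop :=
  (0 < #|gvert G|)%N /\ forall u v : gvert G, connect (@adjacent G) u v.

Definition carrier G : set 'rV[R]_3 :=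
  range (@gpos G) `|` \bigcup_(e in [set: gedge G]) (@garc G e @` `[0, 1]).

(* The last three clauses say that the induced map on the topological
   realization of the graph is injective, hence, the realization being
   compact, an embedding.  Loops and multiple edges are allowed. *)
Definition continuous_graph G : Prop :=
  [/\ connected_graph G,
      forall e : gedge G,
        [/\ {within `[0, 1], continuous (garc e)},
            garc e 0 = gpos (gend (e, false))
          & garc e 1 = gpos (gend (e, true))],
      injective (@gpos G),
      forall (e : gedge G) (s : R) (v : gvert G),
        s \in `]0, 1[ -> garc e s <> gpos v
    & forall (e e' : gedge G) (s s' : R),
        s \in `]0, 1[ -> s' \in `]0, 1[ ->
        garc e s = garc e' s' -> e = e' /\ s = s'].

Definition polygonal_graph P : Prop :=
  continuous_graph P /\
  forall (e : gedge P) (s : R), s \in `[0, 1] ->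
    garc e s = (1 - s) *: gpos (gend (e, false)) + s *: gpos (gend (e, true)).

Definition edge_length P (e : gedge P) : R :=
  enorm (gpos (gend (e, true)) - gpos (gend (e, false))).

(* Topological vertices are recorded together with their degrees. *)
Definition topological_vertices G : set ('rV[R]_3 * nat) :=
  [set (gpos v, degree v) | v in [set v : gvert G | degree v <> 2%N]].

(* G with its edges redrawn along other arcs. *)
Definition redraw G (a : gedge G -> R -> 'rV[R]_3) : sgraph :=
  SGraph (@gend G) (@gpos G) a.

(* The last clause is the correspondence between the arcs of P and the edges of
   G.  It says that the point set of G, cut at the vertices of P, falls into
   arcs which join the vertices of P according to the incidences of P; each
   segment of P is the chord of the arc a e with the same ends.  An edge of G
   between topological vertices is thus replaced by the polygonal path through
   the successive vertices of P on it.  Vertices of G of degree 2 depend only on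
   how G was presented, and need not be vertices of P. *)
Definition approximating G P : Prop :=
  [/\ polygonal_graph P,
      forall v : gvert P, carrier G (gpos v),
      topological_vertices P = topological_vertices G
    & exists a : gedge P -> R -> 'rV[R]_3,
        continuous_graph (redraw a) /\ carrier (redraw a) = carrier G].

(* Vertex contributions: c d takes the d unit vectors T_1, ..., T_d as the rows
   of a d x 3 matrix, whose topology is that of (R^3)^d.  No symmetry of c in
   its arguments is required. *)
Definition unit_rows d : set 'M[R]_(d, 3) :=
  [set T | forall i, enorm (row i T) = 1].

Definition vertex_curvature (c : forall d, 'M[R]_(d, 3) -> R) : Prop :=
  (forall d, {within @unit_rows d, continuous (c d)}) /\
  (forall T : 'M[R]_(2, 3), unit_rows T ->
     c 2%N T = acos (dotv (row ord0 T) (- row ord_max T))).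

(* The unit vector pointing into a straight edge from its end h. *)
Definition tangent P (h : gedge P * bool) : 'rV[R]_3 :=
  unitv (gpos (gend (h.1, ~~ h.2)) - gpos (gend h)).

Definition tangents P (v : gvert P) : 'M[R]_(degree v, 3) :=
  \matrix_(i < degree v) tangent (enum_val (A := ends v) i).

Definition polygonal_curvature (c : forall d, 'M[R]_(d, 3) -> R) P : R :=
  \sum_(v : gvert P) c (degree v) (tangents v).

Definition total_curvature (c : forall d, 'M[R]_(d, 3) -> R) G : \bar R :=
  ereal_sup [set x : \bar R | exists P : sgraph,
    approximating G P /\ x = (polygonal_curvature c P)%:E].

End Graphs.

(* Main.v *)
From HB Require Import structures.
Require Import Defs.
From mathcomp Require Import all_boot all_order all_algebra.
From mathcomp Require Import all_classical all_reals all_analysis.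
From mathcomp Require Import ring lra zify.
Set Implicit Arguments.
Unset Strict Implicit.
Unset Printing Implicit Defensive.
Import Order.TTheory GRing.Theory Num.Theory.
Import numFieldNormedType.Exports.
Local Open Scope classical_set_scope.
Local Open Scope ring_scope.

(** Each polygonal graph that approximates [G] enters the supremum which defines the
    total curvature of [G], so the bound on the curvature holds for all of them, and it
    remains to find one with short edges in the isotopy class of [G].  Finite total
    curvature makes [G] almost straight away from finitely many points.

    Almost straight edges.  Subdividing [G] changes neither its point set nor its total
    curvature ([total_curvature_same_space]), and cutting the edges at their midpoints
    removes the loops.  A graph without loops has arbitrarily fine embedded inscribed
    polygons ([fine_embedded_chords]).  In such a polygon the topological vertices
    contribute at least a constant, by compactness, and the other vertices contribute
    exterior angles, so that the turning of the polygon along an edge is bounded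
    ([polygonal_curvature_lower]).  A part of an edge which has two chords of clearly
    different directions forces a fixed amount of turning on every fine polygon
    ([bent_heavy]); hence there is only a bounded number of disjoint parts of this kind,
    and every edge can be cut into finitely many pieces, the chords of each of which
    lie in a narrow cone ([straight_chain], [straight_cuts]).

    The vertices.  Pieces with a common end can still be tangent to each other there and
    wind around each other infinitely often.  A unit vector [u] is chosen away from the
    opposites of the axes of the cones at the vertex ([spread_vectors]).  After all rays
    have been tilted towards [u] the height along [u] increases on every branch
    ([lean]).  On the level planes the branches then appear as finitely many distinct
    moving points, and their motion extends to the planes, level by level ([untwist]).
    The result is a homeomorphism with support near the vertices which makes all
    branches straight there ([star_straighten], [straighten_vertices]).

    The rest of the edges.  Outside neighbourhoods of the vertices the edges are at
    positive distance from each other.  Each piece is projected to the chords of a fine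
    subdivision, parallel to the planes orthogonal to its axis.  Along the graph this
    displacement is Lipschitz with constant [1 / 2], so by McShane's extension and the
    contraction principle it extends to a homeomorphism of the space ([family_homeo],
    [chord_polygon]).

    Both homeomorphisms move points by a bounded amount, so that the trick of Alexander
    joins their composite to the identity ([tame_homeo_isotopic]). *)

(** * Euclidean geometry of R^3 *)

(** The contraction principle needs the structure of a complete normed module. *)
HB.instance Definition _ (R : realType) := Complete.on 'rV[R]_3.

Section Euclid.
Variable R : realType.
Local Notation V := 'rV[R]_3.
Implicit Types (u v w x y : V) (a b : R).

Lemma dotvE u v : dotv u v = u 0 0 * v 0 0 + u 0 1 * v 0 1 + u 0 2%:R * v 0 2%:R.
Proof.
rewrite /dotv !big_ord_recr big_ord0 /= add0r.
by congr (_ * _ + _ * _ + _ * _); congr (_ _ _); apply/val_inj.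
Qed.

Lemma dotvC u v : dotv u v = dotv v u.
Proof. by rewrite /dotv; apply: eq_bigr => i _; rewrite mulrC. Qed.

Lemma dotvDl u v w : dotv (u + v) w = dotv u w + dotv v w.
Proof. by rewrite /dotv -big_split; apply: eq_bigr => i _; rewrite !mxE mulrDl. Qed.

Lemma dotvZl a u v : dotv (a *: u) v = a * dotv u v.
Proof. by rewrite /dotv mulr_sumr; apply: eq_bigr => i _; rewrite !mxE mulrA. Qed.

Lemma dotvNl u v : dotv (- u) v = - dotv u v.
Proof. by rewrite -scaleN1r dotvZl mulN1r. Qed.

Lemma dotvBl u v w : dotv (u - v) w = dotv u w - dotv v w.
Proof. by rewrite dotvDl dotvNl. Qed.

Lemma dotvDr u v w : dotv w (u + v) = dotv w u + dotv w v.
Proof. by rewrite dotvC dotvDl !(dotvC w). Qed.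

Lemma dotvZr a u v : dotv v (a *: u) = a * dotv v u.
Proof. by rewrite dotvC dotvZl (dotvC v). Qed.

Lemma dotvNr u v : dotv v (- u) = - dotv v u.
Proof. by rewrite dotvC dotvNl dotvC. Qed.

Lemma dotvBr u v w : dotv w (u - v) = dotv w u - dotv w v.
Proof. by rewrite dotvDr dotvNr. Qed.

Lemma dotv0l v : dotv 0 v = 0.
Proof. by rewrite -(scale0r v) dotvZl mul0r. Qed.

Lemma dotv0r v : dotv v 0 = 0.
Proof. by rewrite dotvC dotv0l. Qed.

Lemma dotv_suml (I : finType) (P : pred I) (F : I -> V) v :
  dotv (\sum_(i | P i) F i) v = \sum_(i | P i) dotv (F i) v.
Proof.
elim/big_rec2 : _ => [|i y x _ <-]; first by rewrite dotv0l.
by rewrite dotvDl.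
Qed.

Lemma dotv_ge0 v : 0 <= dotv v v.
Proof. by rewrite dotvE; nra. Qed.

Lemma enorm_ge0 v : 0 <= enorm v.
Proof. exact: sqrtr_ge0. Qed.

Lemma enorm_sq v : enorm v ^+ 2 = dotv v v.
Proof. by rewrite /enorm sqr_sqrtr // dotv_ge0. Qed.

Lemma coord_enorm v i : `|v 0 i| <= enorm v.
Proof.
rewrite -sqrtr_sqr ler_sqrt ?dotv_ge0 // /dotv (bigD1 i) //= -expr2 lerDl.
by apply: sumr_ge0 => j _; rewrite -expr2 sqr_ge0.
Qed.

Lemma enorm0 : enorm (0 : V) = 0.
Proof. by rewrite /enorm dotv0l sqrtr0. Qed.

Lemma enorm_eq0 v : enorm v = 0 -> v = 0.
Proof.
move=> v0; apply/rowP => i; rewrite !mxE; apply/eqP.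
by rewrite -normr_le0 -v0 coord_enorm.
Qed.

Lemma enorm_gt0 v : (0 < enorm v) = (v != 0).
Proof.
rewrite lt_neqAle enorm_ge0 andbT eq_sym; congr negb.
by apply/eqP/eqP => [/enorm_eq0|->]; rewrite ?enorm0.
Qed.

Lemma dotv_le u v : dotv u v <= enorm u * enorm v.
Proof.
rewrite /enorm -sqrtrM ?dotv_ge0 //.
apply: (le_trans (ler_norm _)); rewrite -sqrtr_sqr ler_sqrt; last first.
  by rewrite mulr_ge0 ?dotv_ge0.
rewrite !dotvE -subr_ge0.
set a := u 0 0; set b := u 0 1; set c := u 0 _.
set d := v 0 0; set e := v 0 1; set f := v 0 _.
have -> : (a * a + b * b + c * c) * (d * d + e * e + f * f) -
   (a * d + b * e + c * f) ^+ 2 =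
   (a * e - b * d) ^+ 2 + (a * f - c * d) ^+ 2 + (b * f - c * e) ^+ 2 by ring.
by rewrite !addr_ge0 // sqr_ge0.
Qed.

Lemma enormZ a v : enorm (a *: v) = `|a| * enorm v.
Proof.
by rewrite /enorm dotvZl dotvZr mulrA -expr2 sqrtrM ?sqr_ge0 // sqrtr_sqr.
Qed.

Lemma enormN v : enorm (- v) = enorm v.
Proof. by rewrite -scaleN1r enormZ normrN1 mul1r. Qed.

Lemma enormB u v : enorm (u - v) = enorm (v - u).
Proof. by rewrite -enormN opprB. Qed.

Lemma normr_dotv_le u v : `|dotv u v| <= enorm u * enorm v.
Proof. by rewrite ler_norml dotv_le lerNl -dotvNl -(enormN u) dotv_le. Qed.

Lemma enormD u v : enorm (u + v) <= enorm u + enorm v.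
Proof.
rewrite -(@ler_pXn2r _ 2) ?nnegrE ?addr_ge0 ?enorm_ge0 //.
rewrite enorm_sq dotvDl !dotvDr sqrrD !enorm_sq (dotvC v u).
by have := dotv_le u v; lra.
Qed.

Lemma enorm_sum (I : Type) (r : seq I) (P : pred I) (F : I -> V) :
  enorm (\sum_(i <- r | P i) F i) <= \sum_(i <- r | P i) enorm (F i).
Proof.
elim/big_rec2 : _ => [|i a v _ h]; first by rewrite enorm0.
by apply: (le_trans (enormD _ _)); rewrite lerD2l.
Qed.

Lemma enorm_triangle x y v : enorm (x - v) <= enorm (x - y) + enorm (y - v).
Proof. by apply: le_trans (enormD _ _); rewrite addrA subrK. Qed.

Lemma enorm_distD u v : enorm u - enorm v <= enorm (u - v).
Proof. by rewrite lerBlDr -{1}(subrK v u) enormD. Qed.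

Lemma norm_coord v i : `|v 0 i| <= `|v|.
Proof.
rewrite [leRHS]/Num.norm /= mx_normrE.
by apply/bigmax_geP; right; exists (0, i).
Qed.

Lemma norm_leP v a : 0 <= a -> (forall i, `|v 0 i| <= a) -> `|v| <= a.
Proof.
move=> a0 h; rewrite [leLHS]/Num.norm /= mx_normrE.
by apply/bigmax_leP; split => // -[i j] _ /=; rewrite (ord1 i).
Qed.

Lemma norm_le_enorm v : `|v| <= enorm v.
Proof. by apply: norm_leP; [exact: enorm_ge0 | exact: coord_enorm]. Qed.

Lemma enorm_le_norm v : enorm v <= 3 * `|v|.
Proof.
rewrite -(@ler_pXn2r _ 2) ?nnegrE ?mulr_ge0 ?enorm_ge0 // enorm_sq dotvE.
have h i : v 0 i * v 0 i <= `|v| ^+ 2.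
  rewrite -expr2 -real_normK ?num_real // lerXn2r ?nnegrE ?norm_coord //.
by have := h 0; have := h 1; have := h 2%:R; have := sqr_ge0 `|v|; rewrite exprMn; lra.
Qed.

Lemma dist_continuous (U W : normedModType R) (f : U -> W) (x : U) :
  (forall e, 0 < e -> exists2 d, 0 < d &
     forall y : U, `|x - y| < d -> `|f x - f y| < e) -> {for x, continuous f}.
Proof.
move=> h; apply/cvgrPdist_lt => e e0; have [d d0 hd] := h e e0.
by apply/nbhs_normP; exists d.
Qed.

Lemma continuous_dist (U W : normedModType R) (f : U -> W) (x : U) :
  {for x, continuous f} -> forall e, 0 < e -> exists2 d, 0 < d &
     forall y : U, `|x - y| < d -> `|f x - f y| < e.
Proof.
move=> /cvgrPdist_lt cf e e0; have /nbhs_normP[d /= d0 hd] := cf e e0.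
by exists d => // y xy; apply: (hd y).
Qed.

Lemma near_continuous (U W : normedModType R) (f g : U -> W) (x : U) (d : R) : 0 < d ->
  (forall y : U, `|x - y| < d -> f y = g y) ->
  {for x, continuous f} -> {for x, continuous g}.
Proof.
move=> d0 fg cf; apply: dist_continuous => e e0.
have [d' d'0 hd] := continuous_dist cf e0.
exists (Num.min d d'); first by rewrite lt_min d0.
by move=> y; rewrite lt_min => /andP[xy /hd]; rewrite !fg ?subrr ?normr0.
Qed.

Lemma lip_continuous (U W : normedModType R) (f : U -> W) k :
  (forall x y : U, `|f x - f y| <= k * `|x - y|) -> continuous f.
Proof.
move=> h x; apply: dist_continuous => e e0.
have k1 : 0 < `|k| + 1 by rewrite ltr_pwDr.
exists (e / (`|k| + 1)); first by rewrite divr_gt0.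
move=> y; rewrite ltr_pdivlMr // => xy; apply: le_lt_trans (h x y) _.
apply: le_lt_trans xy; rewrite mulrC ler_wpM2l //.
by rewrite (le_trans (ler_norm k)) // lerDl.
Qed.

Lemma dotv_lip u v w : `|dotv v u - dotv w u| <= 3 * enorm u * `|v - w|.
Proof.
rewrite -dotvBl (le_trans (normr_dotv_le _ _)) // mulrC (mulrC 3) -mulrA.
by rewrite ler_wpM2l ?enorm_ge0 ?enorm_le_norm.
Qed.

Lemma dotv_continuous u : continuous (fun v : V => dotv v u).
Proof. by apply: (@lip_continuous _ _ _ (3 * enorm u)) => v w; exact: dotv_lip. Qed.

Lemma enorm_lip v w : `|enorm v - enorm w| <= 3 * `|v - w|.
Proof.
rewrite ler_norml; apply/andP; split; last first.
  exact: le_trans (enorm_distD _ _) (enorm_le_norm _).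
rewrite lerNl opprB distrC; exact: le_trans (enorm_distD _ _) (enorm_le_norm _).
Qed.

Lemma enorm_continuous : continuous (@enorm R : V -> R).
Proof. exact: lip_continuous enorm_lip. Qed.

Lemma enorm_unitv v : v != 0 -> enorm (unitv v) = 1.
Proof.
move=> v0; rewrite /unitv enormZ ger0_norm ?invr_ge0 ?enorm_ge0 //.
by rewrite mulVf // gt_eqF // enorm_gt0.
Qed.

Lemma unitvK v : enorm v *: unitv v = v.
Proof.
have [->|v0] := eqVneq v 0; first by rewrite enorm0 scale0r.
by rewrite /unitv scalerA mulfV ?scale1r // gt_eqF // enorm_gt0.
Qed.

Lemma unitvN v : unitv (- v) = - unitv v.
Proof. by rewrite /unitv enormN scalerN. Qed.

Lemma unitv_continuous v : v != 0 -> {for v, continuous (@unitv R)}.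
Proof.
move=> v0.
have c1 : (fun w : V => (enorm w)^-1) @ v --> (enorm v)^-1.
  have v1 : enorm v != 0 by rewrite lt0r_neq0 // enorm_gt0.
  exact: (cvgV v1 (@enorm_continuous v)).
have c2 : (fun w : V => w) @ v --> v by exact: cvg_id.
exact: (@cvgZ R V V (nbhs v) _ (fun w : V => (enorm w)^-1) (fun w => w) _ _ c1 c2).
Qed.

End Euclid.

(** * Homeomorphisms of bounded displacement *)

Section Homeo.
Variable R : realType.
Local Notation V := 'rV[R]_3.
Implicit Types (u v w x y : V).

Definition inverse_maps (f g : V -> V) :=
  [/\ continuous f, continuous g, cancel f g & cancel g f].

Definition tame_homeo (h : V -> V) :=
  exists g M, inverse_maps h g /\ forall x, `|h x - x| <= M.

Lemma inverse_maps_sym f g : inverse_maps f g -> inverse_maps g f.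
Proof. by case. Qed.

Lemma inverse_maps_comp f f' g g' :
  inverse_maps f f' -> inverse_maps g g' -> inverse_maps (f \o g) (g' \o f').
Proof.
move=> [cf cf' K1 K2] [cg cg' K3 K4]; split.
- by move=> x; apply: continuous_comp; [exact: cg|exact: cf].
- by move=> x; apply: continuous_comp; [exact: cf'|exact: cg'].
- exact: can_comp.
- exact: can_comp.
Qed.

Lemma tame_homeo_id : tame_homeo id.
Proof.
exists id, 0; split=> [|x]; last by rewrite subrr normr0.
by split=> // x; exact: cvg_id.
Qed.

Lemma tame_homeo_comp f g : tame_homeo f -> tame_homeo g -> tame_homeo (f \o g).
Proof.
move=> [f' [M [If fM]]] [g' [N [Ig gN]]]; exists (g' \o f'), (M + N); split.
  exact: inverse_maps_comp.
move=> x /=; rewrite (le_trans (ler_distD (g x) _ _)) // lerD //.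
Qed.

Lemma tame_homeo_inj h : tame_homeo h -> injective h.
Proof. by move=> [g [M [[_ _ K _] _]]]; exact: can_inj K. Qed.

Lemma tame_homeo_continuous h : tame_homeo h -> continuous h.
Proof. by move=> [g [M [[]]]]. Qed.

(** Conjugation of [h] with the homothety of ratio [t]. *)
Definition alexander (h : V -> V) (t : R) x : V :=
  if t == 0 then x else t *: h (t^-1 *: x).

Lemma alexander_homeo f g t : inverse_maps f g -> homeomorphism (alexander f t).
Proof.
move=> [cf cg fg gf]; rewrite /alexander; have [t0|t0] := eqVneq t 0.
  split; first by move=> x; exact: cvg_id.
  by exists id; split=> // x; exact: cvg_id.
have c (h : V -> V) : continuous h -> continuous (fun x : V => t *: h (t^-1 *: x)).
  move=> ch x.
  apply: (@continuous_comp _ _ _ (fun x : V => h (t^-1 *: x)) (fun y : V => t *: y)).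
    apply: continuous_comp; last exact: ch.
    exact: scaler_continuous.
  exact: scaler_continuous.
split; first exact: c.
exists (fun x => t *: g (t^-1 *: x)); split; first exact: c.
  by move=> x; rewrite scalerA mulVf // scale1r fg scalerA mulfV // scale1r.
by move=> x; rewrite scalerA mulVf // scale1r gf scalerA mulfV // scale1r.
Qed.

Lemma alexander_dist h M t x :
  (forall x, `|h x - x| <= M) -> `|alexander h t x - x| <= `|t| * M.
Proof.
move=> hM; rewrite /alexander; have [->|t0] := eqVneq t 0.
  by rewrite subrr normr0 normr0 mul0r.
rewrite -{2}(scale1r x) -(mulfV t0) -scalerA -scalerBr normrZ.
by rewrite ler_wpM2l.
Qed.

Lemma alexander_continuous h M :
  continuous h -> (forall x, `|h x - x| <= M) ->
  continuous (fun z : R * V => alexander h z.1 z.2).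
Proof.
move=> ch hM [t x]; have [t0|t0] := eqVneq t 0.
  subst t; have M0 : 0 <= M by apply: le_trans (hM 0).
  suff : (fun z : R * V => z.2 + (alexander h z.1 z.2 - z.2)) @ ((0 : R), x) --> x + 0.
    have <- : (fun z : R * V => alexander h z.1 z.2) =
        (fun z => z.2 + (alexander h z.1 z.2 - z.2)).
      by apply/funext => z; rewrite addrC subrK.
    have E0 : alexander h 0 x = x by rewrite /alexander eqxx.
    by rewrite addr0 /continuous_at /= E0.
  apply: cvgD; first exact: cvg_snd.
  apply/cvgr0Pnorm_lt => e e0.
  have M1 : 0 < M + 1 by rewrite ltr_wpDl.
  have /cvgr0Pnorm_lt/(_ _ (divr_gt0 e0 M1)) : (fun z : R * V => z.1) @ ((0 : R), x) --> (0 : R).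
    exact: cvg_fst.
  apply: filterS => -[s y] /= ls.
  apply: le_lt_trans (alexander_dist _ _ hM) _.
  have : `|s| * (M + 1) < e by rewrite -ltr_pdivlMr.
  by apply: le_lt_trans; rewrite ler_wpM2l // lerDl.
have cF : (fun z : R * V => z.1 *: h (z.1^-1 *: z.2)) @ (t, x) --> t *: h (t^-1 *: x).
  have c1 : (fun z : R * V => z.1) @ (t, x) --> t by exact: cvg_fst.
  have c2 : (fun z : R * V => z.2) @ (t, x) --> x by exact: cvg_snd.
  have c3 : (fun z : R * V => z.1^-1) @ (t, x) --> t^-1 by exact: (cvgV t0 c1).
  have c4 : (fun z : R * V => z.1^-1 *: z.2) @ (t, x) --> t^-1 *: x.
    exact: (@cvgZ R V _ (nbhs (t, x)) _ (fun z : R * V => z.1^-1) snd _ _ c3 c2).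
  have c5 : (fun z : R * V => h (z.1^-1 *: z.2)) @ (t, x) --> h (t^-1 *: x).
    exact: (cvg_comp _ _ c4 (ch _)).
  exact: (@cvgZ R V _ (nbhs (t, x)) _ fst (fun z : R * V => h (z.1^-1 *: z.2)) _ _ c1 c5).
have Et : alexander h t x = t *: h (t^-1 *: x) by rewrite /alexander (negbTE t0).
rewrite /continuous_at /= Et.
apply: cvg_trans cF; apply: near_eq_cvg; near=> z.
rewrite /alexander ifF //; apply/negbTE; near: z.
have c1 : (fun z : R * V => z.1) @ (t, x) --> t by exact: cvg_fst.
exact: (cvgr_neq0 _ c1 t0).
Unshelve. all: by end_near. Qed.

(** Alexander's trick: conjugation with the homothety of ratio [t] shrinks [h] to the
    identity, and this is continuous at [t = 0] because the displacement is at most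
    [`|t| * M]. *)
Lemma tame_homeo_isotopic h (A B : set V) :
  tame_homeo h -> h @` A = B -> ambient_isotopic R A B.
Proof.
move=> [g [M [hg hM]]] AB; exists (alexander h); split.
- apply: continuous_subspaceT; apply: alexander_continuous hM.
  by case: hg.
- by move=> t _; exact: alexander_homeo hg.
- by move=> x; rewrite /alexander eqxx.
- rewrite -AB; congr (_ @` _); apply/funext => x.
  by rewrite /alexander oner_eq0 invr1 !scale1r.
Qed.

(** On a fibre of [dotv _ u] the equation [x + w x = a] is a fixed point problem
    for the contraction [x |-> a - w x].  With [u = 0] there is just one fibre. *)
Lemma fiber_perturbation (u : V) (w : V -> V) (k : R) :
  continuous w -> (forall x, dotv (w x) u = 0) -> 0 <= k < 1 ->
  (forall x y, dotv x u = dotv y u -> `|w x - w y| <= k * `|x - y|) ->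
  exists g, inverse_maps (fun x => x + w x) g.
Proof.
move=> cw wu /andP[k0 k1] kw.
have ex (a : V) : exists x, x + w x = a.
  pose U := [set x : V | dotv x u = dotv a u].
  have hU : {homo (fun x => a - w x) : x / U x >-> U x}.
    by move=> x _; rewrite /U /= dotvBl wu subr0.
  pose F := mkfun_fun hU.
  have cF : is_contraction F.
    exists (NngNum k0); split => //= -[x y] /= [Ux Uy].
    rewrite opprB addrC addrA subrK distrC; apply: kw.
    by rewrite Ux Uy.
  have clU : closed U.
    apply: (@closed_comp V R (fun x => dotv x u) [set dotv a u]).
      by move=> x _; exact: dotv_continuous.
    exact: closed_eq.
  have [p _ pE] := banach_fixed_point cF clU (ex_intro _ a erefl).
  have pE' : p = a - w p := pE.
  by exists p; rewrite {1}pE' subrK.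
have [g gK] := choice ex.
have inj x y : x + w x = y + w y -> x = y.
  move=> E; have /kw : dotv x u = dotv y u.
    by have := congr1 (fun v => dotv v u) E; rewrite /= !dotvDl !wu !addr0.
  have -> : w x - w y = y - x.
    by apply/eqP; rewrite subr_eq addrAC -E addrAC subrr add0r.
  rewrite distrC -subr_ge0 -{2}(mul1r `|x - y|) -mulrBl => h.
  have : `|x - y| <= 0 by rewrite leNgt; apply/negP => xy; move: h; nra.
  by rewrite normr_le0 subr_eq0 => /eqP.
exists g; split; last exact: gK.
- move=> x; have c1 : (fun y : V => y) @ x --> x by exact: cvg_id.
  exact: (cvgD c1 (cw x)).
- move=> a; apply: dist_continuous => e e0.
  have k10 : 0 < 1 - k by rewrite subr_gt0.
  have e2 : 0 < e / 2 by rewrite divr_gt0.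
  have [d d0 hd] := continuous_dist (cw (g a)) (mulr_gt0 k10 e2).
  exists (Num.min d (e / 2)); first by rewrite lt_min d0 e2.
  move=> a' ; rewrite lt_min => /andP[aa' aa2].
  pose x := g a; pose x' := g a'; pose x2 := x + (a' - a).
  have xE : x + w x = a := gK a.
  have xE' : x' + w x' = a' := gK a'.
  have D : x' - x2 = w x - w x'.
    by rewrite /x2 -{1}xE' -{}xE; apply/rowP => i; rewrite !mxE; ring.
  have L : `|w x2 - w x'| <= k * `|x2 - x'|.
    apply: kw; rewrite /x2 dotvDl dotvBl -{1}xE' -{1}xE !dotvDl !wu; ring.
  have Q : `|w x - w x2| < (1 - k) * (e / 2).
    by apply: hd; rewrite /x2 opprD addrA subrr add0r normrN distrC.
  have : `|x' - x2| <= `|w x - w x2| + k * `|x' - x2|.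
    by rewrite {1}D (le_trans (ler_distD (w x2) _ _)) // lerD2l (distrC x').
  have T : `|x - x'| <= `|x' - x2| + `|a - a'|.
    rewrite (le_trans (ler_distD x2 _ _)) // addrC (distrC x2) lerD2l //.
    by rewrite /x2 opprD addrA subrr add0r opprB.
  have := normr_ge0 (x' - x2); nra.
- by move=> x; apply: inj; rewrite gK.
Qed.

(** McShane's extension: the infimum of the cones of slope [k] above the data. *)
Lemma lipschitz_extension (A : Type) (X : A -> V) (f : A -> R) k : 0 <= k ->
  (forall i j, `|f i - f j| <= k * `|X i - X j|) ->
  exists F : V -> R, (forall x y, `|F x - F y| <= k * `|x - y|) /\
    forall i, F (X i) = f i.
Proof.
move=> k0 fk; have [[i0]|noA] := pselect (inhabited A); last first.
  exists (fun=> 0); split=> [x y|i]; last by case: noA; exact: inhabits.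
  by rewrite subrr normr0 mulr_ge0.
pose S x := [set f i + k * `|x - X i| | i in [set: A]].
have low x : has_lbound (S x).
  exists (f i0 - k * `|x - X i0|) => _ [i _ <-].
  have := fk i0 i; rewrite ler_norml => /andP[_].
  have := ler_wpM2l k0 (ler_distD x (X i0) (X i)); rewrite mulrDr (distrC _ x); lra.
have ne x : S x !=set0 by exists (f i0 + k * `|x - X i0|); exists i0.
have half x y : inf (S x) - inf (S y) <= k * `|x - y|.
  rewrite lerBlDl -lerBlDr; apply: lb_le_inf => // _ [i _ <-].
  rewrite lerBlDr; apply: le_trans (_ : f i + k * `|x - X i| <= _).
    by apply: ge_inf => //; exists i.
  have := ler_wpM2l k0 (ler_distD y x (X i)); rewrite mulrDr; lra.
exists (fun x => inf (S x)); split=> [x y|i].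
  by rewrite ler_norml half andbT lerNl opprB distrC half.
apply/eqP; rewrite eq_le; apply/andP; split.
  by apply: ge_inf => //; exists i => //; rewrite subrr normr0 mulr0 addr0.
apply: lb_le_inf => // _ [j _ <-].
have := fk i j; rewrite ler_norml => /andP[_]; lra.
Qed.

Lemma max_lip (c a b : R) : `|Num.max c a - Num.max c b| <= `|a - b|.
Proof.
have := ler_norm (a - b); have := ler_norm (b - a); rewrite (distrC b) ler_norml.
by case: (lerP c a) => ?; case: (lerP c b) => ?; lra.
Qed.

Lemma min_lip (c a b : R) : `|Num.min c a - Num.min c b| <= `|a - b|.
Proof.
have := ler_norm (a - b); have := ler_norm (b - a); rewrite (distrC b) ler_norml.
by case: (lerP c a) => ?; case: (lerP c b) => ?; lra.
Qed.

Lemma clip_lip (M a b : R) :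
  `|Num.max (- M) (Num.min M a) - Num.max (- M) (Num.min M b)| <= `|a - b|.
Proof. exact: le_trans (max_lip _ _ _) (min_lip _ _ _). Qed.

(** Displacements that are contractive along the points [X] extend to a global
    contractive displacement, hence to a homeomorphism of the whole space. *)
Lemma family_homeo (A : Type) (X Y : A -> V) (k M : R) : 0 <= k < 1 -> 0 <= M ->
  (forall i j, `|(Y i - X i) - (Y j - X j)| <= k * `|X i - X j|) ->
  (forall i, `|Y i - X i| <= M) ->
  exists h, tame_homeo h /\ forall i, h (X i) = Y i.
Proof.
move=> /andP[k0 k1] M0 XYk XYM.
have ex c : exists F : V -> R, (forall x y, `|F x - F y| <= k * `|x - y|) /\
    forall i, F (X i) = (Y i - X i) 0 c.
  apply: lipschitz_extension => // i j; apply: le_trans (XYk i j).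
  by apply: le_trans (norm_coord _ c); rewrite !mxE.
have [F FP] := choice ex.
(* The extension is clipped to keep the displacement bounded; this does not change it
   along [X]. *)
pose w x : V := \row_c Num.max (- M) (Num.min M (F c x)).
have wk x y : `|w x - w y| <= k * `|x - y|.
  apply: norm_leP => [|c]; first by rewrite mulr_ge0.
  rewrite !mxE; apply: le_trans (clip_lip _ _ _) _.
  by case: (FP c).
have wX i : w (X i) = Y i - X i.
  apply/rowP => c; rewrite mxE; have [_ ->] := FP c.
  have : `|(Y i - X i) 0 c| <= M by apply: le_trans (norm_coord _ _) (XYM i).
  rewrite ler_norml => /andP[h1 h2].
  by rewrite (min_idPr h2) (max_idPr h1).
have wM x : `|w x| <= M.
  apply: norm_leP => // c; rewrite mxE ler_norml le_max lexx /= ge_max.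
  by rewrite ge_min lexx /= andbT; lra.
have [g gI] : exists g, inverse_maps (fun x => x + w x) g.
  apply: (@fiber_perturbation 0 w k) => [|x||x y _] //.
  - exact: lip_continuous wk.
  - exact: dotv0r.
  - by rewrite k0.
exists (fun x => x + w x); split; last first.
  by move=> i; rewrite wX addrC subrK.
by exists g, M; split => // x; rewrite addrC addKr.
Qed.

End Homeo.

(** * Untwisting moving points *)

Section Untwist.
Variable R : realType.
Local Notation V := 'rV[R]_3.

(** Positive bounds for finitely many indices have a common value; all the constants
    that depend on vertices and edges are obtained in this way. *)
Lemma small_forall (I : finType) (P : I -> R -> Prop) :
  (forall i d d', 0 < d' <= d -> P i d -> P i d') ->
  (forall i, exists2 d, 0 < d & P i d) -> exists2 d, 0 < d & forall i, P i d.
Proof.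
move=> mono ex.
have : \forall d \near 0^'+, forall i, P i d.
  apply: filter_forall => i; have [d d0 Pd] := ex i.
  near=> d'; apply: mono Pd; apply/andP; split; near: d'.
    exact: nbhs_right_gt.
  exact: nbhs_right_le.
move=> h; near (0 : R)^'+ => d; exists d; near: d => //.
exact: nbhs_right_gt.
Unshelve. all: by end_near. Qed.

Lemma sum_continuous (I : finType) (F : I -> V -> V) :
  (forall i, continuous (F i)) -> continuous (fun x => \sum_i F i x).
Proof.
move=> cF x.
have h (r : seq I) :
    (fun y => \sum_(i <- r) F i y) @ x --> \sum_(i <- r) F i x.
  elim: r => [|i r IH].
    have -> : (fun y => \sum_(i <- [::]) F i y) = fun=> (0 : V).
      by apply/funext => y; exact: big_nil.
    by rewrite big_nil; apply: (@cst_continuous V V (0 : V)).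
  have -> : (fun y => \sum_(j <- i :: r) F j y) = fun y => F i y + \sum_(j <- r) F j y.
    by apply/funext => y; rewrite big_cons.
  rewrite big_cons; exact: (cvgD (cF i x) IH).
exact: h.
Qed.

Section Strands.
Variables (u : V) (z0 C : R) (I : finType) (eta : I -> R -> V).
Hypothesis z0_gt0 : 0 < z0.
Hypothesis C_ge0 : 0 <= C.
Hypothesis eta_height : forall i (z : R), 0 < z -> dotv (eta i z) u = 1.
Hypothesis eta_bound : forall i (z : R), 0 < z -> `|eta i z| <= C.
Hypothesis eta_neq : forall i j (z : R), 0 < z -> i != j -> eta i z != eta j z.
Hypothesis eta_cont : forall i (z : R), 0 < z -> {for z, continuous (eta i)}.

Local Notation ht x := (dotv x u).

(** The strands [z *: eta i z] lie in this cone, which leaves room around them. *)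
Definition in_cone (x : V) := 0 < ht x < z0 /\ `|x| < (C + 1) * ht x.

Definition cone_map (T : V -> V) :=
  (forall x, ht (T x) = ht x) /\ (forall x, ~ in_cone x -> T x = x).

(** [T] carries the straight strand through [z0 *: eta i z0] to a strand which agrees
    with the given one above height [a] and is straight below. *)
Definition straightens (T : V -> V) (a : R) :=
  forall i (z : R), 0 < z <= z0 -> T (z *: eta i z0) = z *: eta i (Num.max z a).

Lemma cone_map_inv T T' : inverse_maps T T' -> cone_map T -> cone_map T'.
Proof.
move=> [_ _ K K'] [hT oT]; split=> x; first by rewrite -{2}(K' x) hT.
by move=> /oT E; rewrite -{1}E K.
Qed.

Lemma cone_map_dist T T' x : inverse_maps T T' -> cone_map T ->
  `|T x - x| <= 2 * (C + 1) * Num.max 0 (ht x).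
Proof.
move=> [_ _ K K'] [hT oT].
have p : 0 <= 2 * (C + 1) * Num.max 0 (ht x).
  by rewrite !mulr_ge0 ?addr_ge0 // le_max lexx.
have [xin|xout] := pselect (in_cone x); last first.
  by rewrite oT // subrr normr0.
have [Txin|/oT/(can_inj K) ->] := pselect (in_cone (T x)); last first.
  by rewrite subrr normr0.
case: xin Txin => /andP[h0 _] h1 [_]; rewrite hT => h2.
rewrite (max_idPr (ltW h0)); apply: le_trans (ler_normB _ _) _; lra.
Qed.

(** One stage of the straightening.  Between the heights [c'] and [c] the strands stay
    so close to their positions at height [c] that a single displacement, made of
    disjoint bumps around the straight strands, follows their motion and is contractive
    on every level plane. *)
Section Push.
Variables (c' c rho : R).
Hypotheses (c'0 : 0 < c') (c'c : c' < c) (cz0 : c <= z0).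
Hypotheses (rho0 : 0 < rho) (rho1 : rho <= 1).
Hypothesis sep : forall i j, i != j -> rho <= `|eta i c - eta j c|.
Hypothesis move_small :
  forall z, c' <= z <= c -> \sum_i `|eta i z - eta i c| <= rho / 2.

Let cl (z : R) := Num.max c' (Num.min c z).
(* [bump i] has height [z] on the straight strand [z *: eta i c], and vanishes where that
   strand is at distance [rho * z] or more; so it vanishes on the other strands. *)
Let bump i (x : V) := Num.max 0 (ht x - `|x - ht x *: eta i c| / rho).
Let push (x : V) := \sum_i bump i x *: (eta i (cl (ht x)) - eta i c).

Let c0 : 0 < c. Proof. exact: lt_trans c'c. Qed.

Let cl_itv z : c' <= cl z <= c.
Proof. by rewrite /cl le_max lexx /= ge_max (ltW c'c) ge_min lexx. Qed.

Let cl_gt0 z : 0 < cl z.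
Proof. by apply: lt_le_trans c'0 _; case/andP: (cl_itv z). Qed.

Let bump_fiber i x y : ht x = ht y -> `|bump i x - bump i y| <= rho^-1 * `|x - y|.
Proof.
move=> h; apply: le_trans (max_lip _ _ _) _.
rewrite h; set A := `|x - ht y *: _|; set B := `|y - ht y *: _|.
have -> : ht y - A / rho - (ht y - B / rho) = rho^-1 * (B - A) by ring.
rewrite normrM (gtr0_norm (_ : 0 < rho^-1)) ?invr_gt0 //.
rewrite ler_wpM2l ?invr_ge0 ?(ltW rho0) // distrC.
by apply: le_trans (ler_dist_dist _ _) _; rewrite opprB addrA subrK.
Qed.

Let bump_cont i : continuous (bump i).
Proof.
pose K := 3 * enorm u; pose L := K + (1 + K * `|eta i c|) / rho.
have K0 : 0 <= K by rewrite mulr_ge0 ?enorm_ge0.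
apply: (@lip_continuous _ _ _ _ L) => x y.
apply: le_trans (max_lip _ _ _) _.
have h : `|ht x - ht y| <= K * `|x - y| by exact: dotv_lip.
set A := `|x - ht x *: _|; set B := `|y - ht y *: _|.
have -> : ht x - A / rho - (ht y - B / rho) = (ht x - ht y) + rho^-1 * (B - A).
  by ring.
apply: le_trans (ler_normD _ _) _; rewrite mulrDl lerD //.
rewrite normrM (gtr0_norm (_ : 0 < rho^-1)) ?invr_gt0 // mulrAC [leRHS]mulrC.
rewrite ler_wpM2l ?invr_ge0 ?(ltW rho0) //.
apply: le_trans (ler_dist_dist _ _) _.
have -> : y - ht y *: eta i c - (x - ht x *: eta i c) =
  (y - x) + (ht x - ht y) *: eta i c.
  by rewrite scalerBl; apply/rowP => j; rewrite !mxE; ring.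
apply: le_trans (ler_normD _ _) _; rewrite mulrDl mul1r distrC lerD2l normrZ.
by rewrite mulrAC ler_wpM2r.
Qed.

Let push_cont : continuous push.
Proof.
have ccl : continuous (fun x : V => cl (ht x)).
  apply: (@lip_continuous _ _ _ _ (3 * enorm u)) => x y.
  apply: le_trans (max_lip _ _ _) _; apply: le_trans (min_lip _ _ _) _.
  exact: dotv_lip.
apply: sum_continuous => i x.
have c1 : (fun x : V => eta i (cl (ht x))) @ x --> eta i (cl (ht x)).
  by apply: (cvg_comp _ _ (ccl x)); exact: eta_cont.
have c2 : (fun x : V => eta i (cl (ht x)) - eta i c) @ x --> eta i (cl (ht x)) - eta i c.
  exact: (cvgB c1 (@cst_continuous V V (eta i c) x)).
have cb : (fun x : V => bump i x : R) @ x --> (bump i x : R) by exact: bump_cont.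
exact: (@cvgZ R V V (nbhs x) _ (fun x : V => bump i x)
  (fun x : V => eta i (cl (ht x)) - eta i c) _ _ cb c2).
Qed.

Let ht_push x : ht (push x) = 0.
Proof.
rewrite /push dotv_suml big1 // => i _.
by rewrite dotvZl dotvBl !eta_height // subrr mulr0.
Qed.

Let push_fiber x y : ht x = ht y -> `|push x - push y| <= 2^-1 * `|x - y|.
Proof.
move=> h; rewrite /push h -sumrB.
apply: le_trans (ler_norm_sum _ _ _) _.
apply: le_trans (_ : \sum_i rho^-1 * `|x - y| * `|eta i (cl (ht y)) - eta i c| <= _).
  apply: ler_sum => i _; rewrite -scalerBl normrZ ler_wpM2r //.
  exact: bump_fiber.
rewrite -mulr_sumr mulrAC ler_wpM2r //.
apply: le_trans (_ : rho^-1 * (rho / 2) <= _).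
  by rewrite ler_wpM2l ?invr_ge0 ?(ltW rho0) // move_small // cl_itv.
by rewrite mulrA mulVf ?mul1r // gt_eqF.
Qed.

Let push_high x : c <= ht x -> push x = 0.
Proof.
move=> h; rewrite /push big1 // => i _.
by rewrite /cl (min_idPl h) (max_idPr (ltW c'c)) subrr scaler0.
Qed.

Let push_out x : ~ in_cone x -> push x = 0.
Proof.
move=> xout; have [/push_high//|hc] := leP c (ht x).
rewrite /push big1 // => i _; suff -> : bump i x = 0 by rewrite scale0r.
apply/max_idPl; rewrite subr_le0 ler_pdivlMr //.
have [h0|h0] := leP (ht x) 0.
  by apply: le_trans (normr_ge0 _); rewrite pmulr_lle0.
apply: le_trans (_ : ht x <= _); first by rewrite ler_piMr // ltW.
have : (C + 1) * ht x <= `|x|.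
  rewrite leNgt; apply/negP => hx; apply: xout; split=> //.
  by rewrite h0 (lt_le_trans hc).
have : `|ht x *: eta i c| <= C * ht x.
  by rewrite normrZ gtr0_norm // mulrC ler_wpM2r ?(ltW h0) // eta_bound.
have := lerB_dist x (ht x *: eta i c); lra.
Qed.

Let push_strand i z : 0 < z -> z <= c ->
  z *: eta i c + push (z *: eta i c) = z *: eta i (Num.max z c').
Proof.
move=> z00 zc; have hz : ht (z *: eta i c) = z.
  by rewrite dotvZl eta_height // mulr1.
rewrite /push (bigD1 i) //= big1 ?addr0 => [|j ji].
  rewrite /bump hz subrr normr0 mul0r subr0 (max_idPr (ltW z00)).
  by rewrite /cl (min_idPr zc) maxC scalerBr addrC subrK.
suff -> : bump j (z *: eta i c) = 0 by rewrite scale0r.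
apply/max_idPl; rewrite hz -scalerBr normrZ gtr0_norm // subr_le0.
rewrite ler_pdivlMr // ler_wpM2l ?(ltW z00) //.
by apply: sep; rewrite eq_sym.
Qed.

Lemma push_step T T' : inverse_maps T T' -> cone_map T -> straightens T c ->
  exists S S', [/\ inverse_maps S S', cone_map S, straightens S c' &
    forall x, c <= ht x -> S x = T x /\ S' x = T' x].
Proof.
move=> TT' [hT oT] sT.
have [g gI] : exists g, inverse_maps (fun x => x + push x) g.
  apply: (@fiber_perturbation _ u push (2^-1)) => //.
  by rewrite invr_ge0 ler0n /= invf_lt1 ?ltr1n.
exists ((fun x => x + push x) \o T), (T' \o g); split.
- exact: inverse_maps_comp.
- split=> [x|x xout] /=; first by rewrite dotvDl ht_push addr0 hT.
  by rewrite oT // push_out // addr0.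
- move=> i z /andP[z1 z2] /=; rewrite sT ?z1 //; have [cz|zc] := leP c z.
    rewrite push_high ?addr0 ?(max_idPl (ltW (lt_le_trans c'c cz))) //.
    by rewrite dotvZl eta_height ?mulr1.
  by rewrite push_strand // ltW.
- move=> x cx /=; rewrite push_high ?hT // addr0; split=> //.
  case: gI => _ _ K _; congr T'; rewrite -[in RHS](K x) push_high // addr0 //.
Qed.

End Push.

Definition good (p : (V -> V) * (V -> V)) (a : R) :=
  [/\ inverse_maps p.1 p.2, cone_map p.1 & straightens p.1 a].

Definition agree_above (a : R) (p q : (V -> V) * (V -> V)) :=
  forall x, a <= ht x -> q.1 x = p.1 x /\ q.2 x = p.2 x.

(** The separation may tend to [0] with the height, which is why infinitely many stages
    are needed. *)
Lemma separation (b : R) : 0 < b -> exists2 d : R, 0 < d &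
  forall i j, i != j -> d <= `|eta i b - eta j b|.
Proof.
move=> b0.
have [d d0 hd] : exists2 d : R, 0 < d &
    forall p : I * I, p.1 != p.2 -> d <= `|eta p.1 b - eta p.2 b|.
  apply: (@small_forall (I * I)%type (fun p d => p.1 != p.2 -> d <= `|eta p.1 b - eta p.2 b|)).
    by move=> p d d' /andP[_ dd'] h /h; exact: le_trans.
  move=> [i j] /=; have [_|ij] := eqVneq i j; first by exists 1.
  exists `|eta i b - eta j b| => //.
  by rewrite normr_gt0 subr_eq0 eta_neq.
by exists d => // i j ij; apply: (hd (i, j)).
Qed.

(** By continuity of the strands a stage of definite size is possible near any positive
    height. *)
Lemma local_step (b : R) : 0 < b -> exists2 e, 0 < e &
  forall c' c : R, b - e < c' -> c' < c -> c < b + e -> 0 < c' -> c <= z0 ->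
  forall p, good p c -> exists2 q, good q c' & agree_above c p q.
Proof.
move=> b0; have [d d0 sep] := separation b0.
pose rho := Num.min 1 (d / 2).
have rho0 : 0 < rho by rewrite lt_min ltr01 divr_gt0.
have rho1 : rho <= 1 by rewrite ge_min lexx.
have rhod : rho <= d / 2 by rewrite ge_min lexx orbT.
pose m : R := (#|I|%:R + 1).
have m0 : 0 < m by rewrite ltr_wpDl.
pose t := rho / (4 * m).
have t0 : 0 < t by rewrite divr_gt0 // mulr_gt0.
have tm : t * m = rho / 4 by rewrite /t; field; exact: lt0r_neq0.
have trho : t <= rho / 4.
  by rewrite -tm ler_peMr ?(ltW t0) // lerDr.
have [e e0 He] : exists2 e, 0 < e & forall i z, `|b - z| < e -> `|eta i b - eta i z| < t.
  apply: (@small_forall I (fun i e => forall z, `|b - z| < e -> `|eta i b - eta i z| < t)).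
    by move=> i e e' /andP[_ ee'] h z bz; apply: h; apply: lt_le_trans ee'.
  move=> i; have [e e0 he] := continuous_dist (@eta_cont i b b0) t0.
  by exists e.
exists e => // c' c bc' c'c cb c'0 cz0 p [pI pC pS].
have near z : c' <= z <= c -> `|b - z| < e.
  by move=> /andP[z1 z2]; rewrite ltr_norml; lra.
have bc : `|b - c| < e by apply: near; rewrite lexx ltW.
have [||S [S' [h1 h2 h3 h4]]] := @push_step c' c rho c'0 c'c cz0 rho0 rho1 _ _ _ _ pI pC pS.
- move=> i j ij; have := sep i j ij; have := He i _ bc; have := He j _ bc.
  have := ler_distD (eta i c) (eta i b) (eta j b).
  have := ler_distD (eta j c) (eta i c) (eta j b).
  rewrite (distrC (eta j c) (eta j b)); lra.
- move=> z zc; apply: le_trans (_ : \sum_(i : I) 2 * t <= _).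
    apply: ler_sum => i _; have := He i _ bc; have := He i _ (near _ zc).
    have := ler_distD (eta i b) (eta i z) (eta i c); rewrite (distrC _ (eta i b)); lra.
  rewrite sumr_const -mulr_natr.
  have : t * #|I|%:R <= t * m by rewrite ler_wpM2l ?(ltW t0) // lerDl.
  rewrite tm; lra.
by exists (S, S').
Qed.

(** The infimum of the heights to which the strands can be straightened is [0], since
    otherwise one more stage at the infimum would lower it. *)
Lemma good_descent p (a b : R) : 0 < a <= z0 -> good p a -> 0 < b ->
  exists a' q, [/\ 0 < a' < b, a' <= a, good q a' & agree_above a p q].
Proof.
move=> /andP[a0 az] pa b0.
pose S := [set a' : R | 0 < a' <= a /\ exists2 q, good q a' & agree_above a p q].
have Sa : S a by split; [rewrite a0 lexx|exists p].
have Slb : has_lbound S by exists 0 => s [/andP[/ltW]].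
have infS s : S s -> inf S <= s by move=> /ge_inf; apply.
have S0 : 0 <= inf S by apply: lb_le_inf => [|s [/andP[/ltW]]//]; exists a.
have : inf S <= 0.
  rewrite leNgt; apply/negP => i0.
  have [e e0 He] := local_step i0.
  have [c Sc ce] : exists2 c, S c & c < inf S + e.
    by apply: inf_adherent => //; split => //; exists a.
  case: (Sc) => /andP[c0 ca] [q qg qa].
  pose c' := Num.max (inf S - e / 2) (inf S / 2).
  have c'i : c' < inf S by rewrite gt_max; apply/andP; split; lra.
  have c'0 : 0 < c' by rewrite lt_max divr_gt0 ?orbT.
  have : inf S - e < c' by rewrite lt_max; apply/orP; left; lra.
  move=> he; have [q' gq' aq'] :=
    He c' c he (lt_le_trans c'i (infS _ Sc)) ce c'0 (le_trans ca az) q qg.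
  have Sc' : S c'.
    split; first by rewrite c'0 (le_trans (ltW c'i)) // infS.
    exists q' => // x ax; have [-> ->] := aq' x (le_trans ca ax).
    exact: qa.
  by have := infS _ Sc'; rewrite leNgt c'i.
move=> i0.
have [c [/andP[c0 ca] [q qg qa]] cb] : exists2 c, S c & c < inf S + b.
  by apply: inf_adherent => //; split => //; exists a.
exists c, q; split => //; rewrite c0 /=; lra.
Qed.

Lemma good_sequence : exists (P : nat -> (V -> V) * (V -> V)) (a : nat -> R),
  [/\ forall n, 0 < a n <= z0, forall n, good (P n) (a n),
     forall e, 0 < e -> exists n, a n < e &
     forall n m, (n <= m)%N -> agree_above (a n) (P n) (P m)].
Proof.
pose st := {s : ((V -> V) * (V -> V)) * R | 0 < s.2 <= z0 /\ good s.1 s.2}.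
have next (n : nat) (s : st) : exists s' : st,
   [/\ (sval s').2 < n.+1%:R^-1, (sval s').2 <= (sval s).2 &
     agree_above (sval s).2 (sval s).1 (sval s').1].
  case: s => -[p a] /= [az pa].
  have n0 : 0 < n.+1%:R^-1 :> R by rewrite invr_gt0.
  have [a' [q [/andP[a'0 a'n] a'a qg ag]]] := good_descent az pa n0.
  have h : 0 < a' <= z0 by rewrite a'0 (le_trans a'a) //; case/andP: az.
  by exists (exist _ (q, a') (conj h qg)).
have [f fP] := choice (fun ns : nat * st => next ns.1 ns.2).
have g0 : good (id, id) z0.
  split => //=; first by split=> // x; exact: cvg_id.
  by move=> i z /andP[z1 z2]; rewrite (max_idPr z2).
have h0 : 0 < z0 <= z0 by rewrite lexx andbT.
pose s0 : st := exist _ ((id, id), z0) (conj h0 g0).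
pose s := fix s n := if n is n'.+1 then f (n', s n') else s0.
exists (fun n => (sval (s n)).1), (fun n => (sval (s n)).2); split.
- by move=> n; case: (svalP (s n)).
- by move=> n; case: (svalP (s n)).
- move=> e e0; have [N _ hN] := near_infty_natSinv_lt (PosNum e0).
  exists N.+1; have [h _ _] := fP (N, s N).
  by apply: lt_trans h (hN N _) => /=.
move=> n m /subnKC <-; elim: (m - n)%N => [|k IH]; first by rewrite addn0.
rewrite addnS => x nx; have [_ _ ag] := fP ((n + k)%N, s (n + k)%N).
have le k' : (sval (s (n + k')%N)).2 <= (sval (s n)).2.
  elim: k' => [|k' IH']; first by rewrite addn0.
  by rewrite addnS; have [_ h _] := fP ((n + k')%N, s (n + k')%N); apply: le_trans h IH'.
have [e1 e2] := ag x (le_trans (le k) nx); have [e3 e4] := IH x nx.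
by split; [rewrite e1|rewrite e2].
Qed.

(** The moving points are straightened by stages that are stationary above any
    given positive height; the limit is continuous at height [0] because a cone
    map displaces a point by at most a multiple of its height. *)
Lemma untwist : exists T T', [/\ inverse_maps T T', cone_map T &
  forall i z, 0 < z <= z0 -> T (z *: eta i z0) = z *: eta i z].
Proof.
have [P [a [a0 gP aS agP]]] := good_sequence.
have lim (S : nat -> V -> V) :
    (forall n m, (n <= m)%N -> forall x, a n <= ht x -> S m x = S n x) ->
    exists T : V -> V, forall x,
      (ht x <= 0 -> T x = x) /\ (forall n, a n <= ht x -> T x = S n x).
  move=> Snm; suff /choice [T hT] : forall x, exists y : V,
    (ht x <= 0 -> y = x) /\ (forall n, a n <= ht x -> y = S n x) by exists T.
  move=> x; have [h|h] := leP (ht x) 0.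
    exists x; split=> // n nx; have /andP[an _] := a0 n.
    by move: (lt_le_trans an nx); rewrite ltNge h.
  have [n /ltW nx] := aS _ h; exists (S n x); split=> [|m mx].
    by [].
  have [/Snm/(_ x nx)->//|/ltnW/Snm/(_ x mx)->//] := leqP n m.
have [|T hT] := lim (fun n => (P n).1).
  by move=> n m /agP nm x /nm[].
have [|T' hT'] := lim (fun n => (P n).2).
  by move=> n m /agP nm x /nm[].
have invP n : inverse_maps (P n).2 (P n).1 by case: (gP n) => /inverse_maps_sym.
have coneP n : cone_map (P n).2 by case: (gP n) => h c _; exact: cone_map_inv h c.
have htT x : ht (T x) = ht x.
  have [/(hT x).1->//|/aS[n /ltW nx]] := leP (ht x) 0.
  by rewrite ((hT x).2 n nx); case: (gP n) => _ [-> _].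
have htT' x : ht (T' x) = ht x.
  have [/(hT' x).1->//|/aS[n /ltW nx]] := leP (ht x) 0.
  by rewrite ((hT' x).2 n nx); case: (coneP n) => ->.
have cont (S : nat -> V -> V) (U : V -> V) : (forall n, continuous (S n)) ->
   (forall n x, `|S n x - x| <= 2 * (C + 1) * Num.max 0 (ht x)) ->
   (forall x, (ht x <= 0 -> U x = x) /\ (forall n, a n <= ht x -> U x = S n x)) ->
   continuous U.
  move=> cS dS hU x; have [h|/aS[n nx]] := leP (ht x) 0; last first.
    have xn : 0 < ht x - a n by rewrite subr_gt0.
    have [d d0 hd] := continuous_dist (@dotv_continuous _ u x) xn.
    apply: (near_continuous d0 _ (cS n x)) => y /hd xy.
    rewrite ((hU y).2 n) //; have := ler_norm (ht x - ht y); lra.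
  pose K := 1 + 2 * (C + 1) * (3 * enorm u).
  have K0 : 0 < K by rewrite ltr_wpDr // !mulr_ge0 ?addr_ge0 ?enorm_ge0.
  apply: dist_continuous => e e0; exists (e / K); first by rewrite divr_gt0.
  move=> y; rewrite ltr_pdivlMr // => xy; rewrite ((hU x).1 h).
  apply: le_lt_trans xy; rewrite mulrC /K mulrDl mul1r.
  apply: le_trans (ler_distD y _ _) _; rewrite lerD2l distrC.
  have [hy|hy] := leP (ht y) 0.
    by rewrite ((hU y).1 hy) subrr normr0 !mulr_ge0 ?addr_ge0 ?enorm_ge0.
  have [n /ltW ny] := aS _ hy; rewrite ((hU y).2 n ny).
  apply: le_trans (dS n y) _; rewrite (max_idPr (ltW hy)) -[leRHS]mulrA.
  rewrite ler_wpM2l ?mulr_ge0 ?addr_ge0 //.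
  apply: le_trans (_ : ht y - ht x <= _); first lra.
  by apply: le_trans (ler_norm _) _; rewrite (distrC x); exact: dotv_lip.
exists T, T'; split; first split.
- apply: (cont (fun n => (P n).1)) hT => n; first by case: (gP n) => -[].
  by move=> x; case: (gP n) => h c _; exact: cone_map_dist h c.
- apply: (cont (fun n => (P n).2)) hT' => n; first by case: (gP n) => -[].
  by move=> x; exact: cone_map_dist (invP n) (coneP n).
- move=> x; have [h|/aS[n /ltW nx]] := leP (ht x) 0.
    by rewrite (hT' (T x)).1 ?htT // (hT x).1.
  rewrite ((hT' (T x)).2 n) ?htT // ((hT x).2 n) //; by case: (gP n) => -[].
- move=> x; have [h|/aS[n /ltW nx]] := leP (ht x) 0.
    by rewrite (hT (T' x)).1 ?htT' // (hT' x).1.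
  rewrite ((hT (T' x)).2 n) ?htT' // ((hT' x).2 n) //; by case: (gP n) => -[].
- split=> // x xout; have [/(hT x).1//|/aS[n /ltW nx]] := leP (ht x) 0.
  by rewrite ((hT x).2 n nx); case: (gP n) => _ [_ ->].
- move=> i z z0z; have /andP[z1 _] := z0z.
  have hz : ht (z *: eta i z0) = z by rewrite dotvZl eta_height ?mulr1.
  have [n /ltW nz] := aS z z1.
  rewrite ((hT _).2 n) ?hz //; case: (gP n) => _ _ -> //.
  by rewrite (max_idPl nz).
Qed.

End Strands.
End Untwist.

(** * Narrow cones *)

Section Cones.
Variable R : realType.
Local Notation V := 'rV[R]_3.
Implicit Types (u v w x y a : V).

Definition within_cone a (kap : R) v := enorm (v - dotv v a *: a) <= kap * dotv v a.

Lemma within_cone0 a kap : within_cone a kap 0.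
Proof. by rewrite /within_cone dotv0l scale0r subrr enorm0 mulr0. Qed.

Lemma within_coneD a kap v w :
  within_cone a kap v -> within_cone a kap w -> within_cone a kap (v + w).
Proof.
rewrite /within_cone dotvDl scalerDl opprD addrACA mulrDr => hv hw.
by apply: le_trans (enormD _ _) _; rewrite lerD.
Qed.

Lemma within_coneZ a kap (t : R) v :
  0 <= t -> within_cone a kap v -> within_cone a kap (t *: v).
Proof.
move=> t0; rewrite /within_cone dotvZl -scalerA -scalerBr enormZ ger0_norm //.
by rewrite mulrCA => h; rewrite ler_wpM2l.
Qed.

Lemma within_coneN a kap v : within_cone a kap v -> within_cone (- a) kap (- v).
Proof.
by rewrite /within_cone dotvNl dotvNr opprK scalerN -opprD enormN.
Qed.

Lemma within_cone_dot_ge0 a kap v : 0 < kap -> within_cone a kap v -> 0 <= dotv v a.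
Proof. by move=> k0 h; rewrite -(pmulr_rge0 _ k0) (le_trans (enorm_ge0 _) h). Qed.

Lemma enorm_within_cone a kap v : enorm a = 1 -> within_cone a kap v ->
  0 <= dotv v a -> enorm v <= (1 + kap) * dotv v a.
Proof.
move=> a1 h d0; rewrite -{1}(subrK (dotv v a *: a) v).
by apply: le_trans (enormD _ _) _; rewrite enormZ a1 mulr1 ger0_norm //; move: h; rewrite /within_cone; lra.
Qed.

(** Two vectors in the same narrow cone add up almost without cancellation. *)
Lemma enorm_cone_add a kap v x : enorm a = 1 -> 0 < kap <= 4^-1 ->
  within_cone a kap v -> within_cone a kap x ->
  enorm x + dotv v a * (1 - 4 * kap) <= enorm (x + v).
Proof.
move=> a1 /andP[k0 k4] hv hx.
have al := within_cone_dot_ge0 k0 hv; have be := within_cone_dot_ge0 k0 hx.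
have nx := enorm_within_cone a1 hx be.
have dva : dotv v a <= enorm v by have := dotv_le v a; rewrite a1 mulr1.
set A := dotv v a in al dva *; set B := dotv x a in be nx.
have [->|x0] := eqVneq x 0; first by rewrite enorm0 !add0r; nra.
have ex : 0 < enorm x by rewrite enorm_gt0.
have key : A * B * (1 - 2 * kap - kap ^+ 2) <= dotv v x.
  have aa : dotv a a = 1 by rewrite -enorm_sq a1 expr1n.
  pose e := v - A *: a; pose f := x - B *: a.
  have ee : enorm e <= kap * A := hv; have ff : enorm f <= kap * B := hx.
  have ea : dotv e a = 0 by rewrite /e dotvBl dotvZl aa mulr1 subrr.
  have fa : dotv f a = 0 by rewrite /f dotvBl dotvZl aa mulr1 subrr.
  have -> : dotv v x = A * B + dotv e f.
    have vE : v = e + A *: a by rewrite /e subrK.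
    have xE : x = f + B *: a by rewrite /f subrK.
    clearbody e f; rewrite {1}vE {1}xE.
    rewrite !dotvDl !dotvDr !dotvZl !dotvZr ea (dotvC a f) fa aa; ring.
  have : - (enorm e * enorm f) <= dotv e f.
    by have := normr_dotv_le e f; rewrite ler_norml => /andP[].
  have : enorm e * enorm f <= (kap * A) * (kap * B).
    by rewrite ler_pM ?enorm_ge0.
  have AB : 0 <= A * B by rewrite mulr_ge0.
  have : 0 <= A * B * kap by rewrite mulr_ge0 // ltW.
  lra.
have : A * (1 - 4 * kap) * enorm x <= dotv v x.
  apply: le_trans key; apply: le_trans (_ : A * (1 - 4 * kap) * ((1 + kap) * B) <= _).
    by rewrite ler_wpM2l // mulr_ge0 //; lra.
  have AB : 0 <= A * B by rewrite mulr_ge0.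
  have : 0 <= A * B * kap by rewrite mulr_ge0 // ltW.
  have : 0 <= A * B * kap * kap by rewrite !mulr_ge0 // ltW.
  lra.
move=> h; rewrite -(ler_pM2r ex) mulrDl.
have := dotv_le (x + v) x; rewrite dotvDl -enorm_sq; lra.
Qed.

End Cones.

(** * Tilting rays *)

Section Lean.
Variable R : realType.
Local Notation V := 'rV[R]_3.
Implicit Types (x y : V).
Variables (u : V) (c : R).
Hypotheses (u1 : enorm u = 1) (c0 : 0 < c) (c1 : c < 1).

(** [lean] tilts every ray from the origin towards [u] and keeps it straight.
    If [c] is close to [1], then only rays close to that of [- u] stay out of the
    half-space [0 < dotv _ u]. *)
Definition lean x := x + (c * enorm x) *: u.

(** The Euclidean norm of the preimage of [y], as the nonnegative root of a quadratic
    equation. *)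
Definition lean_radius y :=
  (1 - c ^+ 2)^-1 *
  (Num.sqrt ((c * dotv y u) ^+ 2 + (1 - c ^+ 2) * dotv y y) - c * dotv y u).

Definition unlean y := y - (c * lean_radius y) *: u.

Let uu : dotv u u = 1. Proof. by rewrite -enorm_sq u1 expr1n. Qed.

Let cc : 0 < 1 - c ^+ 2. Proof. by rewrite subr_gt0 expr_lt1 // ltW. Qed.

Let disc_ge0 y : 0 <= (c * dotv y u) ^+ 2 + (1 - c ^+ 2) * dotv y y.
Proof. by rewrite addr_ge0 ?sqr_ge0 // mulr_ge0 ?dotv_ge0 // ltW. Qed.

Lemma lean_height x : dotv (lean x) u = dotv x u + c * enorm x.
Proof. by rewrite /lean dotvDl dotvZl uu mulr1. Qed.

Lemma leanZ (t : R) x : 0 <= t -> lean (t *: x) = t *: lean x.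
Proof.
move=> t0; rewrite /lean enormZ ger0_norm // scalerDr scalerA mulrCA.
by rewrite mulrA.
Qed.

Lemma lean0 : lean 0 = 0.
Proof. by rewrite -(scale0r (0 : V)) leanZ // !scale0r. Qed.

Lemma lean_radius_lean x : lean_radius (lean x) = enorm x.
Proof.
rewrite /lean_radius lean_height.
have -> : dotv (lean x) (lean x) =
    enorm x ^+ 2 + 2 * c * enorm x * dotv x u + c ^+ 2 * enorm x ^+ 2.
  rewrite {2}/lean dotvDr dotvZr lean_height /lean dotvDl dotvZl (dotvC u) enorm_sq.
  by rewrite -enorm_sq; ring.
set r := enorm x; set h := dotv x u.
have -> : (c * (h + c * r)) ^+ 2 + (1 - c ^+ 2) * (r ^+ 2 + 2 * c * r * h + c ^+ 2 * r ^+ 2)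
   = (r + c * h) ^+ 2 by ring.
have hr : `|h| <= r by have := normr_dotv_le x u; rewrite u1 mulr1.
have r0 : 0 <= r by exact: enorm_ge0.
rewrite sqrtr_sqr ger0_norm; last first.
  have : - r <= h by move: hr; rewrite ler_norml => /andP[].
  have := c1; have := c0; nra.
by field; exact: lt0r_neq0.
Qed.

Lemma leanK : cancel lean unlean.
Proof. by move=> x; rewrite /unlean lean_radius_lean /lean addrK. Qed.

Lemma unleanK : cancel unlean lean.
Proof.
move=> y; set r := lean_radius y.
have D : (1 - c ^+ 2) * r = Num.sqrt ((c * dotv y u) ^+ 2 + (1 - c ^+ 2) * dotv y y)
    - c * dotv y u.
  by rewrite mulrA mulfV ?mul1r // lt0r_neq0.
have r0 : 0 <= r.
  rewrite -(pmulr_rge0 _ cc) D subr_ge0.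
  apply: le_trans (ler_norm _) _; rewrite -sqrtr_sqr ler_sqrt ?disc_ge0 //.
  by rewrite lerDl mulr_ge0 ?dotv_ge0 // ltW.
have Q : (1 - c ^+ 2) * r ^+ 2 + 2 * c * dotv y u * r = dotv y y.
  have := sqr_sqrtr (disc_ge0 y).
  have <- : (1 - c ^+ 2) * r + c * dotv y u =
     Num.sqrt ((c * dotv y u) ^+ 2 + (1 - c ^+ 2) * dotv y y) by rewrite D subrK.
  move=> E; apply: (mulfI (lt0r_neq0 cc)).
  move: E; set S := dotv y y; set h := dotv y u; set d := 1 - c ^+ 2 => E.
  have -> : d * S = (d * r + c * h) ^+ 2 - (c * h) ^+ 2 by rewrite E; ring.
  ring.
have E : enorm (unlean y) = r.
  apply/eqP; rewrite -(@eqrXn2 _ 2) ?enorm_ge0 // enorm_sq /unlean -/r.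
  rewrite dotvBl !dotvBr !dotvZl !dotvZr uu (dotvC u) -Q; apply/eqP; ring.
by rewrite /lean E /unlean subrK.
Qed.

Lemma lean_continuous : continuous lean.
Proof.
apply: (@lip_continuous _ _ _ _ (1 + c * 3 * enorm u)) => x y.
rewrite /lean opprD addrACA -scalerBl -mulrBr mulrDl mul1r.
apply: le_trans (ler_normD _ _) _; rewrite lerD2l normrZ normrM (gtr0_norm c0).
have := enorm_lip x y; have := norm_le_enorm u; rewrite u1.
have := normr_ge0 (enorm x - enorm y); have := normr_ge0 u; have := c0 => h1 h2 h3 h4 h5.
rewrite mulr1; apply: le_trans (_ : c * `|enorm x - enorm y| * 1 <= _).
  by rewrite ler_wpM2l // mulr_ge0 // ltW.
by rewrite mulr1 -mulrA ler_wpM2l // ltW.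
Qed.

Lemma unlean_continuous : continuous unlean.
Proof.
move=> y; have ch : (fun y : V => c * dotv y u) @ y --> c * dotv y u.
  exact: (cvgM (@cst_continuous V R c y) (@dotv_continuous _ u y)).
have cn : (fun y : V => dotv y y) @ y --> dotv y y.
  have -> : (fun y : V => dotv y y) = (fun y => enorm y * enorm y).
    by apply/funext => z; rewrite -enorm_sq expr2.
  rewrite -enorm_sq expr2.
  exact: (cvgM (@enorm_continuous _ y) (@enorm_continuous _ y)).
have cr : lean_radius @ y --> lean_radius y.
  apply: (cvgM (@cst_continuous V R _ y)).
  have cd : (fun y : V => (c * dotv y u) ^+ 2 + (1 - c ^+ 2) * dotv y y) @ y -->
            (c * dotv y u) ^+ 2 + (1 - c ^+ 2) * dotv y y.
    by rewrite !expr2; exact: (cvgD (cvgM ch ch) (cvgM (@cst_continuous V R _ y) cn)).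
  exact: (cvgB (cvg_comp _ _ cd (@sqrt_continuous R _)) ch).
have cid : (fun y : V => y) @ y --> y by exact: cvg_id.
have cs : (fun y : V => c * lean_radius y) @ y --> c * lean_radius y.
  exact: (cvgM (@cst_continuous V R c y) cr).
have cz : (fun y : V => (c * lean_radius y) *: u) @ y --> (c * lean_radius y) *: u.
  exact: @cvgZ R V V (nbhs y) _ (fun y => c * lean_radius y) (fun=> u) _ _ cs
  (@cst_continuous V V u y).
exact: (@cvgB R V V (nbhs y) (@nbhs_filter V y) (fun y => y) _ _ _ cid cz).
Qed.

Lemma lean_inverse : inverse_maps lean unlean.
Proof.
split; [exact: lean_continuous|exact: unlean_continuous|exact: leanK|exact: unleanK].
Qed.

Lemma enorm_lean x : (1 - c) * enorm x <= enorm (lean x) <= 2 * enorm x.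
Proof.
have cx : enorm ((c * enorm x) *: u) = c * enorm x.
  by rewrite enormZ u1 mulr1 ger0_norm // mulr_ge0 ?enorm_ge0 // ltW.
have x0 := enorm_ge0 x; apply/andP; split.
  have := enorm_distD x (- ((c * enorm x) *: u)).
  by rewrite enormN cx opprK -/(lean x); lra.
have := enormD x ((c * enorm x) *: u); rewrite cx -/(lean x).
have := c1; nra.
Qed.

End Lean.

(** * Straightening a star of arcs *)

Section Star.
Variable R : realType.
Local Notation V := 'rV[R]_3.

Lemma IVT_itv (f : R -> R) (a b v : R) : a <= b -> continuous f ->
  f a <= v <= f b -> exists2 t, a <= t <= b & f t = v.
Proof.
move=> ab cf /andP[av vb].
have [||t tab ft] := @IVT R f a b v ab; last by exists t => //; rewrite in_itv in tab.
  by apply: continuous_subspaceT.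
by rewrite ge_min av le_max vb orbT.
Qed.

(** The quantity [dotv (lean c u (x - p)) u] is strictly increasing along each
    branch, so it may serve as the height in [untwist]; tilting by [lean] turns the
    branches, which leave [p] in all directions, into a bundle of strands that
    cross every level plane once. *)
Lemma star_straighten (I : finType) (p : V) (b : I -> R -> V) (a : I -> V)
    (u : V) (mu : R) :
  enorm u = 1 -> 0 < mu <= 1 ->
  (forall i, enorm (a i) = 1) -> (forall i, mu - 1 <= dotv (a i) u) ->
  (forall i, continuous (b i)) -> (forall i, b i 0 = p) ->
  (forall i (s t : R), 0 <= s -> s < t -> t <= 1 ->
     b i s != b i t /\ within_cone (a i) (mu / 32) (b i t - b i s)) ->
  (forall i j (s t : R), 0 < s < 1 -> 0 < t < 1 -> b i s = b j t -> i = j) ->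
  forall r : R, 0 < r -> exists (h : V -> V) (s0 : I -> R) (lam : I -> R -> R),
    [/\ tame_homeo h, h p = p, forall x, r <= `|x - p| -> h x = x &
      forall i, [/\ 0 < s0 i < 3^-1, `|b i (s0 i) - p| < r,
        [/\ lam i 0 = 0, lam i (s0 i) = 1 &
         forall s t, 0 <= s -> s < t -> t <= s0 i -> lam i s < lam i t],
        forall s, 0 <= s <= s0 i -> h (b i s) = p + lam i s *: (b i (s0 i) - p) &
        forall s, s0 i <= s <= 1 -> h (b i s) = b i s]].
Proof.
move=> u1 /andP[mu0 mu1] a1 au bc b0 chord bneq r r0.
(* The height gains [c * A] from the tilt and loses at most [(1 - mu) * A] by the direction
   of the branch, up to errors of order [mu / 32], where [A] is the component of a chord
   along the axis; with this [c] the gain prevails by a multiple of [mu]. *)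
pose c := 1 - mu / 4; pose nu := mu / 4.
have c_gt0 : 0 < c by rewrite /c; lra.
have c_lt1 : c < 1 by rewrite /c; lra.
have nu0 : 0 < nu by rewrite divr_gt0.
pose F (x : V) := lean u c (x - p).
pose zf i s := dotv (F (b i s)) u.
have FE x : dotv (F x) u = dotv (x - p) u + c * enorm (x - p) by exact: lean_height.
have fromp i (s : R) : 0 <= s <= 1 -> within_cone (a i) (mu / 32) (b i s - p).
  rewrite le_eqVlt => /andP[/orP[/eqP<- _|s0 s1]].
    by rewrite b0 subrr; exact: within_cone0.
  by rewrite -(b0 i); apply: (chord _ _ _ _ _ _).2.
have inc i (s t : R) : 0 <= s -> s < t -> t <= 1 ->
    nu * enorm (b i t - b i s) <= zf i t - zf i s.
  move=> s0 st t1; have [_ hv] := chord i s t s0 st t1.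
  have hx : within_cone (a i) (mu / 32) (b i s - p).
    by apply: fromp; rewrite s0 (le_trans (ltW st)).
  have k0 : 0 < mu / 32 <= 4^-1 by apply/andP; split; lra.
  have k1 : 0 < mu / 32 by case/andP: k0.
  have := enorm_cone_add (a1 i) k0 hv hx.
  have al := within_cone_dot_ge0 k1 hv.
  have nv := enorm_within_cone (a1 i) hv al.
  have -> : b i s - p + (b i t - b i s) = b i t - p by rewrite addrC addrA subrK.
  rewrite /zf !FE.
  have -> : dotv (b i t - p) u = dotv (b i s - p) u + dotv (b i t - b i s) u.
    by rewrite -dotvDl [b i s - p + _]addrC addrA subrK.
  move: hv al nv; set v := b i t - b i s; set A := dotv v (a i) => hv al nv hadd.
  have vu : A * (mu - 1) - mu / 32 * A <= dotv v u.
    rewrite -[X in dotv X u](subrK (A *: a i) v) dotvDl dotvZl.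
    have := normr_dotv_le (v - A *: a i) u; rewrite u1 mulr1 ler_norml.
    move=> /andP[h _]; have := ler_wpM2l al (au i).
    by move: hv; rewrite /within_cone -/A; lra.
  have h1 : nu * enorm v <= nu * (2 * A).
    rewrite ler_wpM2l ?(ltW nu0) // (le_trans nv) //.
    by rewrite ler_wpM2r //; lra.
  have h2 : c * (enorm (b i s - p) + A * (1 - 4 * (mu / 32))) <= c * enorm (b i t - p).
    by rewrite ler_wpM2l // ltW.
  have h3 : 0 <= A * mu by rewrite mulr_ge0 // ltW.
  have h4 : A * mu * mu <= A * mu by rewrite ler_piMr.
  have h5 : 0 <= A * mu * mu by rewrite mulr_ge0 // ltW.
  move: h1 h2; rewrite /nu /c; lra.
have incs i (s t : R) : 0 <= s -> s < t -> t <= 1 -> zf i s < zf i t.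
  move=> s0 st t1; rewrite -subr_gt0; apply: lt_le_trans (inc i s t s0 st t1).
  rewrite mulr_gt0 // enorm_gt0 subr_eq0 eq_sym.
  by case: (chord i s t s0 st t1).
have zf0 i : zf i 0 = 0 by rewrite /zf FE b0 subrr dotv0l enorm0 mulr0 addr0.
have zfc i : continuous (zf i).
  move=> s.
  have cF : {for b i s - p, continuous (lean u c)}.
    exact: (lean_continuous u1 c_gt0).
  have c1 : (fun s => b i s - p) @ s --> b i s - p.
    exact: (cvgB (bc i s) (@cst_continuous R V p s)).
  have c2 : (fun s => F (b i s)) @ s --> F (b i s) by exact: (cvg_comp _ _ c1 cF).
  exact: (cvg_comp _ _ c2 (@dotv_continuous R u _)).
(* [C] bounds the strands after division by their height, and points of the cone of
   [untwist] below height [z0] come from points at distance less than [K * z0] of [p]. *)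
pose C := 2 / nu; have C0 : 0 <= C by rewrite divr_ge0 // ltW.
have c1' : 0 < 1 - c by rewrite subr_gt0.
pose K := 3 * (C + 1) / (1 - c).
have K0 : 0 < K by rewrite divr_gt0 // mulr_gt0 // ltr_wpDl.
have [z0 z0_gt0 [z0zf z0r]] : exists2 z0 : R, 0 < z0 & (forall i, z0 < zf i 3^-1) /\ K * z0 <= r.
  have [z1 z1_gt0 z1zf] : exists2 z0 : R, 0 < z0 & forall i, z0 < zf i 3^-1.
    apply: (@small_forall R I (fun i z => z < zf i 3^-1)).
      by move=> i d d' /andP[_]; exact: le_lt_trans.
    move=> i; have : 0 < zf i 3^-1 by rewrite -(zf0 i) incs //; lra.
    by exists (zf i 3^-1 / 2); lra.
  exists (Num.min z1 (r / K)); first by rewrite lt_min z1_gt0 divr_gt0.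
  split; first by move=> i; rewrite gt_min z1zf.
  by rewrite mulrC -ler_pdivlMr // ge_min lexx orbT.
have exs (iz : I * R) : exists s, 0 <= iz.2 <= z0 -> 0 <= s <= 3^-1 /\ zf iz.1 s = iz.2.
  case: iz => i z /=; have [/andP[z1 z2]|nz] := boolP (0 <= z <= z0); last by exists 0.
  have [||s s1 sz] := @IVT_itv (zf i) 0 3^-1 z _ (zfc i).
  - by lra.
  - by rewrite zf0 z1 (le_trans z2) // ltW.
  by exists s.
have [sg sgP] := choice exs.
pose m (z : R) := Num.min z z0.
have mP (z : R) : 0 < z -> 0 < m z <= z0 by move=> z_gt0; rewrite lt_min z_gt0 z0_gt0 ge_min lexx orbT.
pose B i z := b i (sg (i, m z)).
have sP i (z : R) : 0 < z -> [/\ 0 < sg (i, m z), sg (i, m z) <= 3^-1 & zf i (sg (i, m z)) = m z].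
  move=> /mP/andP[m0 mz]; have [|/andP[s1 s2] sE] := sgP (i, m z); first by rewrite /= ltW.
  split=> //; rewrite lt_neqAle s1 andbT; apply/eqP => s0.
  by move: sE; rewrite /= -s0 zf0 => E; move: m0; rewrite -E ltxx.
have third : 3^-1 <= 1 :> R by lra.
have third' : 3^-1 < 1 :> R by lra.
have Blip i (z z' : R) : 0 < z -> 0 < z' -> `|B i z - B i z'| <= nu^-1 * `|z - z'|.
  move=> z1 z1'; have [s1 s2 s3] := sP i z z1; have [s1' s2' s3'] := sP i z' z1'.
  apply: le_trans (norm_le_enorm _) _; rewrite ler_pdivlMl //.
  have mm : `|m z - m z'| <= `|z - z'| by rewrite /m !(minC _ z0); exact: min_lip.
  apply: le_trans mm; rewrite -s3 -s3' /B.
  move: s1 s2 s1' s2'; set s := sg (i, m z); set s' := sg _ => s1 s2 s1' s2'.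
  have [ss|ss|->] := ltgtP s s'; last by rewrite !subrr enorm0 mulr0 normr0.
    rewrite enormB (distrC (zf i s)); apply: le_trans (ler_norm _).
    by apply: inc => //; [exact: ltW|exact: le_trans s2' third].
  apply: le_trans (ler_norm _).
  by apply: inc => //; [exact: ltW|exact: le_trans s2 third].
(* [B i z] is the point of the branch at height [z]; [m] only serves to define it for all
   positive [z]. *)
pose eta i z := (m z)^-1 *: F (B i z).
have [T [T' [TT' cT straight]]] : exists T T', [/\ inverse_maps T T', cone_map u z0 C T &
    forall i (z : R), 0 < z <= z0 -> T (z *: eta i z0) = z *: eta i z].
  apply: (@untwist R u z0 C I eta z0_gt0 C0).
  - move=> i z z1; have [_ _ E] := sP i z z1; have /andP[m0 _] := mP z z1.
    by rewrite dotvZl -/(zf i _) E mulVf // gt_eqF.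
  - move=> i z z1; have [s1 s2 s3] := sP i z z1; have /andP[m0 _] := mP z z1.
    apply: le_trans (norm_le_enorm _) _; rewrite /eta enormZ gtr0_norm ?invr_gt0 //.
    rewrite ler_pdivrMl // mulrC /C -mulrA; apply: le_trans (_ : 2 * enorm (B i z - p) <= _).
      by have /andP[] := enorm_lean u1 c_gt0 c_lt1 (B i z - p).
    rewrite ler_wpM2l // ler_pdivlMl // -s3 -[leRHS]subr0 -(zf0 i) -(b0 i).
    by apply: inc => //; lra.
  - move=> i j z z1 ij; have [s1 s2 s3] := sP i z z1; have [t1 t2 t3] := sP j z z1.
    have /andP[m0 _] := mP z z1.
    have m1 : (m z)^-1 != 0 by rewrite invr_eq0 lt0r_neq0.
    apply/eqP => E; have /(can_inj (leanK u1 c_gt0 c_lt1))/addIr E2 : F (B i z) = F (B j z).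
      exact: (scalerI m1 E).
    move: ij; rewrite (bneq i j (sg (i, m z)) (sg (j, m z))) ?eqxx //; last first.
      by rewrite t1 (le_lt_trans t2 third').
    by rewrite s1 (le_lt_trans s2 third').
  - move=> i z z1.
    have cB : B i @ z --> B i z.
      apply: dist_continuous => e e0; exists (Num.min z (nu * e)).
        by rewrite lt_min z1 mulr_gt0.
      move=> y; rewrite lt_min => /andP[zy1 zy2].
      apply: le_lt_trans (Blip i z y z1 _) _.
        by have := ler_norm (z - y); lra.
      by rewrite mulrC ltr_pdivrMr // mulrC.
    have cF : {for B i z - p, continuous (lean u c)}.
      exact: (lean_continuous u1 c_gt0).
    have c1 : (fun z => B i z - p) @ z --> B i z - p.
      exact: (cvgB cB (@cst_continuous R V p z)).
    have c2 : (fun z => F (B i z)) @ z --> F (B i z) by exact: (cvg_comp _ _ c1 cF).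
    have cm : (fun z => (m z)^-1) @ z --> (m z)^-1.
      have mz : m z != 0 by have /andP[/lt0r_neq0] := mP z z1.
      have cm0 : m @ z --> m z.
        apply: (@lip_continuous R R R m 1) => x y.
        by rewrite mul1r /m !(minC _ z0) min_lip.
      exact: (cvgV mz cm0).
    exact: (@cvgZ R V R (nbhs z) _ (fun z => (m z)^-1) (fun z => F (B i z)) _ _ cm c2).
have [cT' cTT' K1 K2] := TT'.
(* [T'] makes the tilted branches straight, and [unlean] maps rays to rays. *)
pose h x := unlean u c (T' (F x)) + p.
have oT' x : r <= `|x - p| -> T' (F x) = F x.
  move=> xr; apply: (cone_map_inv TT' cT).2 => -[/andP[_ fz]] fx.
  suff : `|x - p| < r by rewrite ltNge xr.
  apply: lt_le_trans z0r; apply: le_lt_trans (norm_le_enorm _) _.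
  have /andP[l1 _] := enorm_lean u1 c_gt0 c_lt1 (x - p).
  rewrite /K mulrAC ltr_pdivlMr // mulrC; apply: le_lt_trans l1 _.
  apply: le_lt_trans (enorm_le_norm _) _; rewrite -mulrA ltr_pM2l //.
  by apply: lt_le_trans fx _; rewrite ler_wpM2l ?addr_ge0 // ltW.
have unF x : unlean u c (F x) + p = x by rewrite leanK // subrK.
(* The branch [i] is straight up to the parameter at which it reaches the height [z0];
   on that part its height, divided by [z0], is its affine parameter on the segment. *)
exists h, (fun i => sg (i, z0)), (fun i s => zf i s / z0).
have mz0 : m z0 = z0 by rewrite /m minxx.
have hfix x : T' (F x) = F x -> h x = x by move=> E; rewrite /h E unF.
have hp : h p = p.
  have F0 : F p = 0 by rewrite /F subrr lean0.
  apply: hfix; apply: (cone_map_inv TT' cT).2 => -[/andP[]].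
  by rewrite F0 dotv0l ltxx.
split.
- have hI : inverse_maps h (fun x => unlean u c (T (F x)) + p).
    have tr (q : V) : inverse_maps (fun x => x + q) (fun x => x - q).
      split=> [x|x|x|x]; rewrite ?addrK ?subrK //.
        by apply: (@lip_continuous _ _ _ _ 1) => y z; rewrite mul1r opprD addrACA subrr addr0.
      by apply: (@lip_continuous _ _ _ _ 1) => y z; rewrite mul1r opprB addrA subrK.
    have FI := inverse_maps_comp (lean_inverse u1 c_gt0 c_lt1) (inverse_maps_sym (tr p)).
    exact: inverse_maps_comp (inverse_maps_sym FI) (inverse_maps_comp (inverse_maps_sym TT') FI).
  exists (fun x => unlean u c (T (F x)) + p), (2 * r); split => // x.
  have [xr|xr] := leP r `|x - p|.
    by rewrite hfix ?oT' // subrr normr0 mulr_ge0 // ltW.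
  have [hr|hr] := leP r `|h x - p|.
    have := hfix _ (oT' _ hr); have [_ _ Kh _] := hI => /(can_inj Kh) ->.
    by rewrite subrr normr0 mulr_ge0 // ltW.
  have := ler_distD p (h x) x; rewrite (distrC p); lra.
- exact: hp.
- by move=> x /oT'/hfix.
- move=> i; have [s1 s2 s3] := sP i z0 z0_gt0; rewrite mz0 in s1 s2 s3.
  have s4 : sg (i, z0) < 3^-1.
    rewrite lt_neqAle s2 andbT; apply/eqP => E.
    by have := z0zf i; rewrite -{1}s3 E ltxx.
  split.
  + by rewrite s1.
  + apply: le_lt_trans (norm_le_enorm _) _; apply: lt_le_trans z0r.
    have : nu * enorm (b i (sg (i, z0)) - p) <= z0.
      by rewrite -{2}s3 -[leRHS]subr0 -(zf0 i) -(b0 i); apply: inc => //; lra.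
    rewrite mulrC -ler_pdivlMr // => /le_lt_trans; apply.
    rewrite mulrC ltr_pM2r // /K.
    rewrite ltr_pdivlMr // /C; have : 0 < nu^-1 by rewrite invr_gt0.
    by rewrite /c; nra.
  + split; first by rewrite zf0 mul0r.
      by rewrite s3 mulfV // gt_eqF.
    move=> s t h1 h2 h3; rewrite ltr_pM2r ?invr_gt0 //; apply: incs => //; lra.
  + move=> s /andP[]; rewrite le_eqVlt => /orP[/eqP<- _|h1 h2].
      by rewrite b0 zf0 mul0r scale0r addr0.
    have z1 : 0 < zf i s by rewrite -(zf0 i) incs //; lra.
    have z2 : zf i s <= z0.
      move: h2; rewrite le_eqVlt => /orP[/eqP->|h2]; first by rewrite s3.
      by rewrite -s3 ltW // incs //; lra.
    have sE : sg (i, zf i s) = s.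
      have [t1 t2] := sP i (zf i s) z1; rewrite /m (min_idPl z2) => t3.
      have t2' : sg (i, zf i s) <= 3^-1 by move: t2; rewrite /m (min_idPl z2).
      have t1' : 0 < sg (i, zf i s) by move: t1; rewrite /m (min_idPl z2).
      move: t1' t2' t3; set q := sg _ => t1' t2' t3.
      have s1' : s <= 1 by apply: le_trans third; apply: le_trans s2.
      have [qs|qs|//] := ltgtP q s.
        by have := incs i q s (ltW t1') qs s1'; rewrite t3 ltxx.
      by have := incs i s q (ltW h1) qs (le_trans t2' third); rewrite t3 ltxx.
    have e1 : F (b i s) = zf i s *: eta i (zf i s).
      rewrite /eta /B /m (min_idPl z2) sE scalerA mulfV ?scale1r //.
      by rewrite gt_eqF.
    rewrite /h e1 -straight ?z1 // K1 /eta mz0 scalerA /B mz0 -leanZ; last first.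
      by rewrite divr_ge0 // ltW.
    by rewrite leanK // addrC.
  + move=> s /andP[h1 h2]; apply: hfix; apply: (cone_map_inv TT' cT).2.
    move=> -[/andP[_]]; rewrite -/(zf i s) -s3 ltNge.
    move: h1; rewrite le_eqVlt => /orP[/eqP->|h1]; first by rewrite lexx.
    by rewrite ltW // incs //; lra.
Qed.

End Star.

(** * Subdivisions and their chords *)

Section Subdivision.
Variable R : realType.
Local Notation V := 'rV[R]_3.

(** Composition with this retraction extends an arc given on the unit interval
    continuously to the line. *)
Definition clamp01 (s : R) := Num.max 0 (Num.min 1 s).

Lemma clamp01_itv s : 0 <= clamp01 s <= 1.
Proof. by rewrite /clamp01 le_max lexx ge_max ler01 ge_min lexx. Qed.

Lemma clamp01_id s : 0 <= s <= 1 -> clamp01 s = s.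
Proof. by move=> /andP[s0 s1]; rewrite /clamp01 (min_idPr s1) (max_idPr s0). Qed.

Lemma clamp01_lip s s' : `|clamp01 s - clamp01 s'| <= `|s - s'|.
Proof. exact: le_trans (max_lip _ _ _) (min_lip _ _ _). Qed.

Lemma within01_dist (f : R -> V) : {within `[0, 1], continuous f} <->
  (forall x e : R, 0 <= x <= 1 -> 0 < e -> exists2 d, 0 < d &
    forall y, 0 <= y <= 1 -> `|x - y| < d -> `|f x - f y| < e).
Proof.
rewrite subspace_continuousP; split=> h x.
  move=> e x01 e0; have /cvgrPdist_lt/(_ e e0) : f @ within `[0, 1] (nbhs x) --> f x.
    by apply: h; rewrite /= in_itv.
  rewrite near_withinE => /nbhs_normP[d d0 hd]; exists d => // y y01 xy.
  by apply: hd => //; rewrite /= in_itv.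
rewrite /= in_itv /= => x01; apply/cvgrPdist_lt => e e0.
have [d d0 hd] := h x e x01 e0.
rewrite near_withinE; apply/nbhs_normP; exists d => // y xy.
by rewrite /= in_itv /= => y01; apply: hd.
Qed.

Lemma clamp01_continuous (f : R -> V) :
  {within `[0, 1], continuous f} -> continuous (f \o clamp01).
Proof.
move=> /within01_dist h x; apply: dist_continuous => e e0.
have [d d0 hd] := h (clamp01 x) e (clamp01_itv x) e0; exists d => // y xy.
apply: hd; first exact: clamp01_itv.
exact: le_lt_trans (clamp01_lip _ _) xy.
Qed.

Definition chain (n : nat) (t : nat -> R) :=
  [/\ t 0 = 0, t n.+1 = 1 & forall k, (k <= n)%N -> t k < t k.+1].

Lemma chain_lt n t (i j : nat) : chain n t -> (i < j)%N -> (j <= n.+1)%N -> t i < t j.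
Proof.
move=> [_ _ inc]; elim: j => // j IH; rewrite ltnS leq_eqVlt.
move=> /predU1P[->|ij] jn; first exact: inc.
by apply: lt_trans (IH ij (ltnW jn)) _; apply: inc.
Qed.

Lemma chain_le n t (i j : nat) : chain n t -> (i <= j)%N -> (j <= n.+1)%N -> t i <= t j.
Proof.
move=> ct; rewrite leq_eqVlt => /predU1P[->//|ij] jn.
by apply: ltW; exact: chain_lt ct ij jn.
Qed.

Section Graph.
Variable G : sgraph R.
Hypothesis contG : continuous_graph G.

Lemma garc01 (e : gedge G) (b : bool) : garc e (b%:R) = gpos (gend (e, b)).
Proof. by case: contG => _ /(_ e)[_ g0 g1] _ _ _; case: b. Qed.

(** The points in the open edges are simple even when the other point may be an end. *)
Lemma garc_interior_inj (e e' : gedge G) (s s' : R) :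
  0 <= s <= 1 -> 0 < s' < 1 -> garc e s = garc e' s' -> e = e' /\ s = s'.
Proof.
case: contG => _ ends _ avoid inj /andP[s0 s1] s'01 E.
have s'in : s' \in `]0, 1[ by rewrite in_itv.
have [es0|ns0] := eqVneq s 0.
  by case: (avoid e' s' (gend (e, false)) s'in); rewrite -E es0; case: (ends e).
have [es1|ns1] := eqVneq s 1.
  by case: (avoid e' s' (gend (e, true)) s'in); rewrite -E es1; case: (ends e).
apply: inj => //; rewrite in_itv /= !lt_neqAle s0 s1 ns1 eq_sym ns0 //.
Qed.

End Graph.

Section Sub.
Variables (G : sgraph R) (n : gedge G -> nat) (t : gedge G -> nat -> R).

(** The [k]-th cut point of [e]; the first and the last one are vertices of [G]. *)
Definition node (e : gedge G) (k : nat) : gvert G + {e : gedge G & 'I_(n e)} :=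
  if k is k'.+1 then
    if (insub k' : option 'I_(n e)) is Some j then inr (existT (fun e => 'I_(n e)) _ j)
    else inl (gend (e, true))
  else inl (gend (e, false)).

(** The edge [e] of [G] is cut at the parameters [t e 1 < ... < t e (n e)], and the
    [k]-th piece runs from [node e k] to [node e k.+1]. *)
Definition subdivision : sgraph R :=
  @SGraph R (gvert G + {e : gedge G & 'I_(n e)})%type {e : gedge G & 'I_(n e).+1}
    (fun h => node (tag h.1) (tagged h.1 + h.2))
    (fun v => match v with
              | inl v => gpos v
              | inr x => garc (tag x) (t (tag x) (tagged x).+1)
              end)
    (fun x s => garc (tag x) (t (tag x) (tagged x) +
       s * (t (tag x) (tagged x).+1 - t (tag x) (tagged x)))).

Definition cuts := forall e : gedge G, chain (n e) (t e).

Lemma nodeS e (j : 'I_(n e)) : node e j.+1 = inr (existT (fun e => 'I_(n e)) _ j).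
Proof. by rewrite /node valK. Qed.

Lemma node_last e : node e (n e).+1 = inl (gend (e, true)).
Proof. by rewrite /node insubF // ltnn. Qed.

Variant node_spec e : nat -> gvert G + {e : gedge G & 'I_(n e)} -> Type :=
  | NodeFirst : node_spec e 0 (inl (gend (e, false)))
  | NodeInner (j : 'I_(n e)) : node_spec e j.+1 (inr (existT (fun e => 'I_(n e)) _ j))
  | NodeLast : node_spec e (n e).+1 (inl (gend (e, true))).

Lemma nodeP e k : (k <= (n e).+1)%N -> node_spec e k (node e k).
Proof.
case: k => [_|k]; first exact: NodeFirst.
rewrite ltnS; case: ltngtP => // [kn _|-> _]; last by rewrite node_last; exact: NodeLast.
by have := NodeInner (Ordinal kn); rewrite -nodeS.
Qed.

Section Cuts.
Hypotheses (contG : continuous_graph G) (cutT : cuts).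

Lemma cut_lt e i j : (i < j)%N -> (j <= (n e).+1)%N -> t e i < t e j.
Proof. exact: chain_lt. Qed.

Lemma cut_le e i j : (i <= j)%N -> (j <= (n e).+1)%N -> t e i <= t e j.
Proof. exact: chain_le. Qed.

Lemma cut_itv e k : (k <= (n e).+1)%N -> 0 <= t e k <= 1.
Proof.
case: (cutT e) => t0 t1 _ kn; rewrite -{1}t0 -t1; apply/andP.
by split; apply: cut_le.
Qed.

Lemma cut_oo e (j : 'I_(n e)) : 0 < t e j.+1 < 1.
Proof.
case: (cutT e) => t0 t1 _; rewrite -{1}t0 -t1; apply/andP.
by split; apply: cut_lt => //; rewrite ltnS // ltnW.
Qed.

Lemma gpos_node e k : (k <= (n e).+1)%N ->
  @gpos _ subdivision (node e k) = garc e (t e k).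
Proof.
move=> kn; case: (cutT e) => t0 t1 _; case: (nodeP kn) => //=.
  by rewrite t0 -(garc01 contG).
by rewrite t1 -(garc01 contG).
Qed.

Lemma piece_itv e k (s : R) : (k <= n e)%N -> 0 <= s <= 1 ->
  t e k <= t e k + s * (t e k.+1 - t e k) <= t e k.+1.
Proof.
move=> kn /andP[s0 s1]; have := @cut_lt e k k.+1 (leqnn _) kn; nra.
Qed.

Lemma piece_oo e k (s : R) : (k <= n e)%N -> 0 < s < 1 ->
  t e k < t e k + s * (t e k.+1 - t e k) < t e k.+1.
Proof.
move=> kn /andP[s0 s1]; have := @cut_lt e k k.+1 (leqnn _) kn; nra.
Qed.

Lemma piece_in01 e k (s : R) : (k <= n e)%N -> 0 <= s <= 1 ->
  0 <= t e k + s * (t e k.+1 - t e k) <= 1.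
Proof.
move=> kn /(piece_itv kn)/andP[h1 h2].
have /andP[h3 _] := @cut_itv e k (leqW kn); have /andP[_ h4] := @cut_itv e k.+1 kn.
by rewrite (le_trans h3) // (le_trans h2).
Qed.

Lemma piece_in_oo e k (s : R) : (k <= n e)%N -> 0 < s < 1 ->
  0 < t e k + s * (t e k.+1 - t e k) < 1.
Proof.
move=> kn /(piece_oo kn)/andP[h1 h2].
have /andP[h3 _] := @cut_itv e k (leqW kn); have /andP[_ h4] := @cut_itv e k.+1 kn.
by rewrite (le_lt_trans h3) // (lt_le_trans h2).
Qed.

Lemma find_piece e (s : R) : 0 <= s <= 1 ->
  exists2 k, (k <= n e)%N & t e k <= s <= t e k.+1.
Proof.
move=> /andP[s0 s1]; case: (cutT e) => t0 t1 _.
have [k ks kmin] := @ex_minnP (fun k => s <= t e k.+1) (ex_intro _ (n e) (etrans (congr1 _ t1) s1)).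
have kn : (k <= n e)%N by apply: kmin; rewrite t1.
exists k => //; rewrite ks andbT; case: k ks kmin kn => [|k] _ kmin kn.
  by rewrite t0.
by rewrite leNgt; apply/negP => /ltW/kmin; rewrite ltnn.
Qed.

Lemma piece_param e k (s : R) : (k <= n e)%N -> t e k <= s <= t e k.+1 ->
  exists2 s', 0 <= s' <= 1 & s = t e k + s' * (t e k.+1 - t e k).
Proof.
move=> kn /andP[h1 h2]; have d : 0 < t e k.+1 - t e k by rewrite subr_gt0 cut_lt.
exists ((s - t e k) / (t e k.+1 - t e k)).
  apply/andP; split; first by apply: divr_ge0; rewrite ?subr_ge0 // ltW // -subr_gt0.
  by rewrite ler_pdivrMr // mul1r lerD2r.
by rewrite divfK ?gt_eqF // addrC subrK.
Qed.

Lemma subdivision_adjacent e k : (k <= n e)%N ->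
  @Defs.adjacent _ subdivision (node e k) (node e k.+1).
Proof.
move=> kn; apply/existsP; rewrite -ltnS in kn.
exists (existT (fun e => 'I_(n e).+1) _ (Ordinal kn), false).
by rewrite /= addn0 addn1 !eqxx.
Qed.

Lemma adjacent_sym (H : sgraph R) : symmetric (@Defs.adjacent _ H).
Proof.
move=> u v; apply/existsP/existsP => -[h /andP[/eqP h1 /eqP h2]];
  by exists (h.1, ~~ h.2); rewrite /= negbK -surjective_pairing h1 h2 !eqxx.
Qed.

Lemma connect_node e k : (k <= (n e).+1)%N ->
  connect (@Defs.adjacent _ subdivision) (inl (gend (e, false))) (node e k).
Proof.
elim: k => [_|k IH kn]; first exact: connect0.
apply: connect_trans (IH (ltnW kn)) _; apply: connect1.
exact: subdivision_adjacent.
Qed.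

Lemma subdivision_connected : connected_graph subdivision.
Proof.
have sym := sym_connect_sym (@adjacent_sym subdivision).
case: contG => -[G0 conG] _ _ _ _; split.
  by case/card_gt0P: G0 => v _; apply/card_gt0P; exists (inl v).
have old (u v : gvert G) : connect (@Defs.adjacent _ subdivision) (inl u) (inl v).
  have /connectP[p pu ->] := conG u v.
  elim: p u pu => [u _|w p IH u /= /andP[uw pw]]; first exact: connect0.
  apply: connect_trans (IH _ pw).
  case/existsP: uw => -[e b] /andP[/eqP <- /eqP <-] /=.
  have h := @connect_node e (n e).+1 (leqnn _); rewrite node_last in h.
  by case: b => //=; rewrite sym.
have all_old (x : gvert subdivision) :
    exists u, connect (@Defs.adjacent _ subdivision) (inl u) x.
  case: x => [u|[e j]]; first by exists u; exact: connect0.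
  exists (gend (e, false)); have := @connect_node e j.+1; rewrite nodeS; apply.
  by rewrite ltnS ltnW.
move=> x y; have [u ux] := all_old x; have [v vy] := all_old y.
by apply: connect_trans vy; apply: connect_trans (old u v); rewrite sym.
Qed.

Lemma subdivision_continuous : continuous_graph subdivision.
Proof.
have [_ arcs posI avoid inj] := contG.
split.
- exact: subdivision_connected.
- move=> [e [k kn0]] /=; have kn : (k <= n e)%N := kn0; split.
  + have /within01_dist h : {within `[0, 1], continuous (garc e)} by case: (arcs e).
    apply/within01_dist => x eps x01 e0.
    have d : 0 < t e k.+1 - t e k by rewrite subr_gt0 cut_lt.
    have [d1 d10 hd] := h _ _ (piece_in01 kn x01) e0.
    exists (d1 / (t e k.+1 - t e k)); first by rewrite divr_gt0.
    move=> y y01; rewrite ltr_pdivlMr // => xy; apply: hd; first exact: piece_in01.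
    by rewrite opprD addrACA subrr add0r -mulrBl normrM (gtr0_norm d).
  + by rewrite mul0r addr0 -[RHS]/(@gpos _ subdivision _) addn0 gpos_node // ltnW.
  + by rewrite mul1r addrC subrK -[RHS]/(@gpos _ subdivision _) addn1 gpos_node.
- move=> [v|[e j]] [v'|[e' j']] /=.
  + by move=> /posI ->.
  + move=> E; case: (avoid e' (t e' j'.+1) v) => //.
    by rewrite in_itv /= cut_oo.
  + move=> E; case: (avoid e (t e j.+1) v') => //.
    by rewrite in_itv /= cut_oo.
  + move=> /(garc_interior_inj contG) [||ee tt].
    * by have /andP[/ltW-> /ltW->] := cut_oo j.
    * exact: cut_oo.
    subst e'; congr (inr (existT _ _ _)); apply/val_inj => /=.
    have [ij|ij|//] := ltngtP j j'.
      by have := @cut_lt e j.+1 j'.+1 ij (leqW (ltn_ord j')); rewrite tt ltxx.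
    by have := @cut_lt e j'.+1 j.+1 ij (leqW (ltn_ord j)); rewrite tt ltxx.
- move=> [e [k kn0]] s v; have kn : (k <= n e)%N := kn0; rewrite in_itv /= => s01.
  have p1 := piece_oo kn s01; have p2 := piece_in_oo kn s01.
  case: v => [v|[e' j']] /=; first by apply: avoid; rewrite in_itv.
  move=> /esym/(garc_interior_inj contG)[||ee tt] //.
    by have /andP[/ltW-> /ltW->] := cut_oo j'.
  subst e'; move: p1; rewrite -tt => /andP[h1 h2].
  have [ij|ij] := leqP j'.+1 k.
    by have := @cut_le e _ _ ij (leqW kn); rewrite leNgt h1.
  by have := @cut_le e _ _ ij (leq_trans (ltn_ord j') (leqnSn _)); rewrite leNgt h2.
- move=> [e [k kn0]] [e' [k' kn0']] s s'; rewrite !in_itv /= => s01 s01'.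
  have kn : (k <= n e)%N := kn0; have kn' : (k' <= n e')%N := kn0'.
  have p1 := piece_oo kn s01; have p2 := piece_oo kn' s01'.
  move=> /(garc_interior_inj contG)[||ee tt].
  + by have /andP[/ltW-> /ltW->] := piece_in_oo kn s01.
  + exact: piece_in_oo.
  subst e'; move: p1 p2; rewrite -tt => /andP[h1 h2] /andP[h3 h4].
  have kk : k = k'.
    apply/eqP; rewrite eqn_leq; apply/andP; split; rewrite leqNgt; apply/negP => lk.
      by have := @cut_le e _ _ lk (leqW kn); rewrite leNgt (lt_trans h1 h4).
    by have := @cut_le e _ _ lk (leqW kn'); rewrite leNgt (lt_trans h3 h2).
  subst k'; split; first by congr (existT _ _ _); apply/val_inj.
  have d : t e k.+1 - t e k != 0 by rewrite gt_eqF // subr_gt0 cut_lt.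
  by apply: (mulIf d); apply: (addrI (t e k)).
Qed.

Lemma subdivision_carrier : carrier subdivision = carrier G.
Proof.
apply/seteqP; split=> x.
- move=> [[[v|[e j]] _ <-]|[[e [k kn0]] _ [s]]] /=.
  + by left; exists v.
  + right; exists e => //; exists (t e j.+1) => //=; rewrite in_itv /=.
    by have /andP[/ltW-> /ltW->] := cut_oo j.
  + have kn : (k <= n e)%N := kn0; rewrite in_itv /= => s01 <-; right; exists e => //.
    by exists (t e k + s * (t e k.+1 - t e k)) => //=; rewrite in_itv /= piece_in01.
- move=> [[v _ <-]|[e _ [s]]]; first by left; exists (inl v).
  rewrite /= in_itv /= => s01 <-; have [k kn ks] := find_piece e s01.
  have [s' s'01 ->] := piece_param kn ks; right.
  exists (existT (fun e => 'I_(n e).+1) _ (Ordinal (kn : (k < (n e).+1)%N))) => //.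
  by exists s' => //=; rewrite in_itv.
Qed.

Lemma degree_old (v : gvert G) : @degree _ subdivision (inl v) = degree v.
Proof.
pose f (h : gedge G * bool) : gedge subdivision * bool :=
  (existT (fun e => 'I_(n e).+1) _ (if h.2 then ord_max else ord0 : 'I_(n h.1).+1), h.2).
have fI : injective f.
  by move=> [e b] [e' b'] /(congr1 (fun x => (tag x.1, x.2))).
rewrite /degree -(card_imset _ fI); apply: eq_card => -[[e k] b].
rewrite inE /=; apply/idP/imsetP.
  have kb : (k + b <= (n e).+1)%N.
    by case: b; rewrite ?addn0 ?addn1 // ltnW.
  move E: (k + b)%N kb => m mb; case: {mb}(nodeP mb) E => [|j|] //= E /eqP[<-].
    exists (e, false); first by rewrite inE.
    case: b E => //= [|E]; first by rewrite addn1.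
    congr (existT _ _ _, _); apply/val_inj => /=; move: E; rewrite addn0 //.
  exists (e, true); first by rewrite inE.
  case: b E => /=; last by rewrite addn0 => E; have := ltn_ord k; rewrite E ltnn.
  by rewrite addn1 => -[E]; congr (existT _ _ _, _); apply/val_inj.
move=> [[e' b']]; rewrite inE => /eqP <- E.
have [E1 ->] : (existT (fun e => 'I_(n e).+1) _ k =
   existT (fun e => 'I_(n e).+1) _ (if b' then ord_max else ord0 : 'I_(n e').+1)) /\ b = b'.
  by split; [exact: (congr1 fst E)|exact: (congr1 snd E)].
rewrite -[node e (k + b')]/(node (tag (existT (fun e => 'I_(n e).+1) _ k))
   (tagged (existT (fun e => 'I_(n e).+1) _ k) + b')) E1 /=.
by case: b' {E E1} => /=; rewrite ?addn1 ?node_last.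
Qed.

(** The two ends at a new vertex belong to the pieces on its two sides. *)
Lemma degree_new (x : {e : gedge G & 'I_(n e)}) : @degree _ subdivision (inr x) = 2%N.
Proof.
case: x => e j.
pose h1 : gedge subdivision * bool :=
  (existT (fun e => 'I_(n e).+1) _ (widen_ord (leqnSn _) j), true).
pose h2 : gedge subdivision * bool :=
  (existT (fun e => 'I_(n e).+1) _ (lift ord0 j), false).
have h12 : h1 != h2 by apply/eqP => /(congr1 snd).
have e1 : gend h1 == inr (existT _ e j) by rewrite /= addn1 nodeS.
have e2 : gend h2 == inr (existT _ e j) by rewrite /= addn0; exact/eqP/(nodeS j).
rewrite /degree; suff -> : @ends _ subdivision (inr (existT _ e j)) = [set h1; h2]%SET.
  by rewrite cards2 h12.
apply/setP => -[[e' k] b]; rewrite !inE /=; apply/idP/idP; last first.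
  by move=> /orP[] /eqP E; [move: e1|move: e2]; rewrite -E.
have kb : (k + b <= (n e').+1)%N by case: b; rewrite ?addn0 ?addn1 // ltnW.
move E: (k + b)%N kb => m mb; case: {mb}(nodeP mb) E => [|j'|] E /eqP jj.
- discriminate jj.
- have ee : e' = e := congr1 (fun v : gvert subdivision =>
    if v is inr x then tag x else e) jj.
  subst e'.
  have {}jj : j' = j :> nat := congr1 (fun v : gvert subdivision =>
    if v is inr x then nat_of_ord (tagged x) else 0%N) jj.
  case: b E => /=; rewrite ?addn0 ?addn1 jj => E.
    by apply/orP; left; apply/eqP; congr (existT _ _ _, _); apply/val_inj; case: E.
  by apply/orP; right; apply/eqP; congr (existT _ _ _, _); apply/val_inj.
- discriminate jj.
Qed.

Lemma subdivision_topological : topological_vertices subdivision = topological_vertices G.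
Proof.
apply/seteqP; split=> x [v /= dv <-].
  case: v dv => [v|x'] dv /=; last by rewrite degree_new in dv.
  by rewrite degree_old in dv *; exists v.
by exists (inl v) => /=; rewrite degree_old.
Qed.

End Cuts.
End Sub.

Definition chord_graph (G : sgraph R) : sgraph R :=
  @redraw _ G (fun e s => (1 - s) *: gpos (gend (e, false)) + s *: gpos (gend (e, true))).

(** Presentations of one point set with the same topological vertices: they have the same
    approximating polygons, hence the same total curvature. *)
Definition same_space (G H : sgraph R) :=
  [/\ continuous_graph H, carrier H = carrier G &
      topological_vertices H = topological_vertices G].

Lemma same_space_trans G H K : same_space G H -> same_space H K -> same_space G K.
Proof. by move=> [c1 e1 t1] [c2 e2 t2]; split; rewrite // ?e2 // t2. Qed.

Lemma same_space_subdivision G n t : continuous_graph G -> @cuts G n t ->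
  same_space G (subdivision n t).
Proof.
move=> cG ct; split; first exact: subdivision_continuous.
  exact: subdivision_carrier.
exact: subdivision_topological.
Qed.

Lemma approximating_chord G H : same_space G H -> continuous_graph (chord_graph H) ->
  approximating G (chord_graph H).
Proof.
move=> [cH eH tH] cC; split=> //.
  by move=> v; rewrite -eH; left; exists v.
by exists (@garc _ H); case: H cH eH {tH cC}.
Qed.

Lemma approximating_same_space G H P :
  same_space G H -> approximating H P -> approximating G P.
Proof.
by move=> [cH eH tH] [p1 p2 p3 [a [a1 a2]]]; split; rewrite -?eH -?tH //; exists a.
Qed.

Lemma total_curvature_same_space c G H : continuous_graph G -> same_space G H ->
  total_curvature c H = total_curvature c G.
Proof.
move=> cG GH; congr ereal_sup; apply/seteqP; split=> x [P [aP ->]]; exists P; split=> //.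
  exact: approximating_same_space aP.
by apply: approximating_same_space aP; case: GH => cH eH tH; split.
Qed.

End Subdivision.

(** * Compactness estimates for arcs *)

Section Square.
Variable R : realType.
Local Notation V := 'rV[R]_3.

(** Compactness of the closed part [c <= G] of the unit square. *)
Lemma square_positive (F G : R * R -> R) (c : R) : continuous F -> continuous G ->
  (forall s s', 0 <= s <= 1 -> 0 <= s' <= 1 -> c <= G (s, s') -> 0 < F (s, s')) ->
  exists2 d : R, 0 < d & forall s s', 0 <= s <= 1 -> 0 <= s' <= 1 ->
    c <= G (s, s') -> d <= F (s, s').
Proof.
move=> cF cG Fpos.
pose K := (`[0, 1] `*` `[0, 1])%classic `&` [set z : R * R | c <= G z].
have cK : compact K.
  apply: (compact_closedI (compact_setX (@segment_compact R 0 1) (@segment_compact R 0 1))).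
  apply: (@closed_comp (R * R)%type R G [set x | c <= x]); last exact: closed_ge.
  by move=> z _; exact: cG.
have inK s s' : 0 <= s <= 1 -> 0 <= s' <= 1 -> c <= G (s, s') -> K (s, s').
  by move=> h h' hG; split => //; split; rewrite /= in_itv.
have [K0|/set0P/negP/negPn/eqP K0] := pselect (K !=set0); last first.
  exists 1 => // s s' h h' hG.
  by have := inK s s' h h' hG; rewrite K0.
have [z zK zmin] := compact_EVT_min K0 cK (continuous_subspaceT cF).
exists (F z).
  case: z zK {zmin} => s s'; rewrite inE => -[[/=]]; rewrite !in_itv /= => h h' hG.
  exact: Fpos.
by move=> s s' h h' hG; apply: zmin; rewrite inE; exact: inK.
Qed.

Lemma dist_pair_continuous (W : normedModType R) (f g : R -> W) : continuous f -> continuous g ->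
  continuous (fun z : R * R => `|f z.1 - g z.2|).
Proof.
move=> cf cg [s s']; apply: (@dist_continuous R (R * R)%type R) => e e0.
have e2 : 0 < e / 2 by rewrite divr_gt0.
have [d d0 hd] := continuous_dist (cf s) e2.
have [d' d'0 hd'] := continuous_dist (cg s') e2.
exists (Num.min d d'); first by rewrite lt_min d0.
move=> [r r']; rewrite lt_min !prod_normE /= !gt_max.
move=> /andP[/andP[/hd h1 _] /andP[_ /hd' h2]].
apply: le_lt_trans (ler_dist_dist _ _) _.
have -> : f s - g s' - (f r - g r') = (f s - f r) - (g s' - g r').
  by rewrite !opprB addrACA [in RHS]addrACA; congr (_ + _); rewrite addrC.
apply: le_lt_trans (ler_normB _ _) _; lra.
Qed.

Lemma unif_continuous01 (f : R -> V) (e : R) : continuous f -> 0 < e ->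
  exists2 d, 0 < d & forall s s', 0 <= s <= 1 -> 0 <= s' <= 1 ->
    `|s - s'| < d -> `|f s - f s'| < e.
Proof.
move=> cf e0.
have cs : continuous (fun z : R * R => `|z.1 - z.2|).
  by apply: (@dist_pair_continuous R id id) => x; exact: cvg_id.
have [|d d0 hd] := @square_positive _ _ e cs (dist_pair_continuous cf cf).
  move=> s s' _ _ /= h; rewrite normr_gt0 subr_eq0; apply/eqP => E.
  by move: h; rewrite E subrr normr0 leNgt e0.
exists d => // s s' h h' ss'; rewrite ltNge; apply/negP => /(hd s s' h h').
by rewrite leNgt ss'.
Qed.

(** Uniform continuity of the inverse of a simple arc. *)
Lemma inverse_modulus (f : R -> V) (e : R) : continuous f -> 0 < e ->
  (forall s s', 0 <= s <= 1 -> 0 <= s' <= 1 -> f s = f s' -> s = s') ->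
  exists2 d, 0 < d & forall s s', 0 <= s <= 1 -> 0 <= s' <= 1 ->
    `|f s - f s'| < d -> `|s - s'| < e.
Proof.
move=> cf e0 fI.
have cs : continuous (fun z : R * R => `|z.1 - z.2|).
  by apply: (@dist_pair_continuous R id id) => x; exact: cvg_id.
have [|d d0 hd] := @square_positive _ _ e (dist_pair_continuous cf cf) cs.
  move=> s s' s1 s1' /= h; rewrite normr_gt0 subr_eq0; apply/eqP => /fI E.
  by move: h; rewrite E // subrr normr0 leNgt e0.
exists d => // s s' h h' ss'; rewrite ltNge; apply/negP => /(hd s s' h h').
by rewrite leNgt ss'.
Qed.

(** The distance of two disjoint compact arcs is attained. *)
Lemma arcs_apart (f g : R -> V) (a b : R) : continuous f -> continuous g ->
  (forall s s', 0 <= s <= 1 -> 0 <= s' <= 1 -> a <= s <= b -> f s <> g s') ->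
  exists2 d, 0 < d & forall s s', 0 <= s <= 1 -> 0 <= s' <= 1 -> a <= s <= b ->
    d <= `|f s - g s'|.
Proof.
move=> cf cg fg.
pose m := (a + b) / 2.
have cs : continuous (fun z : R * R => - `|z.1 - m|).
  apply: (@lip_continuous R (R * R)%type R _ 1) => -[x y] [x' y'].
  rewrite mul1r prod_normE /= le_max; apply/orP; left.
  rewrite opprK addrC; apply: le_trans (ler_dist_dist _ _) _.
  by rewrite opprB addrA subrK distrC.
have mid s : (- ((b - a) / 2) <= - `|s - m|) = (a <= s <= b).
  by rewrite lerN2 ler_norml /m; apply/andP/andP => -[h1 h2]; split; lra.
have [|d d0 hd] := @square_positive _ _ (- ((b - a) / 2)) (dist_pair_continuous cf cg) cs.
  move=> s s' s1 s1' /=; rewrite mid => h; rewrite normr_gt0 subr_eq0.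
  exact/eqP/fg.
by exists d => // s s' h h' ss'; apply: (hd s s') => //; rewrite mid.
Qed.

End Square.

(** * Graphs without loops *)

Section SimpleArcs.
Variable R : realType.
Local Notation V := 'rV[R]_3.

Definition loopless (G : sgraph R) := forall e : gedge G, gend (e, false) != gend (e, true).

Definition carc (G : sgraph R) (e : gedge G) := garc e \o @clamp01 R.

Lemma carcE (G : sgraph R) (e : gedge G) s : 0 <= s <= 1 -> carc e s = garc e s.
Proof. by move=> h; rewrite /carc /= clamp01_id. Qed.

Lemma carc_continuous (G : sgraph R) (e : gedge G) :
  continuous_graph G -> continuous (carc e).
Proof. by move=> [_ /(_ e)[c _ _] _ _ _]; exact: clamp01_continuous. Qed.

(** In a graph without loops every closed edge is a simple arc. *)
Lemma garc_inj (G : sgraph R) (e : gedge G) (s s' : R) :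
  continuous_graph G -> loopless G ->
  0 <= s <= 1 -> 0 <= s' <= 1 -> garc e s = garc e s' -> s = s'.
Proof.
move=> cG ll s1 s1'.
have cases (r : R) : 0 <= r <= 1 -> r = 0 \/ r = 1 \/ 0 < r < 1.
  move=> /andP[h h']; have [->|r0] := eqVneq r 0; first by left.
  have [->|r1] := eqVneq r 1; first by right; left.
  by right; right; rewrite !lt_neqAle h h' r1 eq_sym r0.
have [_ _ posI _ _] := cG.
have g0 : garc e 0 = gpos (gend (e, false)) := garc01 cG e false.
have g1 : garc e 1 = gpos (gend (e, true)) := garc01 cG e true.
have [E'|[E'|h']] := cases s' s1'; last by move=> /(garc_interior_inj cG s1 h')[].
- have [E|[E|h]] := cases s s1.
  + by rewrite E E'.
  + by rewrite E E' g0 g1 => /posI/eqP; rewrite eq_sym (negbTE (ll e)).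
  + by move=> /esym/(garc_interior_inj cG s1' h)[].
- have [E|[E|h]] := cases s s1.
  + by rewrite E E' g0 g1 => /posI/eqP; rewrite (negbTE (ll e)).
  + by rewrite E E'.
  + by move=> /esym/(garc_interior_inj cG s1' h)[].
Qed.

Lemma subdivision_loopless (G : sgraph R) n t : continuous_graph G -> loopless G ->
  @cuts R G n t -> loopless (subdivision n t).
Proof.
move=> cG ll ct [e [k kn0]] /=; have kn : (k <= n e)%N := kn0.
apply/eqP => /(congr1 (@gpos _ (subdivision n t))).
rewrite addn0 addn1 !gpos_node //; last exact: leqW.
move=> /(garc_inj cG ll (cut_itv ct (leqW kn)) (cut_itv ct kn0)) E.
by have := cut_lt ct (ltnSn k) kn0; rewrite E ltxx.
Qed.

Lemma chord_graph_continuous (H : sgraph R) : continuous_graph H ->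
  (forall (e : gedge H) x (v : gvert H), 0 < x < 1 ->
     garc (s := chord_graph H) e x <> gpos v) ->
  (forall (e e' : gedge H) x x', 0 < x < 1 -> 0 < x' < 1 ->
     garc (s := chord_graph H) e x = garc (s := chord_graph H) e' x' -> e = e' /\ x = x') ->
  continuous_graph (chord_graph H).
Proof.
move=> [con arcs posI _ _] avoid inj; split=> //.
move=> e; split=> /=; last by rewrite subrr scale1r scale0r add0r.
  apply: continuous_subspaceT.
    set p := @gpos _ H (gend (e, false)); set q := @gpos _ H (gend (e, true)).
    apply: (@lip_continuous _ _ _ _ `|q - p|) => x y /=.
    have -> : (1 - x) *: p + x *: q - ((1 - y) *: p + y *: q) = (x - y) *: (q - p).
      by apply/rowP => i; rewrite !mxE; ring.
    by rewrite normrZ mulrC.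
  by rewrite subr0 scale1r scale0r addr0.
Qed.

(** Embeddedness passes from the edges to their chords along an injective map. *)
Lemma chord_graph_image (H : sgraph R) (h : V -> V) :
  continuous_graph H -> injective h -> (forall v : gvert H, h (gpos v) = gpos v) ->
  (forall (e : gedge H) x, 0 < x < 1 -> exists2 s, 0 < s < 1 &
     h (garc e s) = garc (s := chord_graph H) e x) ->
  (forall (e : gedge H) s, 0 <= s <= 1 -> exists2 x, 0 <= x <= 1 &
     h (garc e s) = garc (s := chord_graph H) e x) ->
  continuous_graph (chord_graph H) /\ h @` carrier H = carrier (chord_graph H).
Proof.
move=> cH hI hv onto into; have [con arcs posI avoid inj] := cH.
have c0 (e : gedge H) : garc (s := chord_graph H) e 0 = gpos (gend (e, false)).
  by rewrite /= subr0 scale1r scale0r addr0.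
have c1 (e : gedge H) : garc (s := chord_graph H) e 1 = gpos (gend (e, true)).
  by rewrite /= subrr scale1r scale0r add0r.
split; first apply: chord_graph_continuous => //.
- move=> e s v /(onto e)[s' s1 E] E'.
  have := avoid e s' v; rewrite in_itv /= => /(_ s1); apply.
  by apply: hI; rewrite hv -E' E.
- move=> e e' x x' x01 x01' E.
  have [s s1 hs] := onto e x x01; have [s' s1' hs'] := onto e' x' x01'.
  have /hI ss : h (garc (s := H) e s) = h (garc (s := H) e' s') by rewrite hs hs'.
  have [||ee _] := inj e e' s s' _ _ ss; rewrite ?in_itv //.
  split=> //; subst e'.
  move: E => /=; set p := @gpos _ H (gend (e, false)); set q := @gpos _ H (gend (e, true)) => E.
  have /eqP : (x - x') *: (q - p) = 0.
    have -> : (x - x') *: (q - p) = ((1 - x) *: p + x *: q) - ((1 - x') *: p + x' *: q).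
      by apply/rowP => i; rewrite !mxE; ring.
    by rewrite E subrr.
  rewrite scaler_eq0 !subr_eq0 => /orP[/eqP//|/eqP qp].
  have hp : garc (s := chord_graph H) e x = p.
    by rewrite /= -/p -/q qp -scalerDl subrK scale1r.
  have := avoid e s (gend (e, false)); rewrite in_itv /= => /(_ s1).
  by case; apply: hI; rewrite hv hs hp.
apply/seteqP; split=> y.
  move=> [x [[v _ <-]|[e _ [s s1 <-]]] <-].
    by left; exists v.
  rewrite /= in_itv /= in s1; right; have [x' x1 ->] := into e s s1.
  by exists e => //; exists x' => //=; rewrite in_itv.
move=> [[v _ <-]|[e _ [x]]].
  by exists (@gpos _ H v); [left; exists v|exact: hv].
rewrite /= in_itv /= => x1 <-.
have [->|x0] := eqVneq x 0.
  exists (@gpos _ H (gend (e, false))); first by left; exists (gend (e, false)).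
  by rewrite hv; exact/esym/c0.
have [->|xn1] := eqVneq x 1.
  exists (@gpos _ H (gend (e, true))); first by left; exists (gend (e, true)).
  by rewrite hv; exact/esym/c1.
have /(onto e)[s /andP[s0 s1] E] : 0 < x < 1.
  by case/andP: x1 => a b; rewrite !lt_neqAle a b xn1 eq_sym x0.
exists (garc (s := H) e s) => //; right; exists e => //; exists s => //=.
by rewrite in_itv /= !ltW.
Qed.

End SimpleArcs.

(** * Straightening all stars of a graph *)

Section Vertices.
Variable R : realType.
Local Notation V := 'rV[R]_3.
Variables (G : sgraph R) (a : gedge G -> V) (mu : R).
Hypotheses (contG : continuous_graph G) (loopG : loopless G).
Hypotheses (a1 : forall e, enorm (a e) = 1) (mu01 : 0 < mu <= 1).
Hypothesis cone : forall (e : gedge G) (s t : R), 0 <= s -> s < t -> t <= 1 ->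
  within_cone (a e) (mu / 32) (garc e t - garc e s).

(** The axis of the cone in which the edge leaves its end [h]. *)
Definition end_axis (h : gedge G * bool) := if h.2 then - a h.1 else a h.1.

Hypothesis spread : forall v : gvert G, exists2 u : V, enorm u = 1 &
  forall h, gend h = v -> mu - 1 <= dotv (end_axis h) u.

(** The edge parametrized from its end [h]. *)
Definition branch (h : gedge G * bool) (s : R) := carc h.1 (if h.2 then 1 - s else s).

Let flip01 (b : bool) (s : R) : 0 <= s <= 1 -> 0 <= (if b then 1 - s else s) <= 1.
Proof. by case: b => // /andP[h1 h2]; apply/andP; split; lra. Qed.

Lemma branch_continuous h : continuous (branch h).
Proof.
case: h => e b x; rewrite /branch /=; case: b; last exact: carc_continuous.
have cf : {for x, continuous (fun s : R => 1 - s)}.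
  apply: (@lip_continuous R R R _ 1) => y z.
  by rewrite mul1r (_ : 1 - y - (1 - z) = z - y) ?(distrC z) //; ring.
have cc : {for 1 - x, continuous (carc e)} by exact: carc_continuous.
exact: (@continuous_comp R R V (fun s => 1 - s) (carc e) x cf cc).
Qed.

Lemma branch0 h : branch h 0 = gpos (gend h).
Proof.
case: h => e b; rewrite /branch /= -(garc01 contG) carcE; case: b => //=.
- by rewrite subr0.
- by rewrite subr0 ler01 lexx.
- by rewrite lexx ler01.
Qed.

Lemma branch_chord h s t : 0 <= s -> s < t -> t <= 1 ->
  branch h s != branch h t /\ within_cone (end_axis h) (mu / 32) (branch h t - branch h s).
Proof.
move=> s0 st t1.
have s01 : 0 <= s <= 1 by rewrite s0 (le_trans (ltW st)).
have t01 : 0 <= t <= 1 by rewrite t1 (le_trans s0) // ltW.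
case: h => e b; rewrite /branch /end_axis /= !carcE ?flip01 //; split.
  apply/eqP => /(garc_inj contG loopG (flip01 b s01) (flip01 b t01)).
  by case: b => E; move: st; rewrite ?E ?ltxx //; rewrite (_ : s = t) ?ltxx //; lra.
case: b; last exact: cone.
rewrite -opprB; apply: within_coneN; apply: cone; lra.
Qed.

Lemma branch_inj (h h' : gedge G * bool) s t : gend h = gend h' ->
  0 < s < 1 -> 0 < t < 1 -> branch h s = branch h' t -> h = h'.
Proof.
have oo (b : bool) (r : R) : 0 < r < 1 -> 0 < (if b then 1 - r else r) < 1.
  by case: b => // /andP[h1 h2]; apply/andP; split; lra.
have cc (r : R) : 0 < r < 1 -> 0 <= r <= 1 by move=> /andP[/ltW-> /ltW->].
case: h => e b; case: h' => e' b' E s01 t01; rewrite /branch /= !carcE ?flip01 ?cc //.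
move=> /(garc_interior_inj contG (cc _ (oo b s s01)) (oo b' t t01))[ee _].
subst e'; case: b b' E {s01 t01} => -[] //= /eqP; last by rewrite (negbTE (loopG e)).
by rewrite eq_sym (negbTE (loopG e)).
Qed.

(** Up to the parameter [s0] the map [f] carries the branch at [h] onto a segment, with the
    increasing parameter [lam]; from there to [b] it fixes the branch. *)
Definition straightened_end (f : V -> V) (h : gedge G * bool) (s0 : R) (lam : R -> R) (b : R) :=
  [/\ lam 0 = 0, lam s0 = 1, forall s t, 0 <= s -> s < t -> t <= s0 -> lam s < lam t,
    forall s, 0 <= s <= s0 ->
      f (branch h s) = gpos (gend h) + lam s *: (branch h s0 - gpos (gend h)) &
    forall s, s0 <= s <= b -> f (branch h s) = branch h s].

Lemma star_at_vertex (v : gvert G) (r : R) : 0 < r ->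
  exists (f : V -> V) (s0 : gedge G * bool -> R) (lam : gedge G * bool -> R -> R),
  [/\ tame_homeo f, f (gpos v) = gpos v, forall x, r <= `|x - gpos v| -> f x = x &
    forall h, gend h = v -> [/\ 0 < s0 h < 3^-1, `|branch h (s0 h) - gpos v| < r &
      straightened_end f h (s0 h) (lam h) 1]].
Proof.
move=> r0; have [u u1 su] := spread v.
pose I : finType := {h : gedge G * bool | h \in ends v}.
have endI (i : I) : gend (val i) = v by have := valP i; rewrite inE => /eqP.
have [||||||f [s0 [lam [tf fv out st]]]] := @star_straighten R I (gpos v)
    (fun i => branch (val i)) (fun i => end_axis (val i)) u mu u1 mu01 _ _ _ _ _ _ r r0.
- by move=> i; rewrite /end_axis; case: ifP; rewrite ?enormN a1.
- by move=> i; apply: su; exact: endI.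
- by move=> i; exact: branch_continuous.
- by move=> i; rewrite branch0 endI.
- by move=> i s t; exact: branch_chord.
- move=> i j s t s1 t1 E; apply/val_inj; apply: branch_inj s1 t1 E.
  by rewrite !endI.
exists f, (fun h => if insub h is Some i then s0 i else 0),
  (fun h => if insub h is Some i then lam i else fun=> 0).
split=> // h hv; have hin : h \in ends v by rewrite inE hv.
rewrite insubT /=; have [h1 h2 [h3 h4 h5] h6 h7] := st (Sub h hin).
by split=> //; split=> //; rewrite hv.
Qed.

(** The homeomorphisms at two vertices have disjoint supports in balls of this radius, and
    the one at the far end of a branch does not touch the first two thirds of it. *)
Lemma vertex_radius : exists2 r : R, 0 < r &
  (forall v w : gvert G, v != w -> 2 * r <= `|gpos v - gpos w|) /\
  (forall (h : gedge G * bool) v s, 0 <= s <= 1 -> `|branch h s - gpos v| < r ->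
    v != gend h -> 2 / 3 < s).
Proof.
have [d1 d10 H1] : exists2 r : R, 0 < r & forall p : gvert G * gvert G,
    p.1 != p.2 -> 2 * r <= `|gpos p.1 - gpos p.2|.
  apply: (@small_forall R (gvert G * gvert G)%type
    (fun p r => p.1 != p.2 -> 2 * r <= `|gpos p.1 - gpos p.2|)).
    by move=> p d d' /andP[_ dd'] h /h; apply: le_trans; rewrite ler_wpM2l.
  move=> [v w] /=; have [_|vw] := eqVneq v w; first by exists 1.
  have vw0 : 0 < `|gpos v - gpos w|.
    rewrite normr_gt0 subr_eq0; apply: contra vw => /eqP E; apply/eqP.
    by case: contG => _ _ posI _ _; exact: posI.
  by exists (`|gpos v - gpos w| / 2) => //; [rewrite divr_gt0|move=> _; lra].
have [d2 d20 H2] : exists2 r : R, 0 < r & forall p : (gedge G * bool) * gvert G,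
    p.2 != gend p.1 -> forall s, 0 <= s <= 1 -> s <= 2 / 3 -> r <= `|branch p.1 s - gpos p.2|.
  apply: (@small_forall R ((gedge G * bool) * gvert G)%type (fun p r =>
    p.2 != gend p.1 -> forall s, 0 <= s <= 1 -> s <= 2 / 3 -> r <= `|branch p.1 s - gpos p.2|)).
    by move=> p d d' /andP[_ dd'] h /h{}h s s1 s2; apply: le_trans dd' _; exact: h.
  move=> [h v] /=; have [_|vh] := eqVneq v (gend h); first by exists 1.
  have [||d d0 hd] := @arcs_apart R (branch h) (fun=> gpos v) 0 (2 / 3) (@branch_continuous h).
  - exact: cst_continuous.
  - move=> s _ s01 _ /andP[s0 s2].
    have [->|sn0] := eqVneq s 0.
      rewrite branch0 => E; case: contG => _ _ posI _ _.
      by move: vh; rewrite (posI _ _ E) eqxx.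
    case: h vh => e b vh; rewrite /branch /= carcE ?flip01 //.
    case: contG => _ _ _ avoid _; apply: avoid; rewrite in_itv /=.
    have s00 : 0 < s by rewrite lt_neqAle eq_sym sn0.
    by case: b {vh}; apply/andP; split; lra.
  exists d => // _ s s01 s2; apply: (hd s 0) => //; first by rewrite lexx ler01.
  by case/andP: s01 => -> _.
exists (Num.min d1 d2); first by rewrite lt_min d10.
split=> [v w vw|h v s s01 hs vh].
  apply: le_trans (H1 (v, w) vw); rewrite ler_wpM2l //.
  by rewrite ge_min lexx.
rewrite ltNge; apply/negP => s2; have := H2 (h, v) vh s s01 s2 => /= hd.
by move: hs; rewrite lt_min => /andP[_]; rewrite ltNge hd.
Qed.

(** All stars are straightened at once: the homeomorphisms of the various vertices
    have disjoint supports. *)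
Lemma straighten_vertices (r0 : R) : 0 < r0 ->
  exists (f : V -> V) (s0 : gedge G * bool -> R) (lam : gedge G * bool -> R -> R),
  [/\ tame_homeo f, forall v : gvert G, f (gpos v) = gpos v &
    forall h, [/\ 0 < s0 h < 3^-1, `|branch h (s0 h) - gpos (gend h)| < r0 &
      straightened_end f h (s0 h) (lam h) (2 / 3)]].
Proof.
move=> r00; have [r1 r10 [sep far]] := vertex_radius.
pose r := Num.min r0 r1; have r_gt0 : 0 < r by rewrite lt_min r00.
have rr0 : r <= r0 by rewrite ge_min lexx.
have rr1 : r <= r1 by rewrite ge_min lexx orbT.
have [F FP] := choice (fun v => @star_at_vertex v r r_gt0).
have [s0 FP'] := choice FP; have [lam {FP'}P] := choice FP'.
(* The order of composition is irrelevant since the supports are disjoint. *)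
pose f := foldr (fun v g => F v \o g) id (enum (gvert G)).
have tf : tame_homeo f.
  rewrite /f; elim: (enum _) => [|v l IH] /=; first exact: tame_homeo_id.
  by apply: tame_homeo_comp => //; case: (P v).
have apart (v w : gvert G) x : w != v -> `|x - gpos v| < r -> r <= `|x - gpos w|.
  move=> wv xv; have := sep w v wv; have := ler_distD x (gpos w) (gpos v).
  rewrite (distrC (gpos w) x); lra.
have stay (v : gvert G) x : `|x - gpos v| < r -> `|F v x - gpos v| < r.
  move=> xv; rewrite ltNge; apply/negP => Fx.
  have [tFv _ out _] := P v; have /(tame_homeo_inj tFv) E := out _ Fx.
  by move: Fx; rewrite E leNgt xv.
have fE (v : gvert G) x : (forall w, w != v -> r <= `|x - gpos w|) -> f x = F v x.
  move=> hx.
  have fix1 w : w != v -> F w x = x by move=> /hx; case: (P w) => _ _ out _ /out.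
  have fix2 w : w != v -> F w (F v x) = F v x.
    move=> wv; have [xv|xv] := leP r `|x - gpos v|.
      by have [_ _ out _] := P v; rewrite (out _ xv) fix1.
    have [_ _ out _] := P w; apply: out; apply: apart wv _; exact: stay.
  have : foldr (fun v g => F v \o g) id (enum (gvert G)) x =
     if v \in enum (gvert G) then F v x else x.
    elim: (enum _) (enum_uniq (gvert G)) => [|w l IH] //= /andP[wl /IH ->].
    rewrite inE; have [->|vw] := eqVneq v w; first by rewrite (negbTE wl).
    by case: ifP => _ /=; [rewrite fix2 // eq_sym|rewrite fix1 // eq_sym].
  by rewrite mem_enum.
have fbranch h s : 0 <= s <= 1 -> s <= 2 / 3 -> f (branch h s) = F (gend h) (branch h s).
  move=> s01 s2; apply: fE => w wh; rewrite leNgt; apply/negP => lt.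
  have := far h w s s01 (lt_le_trans lt rr1) wh; lra.
exists f, (fun h => s0 (gend h) h), (fun h => lam (gend h) h); split=> //.
- move=> v; rewrite (fE v); first by case: (P v).
  move=> w wv; apply: apart wv _; by rewrite subrr normr0.
- move=> h; have [_ _ _ /(_ h erefl)[h1 h2 [l1 l2 l3 l4 l5]]] := P (gend h).
  split=> //; first exact: lt_le_trans rr0.
  case/andP: (h1) => h3 h4; split=> // s /andP[sa sb].
    by rewrite fbranch ?l4 ?sa //; lra.
  by rewrite fbranch ?l5 ?sa //=; lra.
Qed.

End Vertices.

(** * Projection to inscribed polygons *)

Section Polygon.
Variable R : realType.
Local Notation V := 'rV[R]_3.
Variables (G : sgraph R) (a : gedge G -> V) (kap : R).
Hypotheses (contG : continuous_graph G) (loopG : loopless G).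
Hypotheses (a1 : forall e, enorm (a e) = 1) (kap0 : 0 < kap) (kap12 : kap <= 12^-1).
Hypothesis cone : forall (e : gedge G) (s t : R), 0 <= s -> s < t -> t <= 1 ->
  within_cone (a e) kap (garc e t - garc e s).
(* [f] is the homeomorphism which straightens the stars. *)
Variables (f : V -> V) (s0 : gedge G * bool -> R) (lam : gedge G * bool -> R -> R).
Hypothesis tf : tame_homeo f.
Hypothesis fv : forall v : gvert G, f (gpos v) = gpos v.
Hypothesis s0_itv : forall h, 0 < s0 h < 3^-1.
Hypothesis fstr : forall h, straightened_end f h (s0 h) (lam h) (2 / 3).
Variable N : nat.

Let sg (e : gedge G) : R := s0 (e, false).
Let tau (e : gedge G) : R := 1 - s0 (e, true).
Let X (e : gedge G) s := f (carc e s).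

(** The straight parts of the edge at its two ends are pieces of their own, and the part
    in the middle is divided evenly. *)
Definition fine_cuts (e : gedge G) (k : nat) : R :=
  if k == 0%N then 0 else
  if (k <= N.+2)%N then sg e + k.-1%:R / N.+1%:R * (tau e - sg e) else 1.

Local Notation n := (fun _ : gedge G => N.+2).
Local Notation t := fine_cuts.

Let sg_itv e : 0 < sg e < 3^-1. Proof. exact: s0_itv. Qed.

Let tau_itv e : 2 / 3 < tau e < 1.
Proof. by rewrite /tau; have := s0_itv (e, true) => /andP[h1 h2]; apply/andP; split; lra. Qed.

Let sgtau e : sg e < tau e.
Proof. by have := sg_itv e; have := tau_itv e; move=> /andP[h1 h2] /andP[h3 h4]; lra. Qed.

Let t0 e : t e 0 = 0. Proof. by []. Qed.
Let tmid e k : (k <= N.+1)%N -> t e k.+1 = sg e + k%:R / N.+1%:R * (tau e - sg e).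
Proof. by move=> kN; rewrite /t /= ltnS kN. Qed.
Let t1 e : t e 1 = sg e. Proof. by rewrite tmid // mul0r mul0r addr0. Qed.
Let tN e : t e N.+2 = tau e.
Proof. by rewrite tmid // mulfV ?pnatr_eq0 // mul1r addrC subrK. Qed.
Let tlast e : t e N.+3 = 1. Proof. by rewrite /t /= ltnn. Qed.

Let mesh e k : (k <= N)%N -> t e k.+2 - t e k.+1 = (tau e - sg e) / N.+1%:R.
Proof.
move=> kN; rewrite (@tmid e k.+1) // (@tmid e k); last exact: leqW.
by rewrite -natr1; set u := N.+1%:R^-1; ring.
Qed.

Lemma fine_cutsP : cuts n t.
Proof.
move=> e; split; [exact: t0|exact: tlast|].
move=> [_|k]; first by rewrite t0 t1; case/andP: (sg_itv e).
rewrite ltnS leq_eqVlt => /predU1P[->|kN].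
  by rewrite tN tlast; case/andP: (tau_itv e).
by rewrite -subr_gt0 mesh // divr_gt0 ?subr_gt0.
Qed.

Let ct := fine_cutsP.

Lemma fine_cuts_mid e k s : (0 < k <= N.+1)%N -> t e k <= s <= t e k.+1 ->
  sg e <= s <= tau e.
Proof.
move=> /andP[k0 kN] /andP[h1 h2]; rewrite -(t1 e) -(tN e); apply/andP; split.
  apply: le_trans h1; apply: (cut_le ct) => //.
  exact: (leq_trans kN (leqW (leqnSn _))).
by apply: le_trans h2 _; apply: (cut_le ct).
Qed.

Let X1 e s : 0 <= s <= sg e ->
  X e s = X e 0 + lam (e, false) s *: (X e (sg e) - X e 0).
Proof.
move=> hs; have [l0 l1 lm lf _] := fstr (e, false).
have b0 : branch (e, false) 0 = gpos (gend (e, false)) by exact: branch0.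
have e0 : X e 0 = gpos (gend (e, false)) by rewrite /X -fv -b0.
have e1 : X e (sg e) = branch (e, false) (sg e).
  by rewrite /X -/(branch (e, false) (sg e)) lf ?l1 ?scale1r 1?addrC ?subrK // lexx andbT ltW //; case/andP: (sg_itv e).
by rewrite e1 e0 /X -/(branch (e, false) s) lf.
Qed.

Let X2 e s : sg e <= s <= tau e -> X e s = carc e s.
Proof.
move=> /andP[h1 h2]; have [s2|s2] := leP s (2 / 3).
  have [_ _ _ _ lf] := fstr (e, false).
  by rewrite /X -/(branch (e, false) s) lf // h1.
have [_ _ _ _ lf] := fstr (e, true).
have E : carc e s = branch (e, true) (1 - s) by rewrite /branch /= opprB addrC subrK.
by rewrite /X E lf //; move: h2; rewrite /tau; lra.
Qed.

Let X3 e s : tau e <= s <= 1 ->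
  X e s = X e 1 + lam (e, true) (1 - s) *: (X e (tau e) - X e 1).
Proof.
move=> /andP[h1 h2]; have [l0 l1 lm lf _] := fstr (e, true).
have E r : carc e r = branch (e, true) (1 - r) by rewrite /branch /= opprB addrC subrK.
have b0 : branch (e, true) 0 = gpos (gend (e, true)) by exact: branch0.
have e0 : X e 1 = gpos (gend (e, true)) by rewrite /X E subrr b0 fv.
have tauE : 1 - tau e = s0 (e, true) by rewrite /tau opprB addrC subrK.
have s00 : 0 <= s0 (e, true) by case/andP: (s0_itv (e, true)) => /ltW.
have e1 : X e (tau e) = branch (e, true) (s0 (e, true)).
  by rewrite /X E tauE lf ?l1 ?scale1r 1?addrC ?subrK // lexx s00.
by rewrite e1 e0 /X E lf //; rewrite subr_ge0 h2 -tauE lerD2l lerN2.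
Qed.

Let X_continuous e : continuous (X e).
Proof.
move=> s; have c1 : {for carc e s, continuous f} by exact: tame_homeo_continuous.
have c2 : {for s, continuous (carc e)} by exact: carc_continuous.
  exact: (@continuous_comp R V V (carc e) f s c2 c1).
Qed.

Let lam_le h s s' : 0 <= s -> s <= s' -> s' <= s0 h -> lam h s <= lam h s'.
Proof.
have [_ _ lm _ _] := fstr h.
by move=> h0; rewrite le_eqVlt => /predU1P[->//|ss'] h1; apply/ltW/lm.
Qed.

Let cone_le e s s' : 0 <= s -> s <= s' -> s' <= 1 ->
  within_cone (a e) kap (carc e s' - carc e s).
Proof.
move=> h; rewrite le_eqVlt => /predU1P[->|ss'] h'; first by rewrite subrr; exact: within_cone0.
by rewrite !carcE; [exact: cone|lra|lra].
Qed.

(** Chords stay in the cone after the ends have been straightened, because the new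
    segments are chords of the original edge. *)
Let cone_X e s s' : 0 <= s -> s <= s' -> s' <= 1 ->
  within_cone (a e) kap (X e s' - X e s).
Proof.
have /andP[g1 g2] := sg_itv e; have /andP[u1 u2] := tau_itv e.
have gu := sgtau e.
have E0 : X e 0 = carc e 0.
  by rewrite /X -/(branch (e, false) 0) branch0 // fv.
have E1 : X e 1 = carc e 1.
  have E : carc e 1 = branch (e, true) 0 by rewrite /branch /= subr0.
  by rewrite /X E branch0 // fv.
have Eg : X e (sg e) = carc e (sg e) by rewrite X2 // lexx ltW.
have Eu : X e (tau e) = carc e (tau e) by rewrite X2 // lexx andbT ltW.
have A r r' : 0 <= r -> r <= r' -> r' <= sg e -> within_cone (a e) kap (X e r' - X e r).
  move=> h1 h2 h3; rewrite (X1 (s := r)) ?h1 ?(le_trans h2) //.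
  rewrite (X1 (s := r')) ?h3 ?(le_trans h1) //.
  rewrite opprD addrACA subrr add0r -scalerBl; apply: within_coneZ.
    by rewrite subr_ge0; exact: lam_le.
  by rewrite Eg E0; apply: cone_le; lra.
have B r r' : sg e <= r -> r <= r' -> r' <= tau e -> within_cone (a e) kap (X e r' - X e r).
  move=> h1 h2 h3; rewrite (X2 (s := r)) ?h1 ?(le_trans h2) //.
  rewrite (X2 (s := r')) ?h3 ?(le_trans h1) //.
  by apply: cone_le; lra.
have C r r' : tau e <= r -> r <= r' -> r' <= 1 -> within_cone (a e) kap (X e r' - X e r).
  move=> h1 h2 h3; rewrite (X3 (s := r)) ?h1 ?(le_trans h2) //.
  rewrite (X3 (s := r')) ?h3 ?(le_trans h1) //.
  rewrite opprD addrACA subrr add0r -scalerBl -opprB scaleNr -scalerN opprB.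
  apply: within_coneZ.
    rewrite subr_ge0; apply: lam_le; rewrite ?subr_ge0 ?lerD2l ?lerN2 //.
    by move: h1; rewrite /tau; lra.
  by rewrite E1 Eu; apply: cone_le; lra.
have glue r r' r'' : within_cone (a e) kap (X e r' - X e r) ->
    within_cone (a e) kap (X e r'' - X e r') -> within_cone (a e) kap (X e r'' - X e r).
  by move=> h1 h2; rewrite -(subrK (X e r') (X e r'')) -addrA; exact: within_coneD.
move=> h1 h2 h3; have [sa|sa] := leP s (sg e); have [sb|sb] := leP s (tau e);
  have [s'a|s'a] := leP s' (sg e); have [s'b|s'b] := leP s' (tau e); try lra.
- exact: A.
- by apply: (glue _ (sg e)); [apply: A|apply: B] => //; exact: ltW.
- apply: (glue _ (sg e)); first exact: A.
  by apply: (glue _ (tau e)); [apply: B|apply: C] => //; exact: ltW.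
- by apply: B => //; exact: ltW.
- by apply: (glue _ (tau e)); [apply: B|apply: C] => //; exact: ltW.
- by apply: C => //; exact: ltW.
Qed.

Let ht e s := dotv (X e s) (a e).

Let ht_lt e s s' : 0 <= s -> s < s' -> s' <= 1 -> ht e s < ht e s'.
Proof.
move=> h1 h2 h3; have hc := cone_X e h1 (ltW h2) h3.
have h0 := within_cone_dot_ge0 kap0 hc.
rewrite -subr_gt0 /ht -dotvBl lt_neqAle h0 andbT; apply/eqP => E.
have := enorm_within_cone (a1 e) hc h0; rewrite -E mulr0 => n0.
have /eqP : enorm (X e s' - X e s) = 0 by apply/eqP; rewrite eq_le n0 enorm_ge0.
move/eqP/enorm_eq0/eqP; rewrite subr_eq0 => /eqP/(tame_homeo_inj tf).
have s01 : 0 <= s <= 1 by rewrite h1 (le_trans (ltW h2)).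
have s01' : 0 <= s' <= 1 by rewrite h3 (le_trans h1 (ltW h2)).
rewrite !carcE // => /(garc_inj contG loopG s01' s01) E'.
by move: h2; rewrite E' ltxx.
Qed.

Let x e k := X e (t e k).
(* [Y] is the projection of a piece to its chord along the planes orthogonal to the axis. *)
Let theta e k s := (ht e s - ht e (t e k)) / (ht e (t e k.+1) - ht e (t e k)).
Let Y e k s := x e k + theta e k s *: (x e k.+1 - x e k).

Let in01 e k s : (k <= N.+2)%N -> t e k <= s <= t e k.+1 -> 0 <= s <= 1.
Proof.
move=> kN /andP[h1 h2]; have /andP[h3 _] := cut_itv ct (leqW kN : (k <= (n e).+1)%N).
have /andP[_ h4] := cut_itv ct (kN : (k.+1 <= (n e).+1)%N).
by rewrite (le_trans h3) // (le_trans h2).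
Qed.

Let dht e k : (k <= N.+2)%N -> 0 < ht e (t e k.+1) - ht e (t e k).
Proof.
move=> kN; rewrite subr_gt0; apply: ht_lt.
- by case/andP: (cut_itv ct (leqW kN : (k <= (n e).+1)%N)).
- exact: (cut_lt ct (ltnSn k)).
- by case/andP: (cut_itv ct (kN : (k.+1 <= (n e).+1)%N)).
Qed.

Let ht_le e s s' : 0 <= s -> s <= s' -> s' <= 1 -> ht e s <= ht e s'.
Proof. by move=> h1; rewrite le_eqVlt => /predU1P[->//|h2 h3]; apply/ltW/ht_lt. Qed.

Let theta_le e k s s' : (k <= N.+2)%N -> t e k <= s -> s <= s' -> s' <= t e k.+1 ->
  theta e k s <= theta e k s'.
Proof.
move=> kN h1 h2 h3; rewrite /theta ler_pM2r ?invr_gt0 ?dht // lerD2r.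
have /andP[p1 p2] : 0 <= s <= 1 by apply: (@in01 e k s kN); rewrite h1 (le_trans h2).
have /andP[p3 p4] : 0 <= s' <= 1 by apply: (@in01 e k s' kN); rewrite h3 (le_trans h1).
exact: ht_le.
Qed.

Let theta0 e k : theta e k (t e k) = 0. Proof. by rewrite /theta subrr mul0r. Qed.
Let theta1 e k : (k <= N.+2)%N -> theta e k (t e k.+1) = 1.
Proof. by move=> kN; rewrite /theta mulfV // gt_eqF // dht. Qed.

Let theta01 e k s : (k <= N.+2)%N -> t e k <= s <= t e k.+1 -> 0 <= theta e k s <= 1.
Proof.
move=> kN /andP[h1 h2]; rewrite -{1}(theta0 e k) -(theta1 e kN).
by rewrite !theta_le // (le_trans h1).
Qed.

Let ht_Y e k s : (k <= N.+2)%N -> dotv (Y e k s) (a e) = ht e s.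
Proof.
move=> kN; rewrite /Y dotvDl dotvZl dotvBl -!/(ht _ _) /theta divfK ?gt_eqF ?dht //.
by rewrite addrC subrK.
Qed.

(** On a piece that is already straight the projection to the chord does nothing. *)
Let Y_straight e k s (c : R) : (k <= N.+2)%N ->
  X e s = x e k + c *: (x e k.+1 - x e k) -> Y e k s = X e s.
Proof.
move=> kN E; suff -> : Y e k s = x e k + c *: (x e k.+1 - x e k) by [].
congr (_ + _ *: _); rewrite /theta /ht {1}E dotvDl dotvZl dotvBl -!/(ht _ _).
by field; rewrite gt_eqF // dht.
Qed.

(** Points are moved only in the middle of an edge. *)
Let Y_end e k s : (k <= N.+2)%N -> t e k <= s <= t e k.+1 ->
  Y e k s = X e s \/ (0 < k <= N.+1)%N.
Proof.
case: k => [_|k]; rewrite ?t0 ?t1.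
  by move=> hs; left; apply: Y_straight => //; rewrite /x t0 t1; exact: X1.
rewrite ltnS leq_eqVlt => /predU1P[->|kN]; last by right.
rewrite tN tlast => hs; left.
apply: (@Y_straight e N.+2 s (1 - lam (e, true) (1 - s))) => //.
rewrite /x tN tlast X3 //; move: (X e 1) (X e (tau e)) (lam _ _) => A B l.
by apply/rowP => i; rewrite !mxE; ring.
Qed.

(** The displacements of two points of one edge differ by at most half of their distance:
    the difference of the points and that of their projections have the same height and
    lie in a narrow cone. *)
Let same_edge e k k' s s' : (k <= N.+2)%N -> (k' <= N.+2)%N ->
  t e k <= s <= t e k.+1 -> t e k' <= s' <= t e k'.+1 ->
  `|(Y e k s - X e s) - (Y e k' s' - X e s')| <= 2^-1 * `|X e s - X e s'|.
Proof.
wlog : k k' s s' / (k < k')%N \/ (k = k' /\ s <= s').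
  move=> W kN kN' hs hs'.
  have swap : (k' < k)%N \/ (k' = k /\ s' <= s) ->
    `|(Y e k s - X e s) - (Y e k' s' - X e s')| <= 2^-1 * `|X e s - X e s'|.
    by move=> h; rewrite distrC (distrC (X e s)); apply: W.
  have [kk|kk|kk] := ltngtP k k'; first by apply: W => //; left.
    by apply: swap; left.
  subst k'; have [ss|/ltW ss] := leP s s'; first by apply: W => //; right.
  by apply: swap; right.
move=> order kN kN' hs hs'.
have ss' : s <= s'.
  case: order => [kk|[]//]; case/andP: hs => _ h; case/andP: hs' => h' _.
  apply: le_trans h (le_trans _ h'); apply: (cut_le ct) => //; exact: leqW.
have /andP[p1 p2] := in01 kN hs; have /andP[p3 p4] := in01 kN' hs'.
have xk j : (j <= N.+2)%N -> within_cone (a e) kap (x e j.+1 - x e j).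
  move=> jN; apply: cone_X; first by case/andP: (cut_itv ct (leqW jN : (j <= (n e).+1)%N)).
    by apply: (cut_le ct) => //.
  by case/andP: (cut_itv ct (jN : (j.+1 <= (n e).+1)%N)).
have cX := cone_X e p1 ss' p4.
have cY : within_cone (a e) kap (Y e k' s' - Y e k s).
  have /andP[q1 q2] := theta01 kN hs; have /andP[q3 q4] := theta01 kN' hs'.
  case: order => [kk|[kk _]].
    have -> : Y e k' s' - Y e k s = theta e k' s' *: (x e k'.+1 - x e k') +
       ((x e k' - x e k.+1) + (1 - theta e k s) *: (x e k.+1 - x e k)).
      by rewrite /Y; apply/rowP => i; rewrite !mxE; ring.
    apply: within_coneD; first by apply: within_coneZ => //; exact: xk.
    apply: within_coneD; last by apply: within_coneZ; rewrite ?subr_ge0 //; exact: xk.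
    apply: cone_X.
    + by case/andP: (cut_itv ct (kN : (k.+1 <= (n e).+1)%N)).
    + by apply: (cut_le ct) => //; exact: leqW.
    + by case/andP: (cut_itv ct (leqW kN' : (k' <= (n e).+1)%N)).
  subst k'; rewrite /Y opprD addrACA subrr add0r -scalerBl; apply: within_coneZ (xk _ kN).
  by rewrite subr_ge0; case/andP: hs => ? ?; case/andP: hs' => ? ?; apply: theta_le.
pose h := ht e s' - ht e s.
have hX : dotv (X e s' - X e s) (a e) = h by rewrite dotvBl.
have hY : dotv (Y e k' s' - Y e k s) (a e) = h by rewrite dotvBl !ht_Y.
move: cX cY; rewrite /within_cone hX hY => cX cY.
have -> : Y e k s - X e s - (Y e k' s' - X e s') =
  ((X e s' - X e s) - h *: a e) - ((Y e k' s' - Y e k s) - h *: a e).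
  by apply/rowP => i; rewrite !mxE; ring.
apply: le_trans (norm_le_enorm _) _; apply: le_trans (enormD _ _) _; rewrite enormN.
have h1 : h <= enorm (X e s' - X e s).
  by rewrite -hX; have := dotv_le (X e s' - X e s) (a e); rewrite a1 mulr1.
have h2 := enorm_le_norm (X e s' - X e s); rewrite (distrC (X e s)).
have h0 : 0 <= h by rewrite subr_ge0; exact: ht_le.
have : kap * h <= 12^-1 * h by rewrite ler_wpM2r.
move: cX cY; set A := enorm _; set B := enorm _; lra.
Qed.

Variables (eps M Delta : R).
Hypothesis M0 : 0 <= M.
Hypothesis M_Delta : 4 * M <= Delta.
Hypothesis apart_edges : forall (e e' : gedge G) s s', e != e' ->
  sg e <= s <= tau e -> 0 <= s' <= 1 -> Delta <= `|X e s - X e' s'|.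
Hypothesis apart_verts : forall (e : gedge G) (v : gvert G) s,
  sg e <= s <= tau e -> Delta <= `|X e s - gpos v|.
Hypothesis small_pieces : forall (e : gedge G) s s', 0 <= s <= 1 -> 0 <= s' <= 1 ->
  `|s - s'| <= N.+1%:R^-1 ->  `|carc e s - carc e s'| <= M / 2 /\ `|carc e s - carc e s'| <= eps / 3.
Hypothesis small_ends : forall h, `|branch h (s0 h) - gpos (gend h)| <= eps / 3.

Let piece_small e k s s' : (0 < k <= N.+1)%N -> t e k <= s <= t e k.+1 ->
  t e k <= s' <= t e k.+1 -> `|X e s - X e s'| <= M / 2 /\ `|X e s - X e s'| <= eps / 3.
Proof.
case: k => // k kN hs hs'.
have hk : (k.+1 <= N.+2)%N by apply: ltnW.
rewrite !X2 ?(fine_cuts_mid kN) //; apply: small_pieces; [exact: (in01 hk hs)|exact: (in01 hk hs')|].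
have : t e k.+2 - t e k.+1 <= N.+1%:R^-1.
  rewrite mesh // ler_piMl ?invr_ge0 //.
  by have /andP[? ?] := sg_itv e; have /andP[? ?] := tau_itv e; lra.
move: hs hs' => /andP[q1 q2] /andP[q3 q4]; move: (t e k.+1) (t e k.+2) q1 q2 q3 q4.
move: (N.+1%:R^-1 : R) => u b c q1 q2 q3 q4 hm.
by rewrite ler_norml; apply/andP; split; lra.
Qed.

Let Y_close e k s : (k <= N.+2)%N -> t e k <= s <= t e k.+1 -> `|Y e k s - X e s| <= M.
Proof.
move=> kN hs; have [->|km] := Y_end kN hs; first by rewrite subrr normr0.
have kk : t e k <= t e k.+1 by case/andP: hs => h; exact: le_trans.
have hl : t e k <= t e k <= t e k.+1 by rewrite lexx kk.
have hr : t e k <= t e k.+1 <= t e k.+1 by rewrite lexx kk.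
have [h1 _] := piece_small km hl hs; have [h2 _] := piece_small km hr hl.
have /andP[q1 q2] := theta01 kN hs.
rewrite /Y addrAC; apply: le_trans (ler_normD _ _) _.
rewrite normrZ (ger0_norm q1).
have : theta e k s * `|X e (t e k.+1) - X e (t e k)| <= 1 * (M / 2) by rewrite ler_pM.
lra.
Qed.

(** Two points on different edges, or a point on an edge and a vertex, are far apart
    compared with the size [M] of the displacement unless both are fixed. *)
Let XY_homeo : exists g : V -> V, [/\ tame_homeo g, forall v : gvert G, g (gpos v) = gpos v &
  forall e k s, (k <= N.+2)%N -> t e k <= s <= t e k.+1 -> g (X e s) = Y e k s].
Proof.
pose ok (z : gedge G * nat * R) :=
  (z.1.2 <= N.+2)%N && (t z.1.1 z.1.2 <= z.2 <= t z.1.1 z.1.2.+1).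
pose A := (gvert G + {z | ok z})%type.
pose XA (i : A) := match i with
  | inl v => gpos v | inr z => X (sval z).1.1 (sval z).2 end.
pose YA (i : A) := match i with
  | inl v => gpos v | inr z => Y (sval z).1.1 (sval z).1.2 (sval z).2 end.
have [||||g [tg gXY]] := @family_homeo R A XA YA (2^-1) M.
- by rewrite invr_ge0 ler0n /= invf_lt1 ?ltr1n.
- exact: M0.
- have mixed (v : gvert G) e k s : (k <= N.+2)%N -> t e k <= s <= t e k.+1 ->
     `|Y e k s - X e s| <= 2^-1 * `|X e s - gpos v|.
    move=> kN hs; have [->|km] := Y_end kN hs; first by rewrite subrr normr0 mulr_ge0.
    have := Y_close kN hs; have := apart_verts v (fine_cuts_mid km hs).
    have := M_Delta; have := M0; lra.
  move=> [v|[[[e k] s] /= /andP[kN hs]]] [v'|[[[e' k'] s'] /= /andP[kN' hs']]] /=.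
  + by rewrite !subrr normr0 mulr_ge0.
  + by rewrite (subrr (gpos v)) sub0r normrN (distrC (gpos v)); exact: mixed.
  + by rewrite (subrr (gpos v')) subr0; exact: mixed.
  + have [ee|ee] := eqVneq e e'; first by subst e'; exact: same_edge.
    have n1 := Y_close kN hs; have n2 := Y_close kN' hs'.
    have n3 := ler_normB (Y e k s - X e s) (Y e' k' s' - X e' s').
    have [E1|km] := Y_end kN hs; last first.
      have := apart_edges ee (fine_cuts_mid km hs) (in01 kN' hs').
      have := M_Delta; lra.
    have [E2|km'] := Y_end kN' hs'; first by rewrite E1 E2 !subrr normr0 mulr_ge0.
    rewrite eq_sym in ee; have := apart_edges ee (fine_cuts_mid km' hs') (in01 kN hs).
    rewrite (distrC (X e' s')); have := M_Delta; lra.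
- move=> [v|[[[e k] s] /= /andP[kN hs]]] /=; first by rewrite subrr normr0 M0.
  exact: Y_close.
exists g; split=> // [v|e k s kN hs]; first exact: (gXY (inl v)).
have okz : ok (e, k, s) by rewrite /ok /= kN.
exact: (gXY (inr (exist _ (e, k, s) okz))).
Qed.

Let x_garc e k : (k <= N.+3)%N -> x e k = garc e (t e k).
Proof.
move=> kN; have k01 : 0 <= t e k <= 1 by exact: (cut_itv ct).
rewrite /x; case: k kN k01 => [_ _|k].
  by rewrite t0 /X carcE ?lexx ?ler01 // (garc01 contG e false) fv.
rewrite ltnS leq_eqVlt => /predU1P[->|kN] k01.
  by rewrite tlast /X carcE ?lexx ?ler01 // (garc01 contG e true) fv.
rewrite X2 ?carcE // -(t1 e) -(tN e).
by apply/andP; split; apply: (cut_le ct) => //; apply: leqW.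
Qed.

Lemma chord_polygon : exists g : V -> V,
  [/\ tame_homeo g, continuous_graph (chord_graph (subdivision n t)),
    g @` carrier G = carrier (chord_graph (subdivision n t)) &
    forall E : gedge (chord_graph (subdivision n t)), edge_length E <= eps].
Proof.
have [g2 [tg2 g2v g2X]] := XY_homeo.
have tg : tame_homeo (g2 \o f) by exact: tame_homeo_comp.
exists (g2 \o f).
have nodeE e k : (k <= N.+3)%N -> @gpos _ (subdivision n t) (node n e k) = x e k.
  by move=> kN; rewrite (gpos_node contG ct) // x_garc.
have chordE (E : gedge (chord_graph (subdivision n t))) y :
    garc (s := chord_graph (subdivision n t)) E y =
    x (tag E) (tagged E) + y *: (x (tag E) (tagged E).+1 - x (tag E) (tagged E)).
  case: E => e [k kN].
  rewrite -[LHS]/((1 - y) *: @gpos _ (subdivision n t) (node n e (k + 0)) +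
     y *: @gpos _ (subdivision n t) (node n e (k + 1))).
  rewrite addn0 addn1 !nodeE //; last exact: ltnW.
  by apply/rowP => i; rewrite !mxE; ring.
have image e k s : (k <= N.+2)%N -> t e k <= s <= t e k.+1 ->
    (g2 \o f) (garc e s) = Y e k s.
  by move=> kN hs; rewrite /= -(carcE _ (in01 kN hs)) -/(X e s) (g2X e k s).
have [|||cc gc] := @chord_graph_image R (subdivision n t) (g2 \o f)
   (subdivision_continuous contG ct) (tame_homeo_inj tg) _ _ _.
- move=> [v|[e j]] /=; first by rewrite fv g2v.
  have kN : (j.+1 <= N.+2)%N by exact: ltn_ord.
  have hs : t e j.+1 <= t e j.+1 <= t e j.+2 by rewrite lexx (cut_le ct).
  rewrite -[g2 _]/((g2 \o f) _) (image e j.+1) // /Y theta0 scale0r addr0 x_garc //.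
  exact: leqW.
- move=> [e [k kN0]] y /andP[y0 y1]; have kN : (k <= N.+2)%N := kN0.
  have dk := dht e kN.
  have [|||s /andP[sa sb] sE] := @IVT_itv R (ht e) (t e k) (t e k.+1)
     (ht e (t e k) + y * (ht e (t e k.+1) - ht e (t e k))).
  + by apply: (cut_le ct).
  + move=> s; have c1 : {for s, continuous (X e)} by exact: X_continuous.
    have c2 : {for X e s, continuous (fun v : V => dotv v (a e))} by exact: dotv_continuous.
    exact: (@continuous_comp R V R (X e) (fun v => dotv v (a e)) s c1 c2).
  + by apply/andP; split; nra.
  have sa' : t e k < s.
    rewrite lt_neqAle sa andbT; apply/eqP => E; move: sE; rewrite -E; nra.
  have sb' : s < t e k.+1.
    rewrite lt_neqAle sb andbT; apply/eqP => E; move: sE; rewrite E; nra.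
  have hs : t e k <= s <= t e k.+1 by rewrite sa sb.
  have [s' s'01 s'E] := piece_param ct kN hs.
  have dt : 0 < t e k.+1 - t e k by rewrite subr_gt0 (lt_trans sa').
  exists s'.
    have : 0 < s' * (t e k.+1 - t e k) by rewrite -(ltrD2l (t e k)) addr0 -s'E.
    have : s' * (t e k.+1 - t e k) < 1 * (t e k.+1 - t e k).
      by rewrite -(ltrD2l (t e k)) -s'E mul1r addrC subrK.
    by rewrite ltr_pM2r // pmulr_lgt0 // => -> ->.
  rewrite chordE -[garc _ _]/(garc e (t e k + s' * (t e k.+1 - t e k))) -s'E.
  rewrite (image e k) // /Y /=; congr (_ + _ *: _).
  by rewrite /theta sE addrC addKr mulfK // gt_eqF.
- move=> [e [k kN0]] s s01; have kN : (k <= N.+2)%N := kN0.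
  have hs := piece_itv ct kN s01.
  exists (theta e k (t e k + s * (t e k.+1 - t e k))); first exact: theta01.
  by rewrite chordE -[garc _ _]/(garc e (t e k + s * (t e k.+1 - t e k))) (image e k).
split=> //.
  by rewrite -gc (subdivision_carrier ct).
move=> [e [k kN0]]; have kN : (k <= N.+2)%N := kN0.
rewrite -[edge_length _]/(enorm (@gpos _ (subdivision n t) (node n e (k + 1)) -
  @gpos _ (subdivision n t) (node n e (k + 0)))).
rewrite addn0 addn1 !nodeE //; last exact: leqW.
apply: le_trans (enorm_le_norm _) _.
suff : `|x e k.+1 - x e k| <= eps / 3 by lra.
case: k kN {kN0} => [_|k].
  rewrite !x_garc // t0 t1 (garc01 contG e false).
  have := small_ends (e, false); rewrite /branch /= carcE //.
  by have /andP[q1 q2] := s0_itv (e, false); apply/andP; split; lra.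
rewrite ltnS leq_eqVlt => /predU1P[->|kN].
  rewrite !x_garc // tN tlast (garc01 contG e true) distrC.
  have := small_ends (e, true); rewrite /branch /= carcE //.
  by have /andP[q1 q2] := s0_itv (e, true); apply/andP; split; lra.
have kl : t e k.+1 <= t e k.+2 by apply: (cut_le ct) => //; rewrite !ltnS ltnW.
have [|||_ h] := @piece_small e k.+1 (t e k.+2) (t e k.+1); rewrite ?lexx ?kl //.
Qed.

End Polygon.

(** * Graphs with almost straight edges *)

Section ConeGraph.
Variable R : realType.
Local Notation V := 'rV[R]_3.
Variables (G : sgraph R) (a : gedge G -> V) (mu : R).
Hypotheses (contG : continuous_graph G) (loopG : loopless G).
Hypotheses (a1 : forall e, enorm (a e) = 1) (mu01 : 0 < mu <= 1).
Hypothesis cone : forall (e : gedge G) (s t : R), 0 <= s -> s < t -> t <= 1 ->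
  within_cone (a e) (mu / 32) (garc e t - garc e s).
Hypothesis spread : forall v : gvert G, exists2 u : V, enorm u = 1 &
  forall h, gend h = v -> mu - 1 <= dotv (end_axis a h) u.

(** Straightening the stars at the vertices is followed by a projection of the rest
    of every edge to a fine inscribed polygon; near the vertices the projection is
    the identity, so that strands which leave a vertex in the same direction do not
    have to be compared. *)
Lemma cone_graph_polygon (eps : R) : 0 < eps ->
  exists (n : gedge G -> nat) (t : gedge G -> nat -> R),
  [/\ cuts n t, continuous_graph (chord_graph (subdivision n t)),
    ambient_isotopic R (carrier G) (carrier (chord_graph (subdivision n t))) &
    forall E : gedge (chord_graph (subdivision n t)), edge_length E <= eps].
Proof.
move=> eps0; have e3 : 0 < eps / 3 by rewrite divr_gt0.
have [f [s0 [lam [tf fv ends]]]] :=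
  straighten_vertices contG loopG a1 mu01 cone spread e3.
have s0P h : 0 < s0 h < 3^-1 by case: (ends h).
have fstr h : straightened_end f h (s0 h) (lam h) (2 / 3) by case: (ends h).
pose X e s := f (carc (G := G) e s).
have Xc e : continuous (X e).
  move=> s; have c1 : {for carc e s, continuous f} by exact: tame_homeo_continuous.
  have c2 : {for s, continuous (carc e)} by exact: carc_continuous.
  exact: (@continuous_comp R V V (carc e) f s c2 c1).
have mid e s : s0 (e, false) <= s <= 1 - s0 (e, true) -> 0 < s < 1.
  have /andP[? ?] := s0P (e, false); have /andP[? ?] := s0P (e, true).
  by move=> /andP[? ?]; apply/andP; split; lra.
have cc (r : R) : 0 < r < 1 -> 0 <= r <= 1 by move=> /andP[/ltW-> /ltW->].
have [D1 D10 HD1] : exists2 d : R, 0 < d & forall p : gedge G * gedge G,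
    forall s s', p.1 != p.2 -> s0 (p.1, false) <= s <= 1 - s0 (p.1, true) ->
    0 <= s' <= 1 -> d <= `|X p.1 s - X p.2 s'|.
  apply: (@small_forall R (gedge G * gedge G)%type (fun p d => forall s s', p.1 != p.2 ->
    s0 (p.1, false) <= s <= 1 - s0 (p.1, true) -> 0 <= s' <= 1 -> d <= `|X p.1 s - X p.2 s'|)).
    by move=> p d d' /andP[_ dd'] h s s' h1 h2 h3; apply: le_trans dd' _; exact: h.
  move=> [e e'] /=; have [_|ee] := eqVneq e e'; first by exists 1.
  have [|d d0 hd] := @arcs_apart R (X e) (X e') (s0 (e, false)) (1 - s0 (e, true)) (Xc e) (Xc e').
    move=> s s' s01 s01' /mid h /(tame_homeo_inj tf); rewrite !carcE // => /esym E.
    by have [E' _] := garc_interior_inj contG s01' h E; rewrite E' eqxx in ee.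
  by exists d => // s s' _ h h'; apply: hd => //; exact: (cc _ (mid _ _ h)).
have [D2 D20 HD2] : exists2 d : R, 0 < d & forall p : gedge G * gvert G,
    forall s, s0 (p.1, false) <= s <= 1 - s0 (p.1, true) -> d <= `|X p.1 s - gpos p.2|.
  apply: (@small_forall R (gedge G * gvert G)%type (fun p d => forall s,
    s0 (p.1, false) <= s <= 1 - s0 (p.1, true) -> d <= `|X p.1 s - gpos p.2|)).
    by move=> p d d' /andP[_ dd'] h s h1; apply: le_trans dd' _; exact: h.
  move=> [e v] /=.
  have [|d d0 hd] := @arcs_apart R (X e) (fun=> gpos v) (s0 (e, false)) (1 - s0 (e, true)) (Xc e)
      (@cst_continuous _ _ _).
    move=> s _ s01 _ /mid h; rewrite -fv => /(tame_homeo_inj tf); rewrite carcE //.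
    by case: contG => _ _ _ avoid _; apply: avoid; rewrite in_itv.
  exists d => // s h; apply: (hd s 0) => //; first exact: (cc _ (mid _ _ h)).
  by rewrite lexx ler01.
(* The displacement has to be small compared with the distances between the edges. *)
pose Delta := Num.min D1 D2; pose M := Delta / 4.
have Delta0 : 0 < Delta by rewrite lt_min D10.
have M0 : 0 < M by rewrite divr_gt0.
pose me := Num.min (M / 2) (eps / 3).
have me0 : 0 < me by rewrite lt_min e3 andbT divr_gt0.
have [d d0 hd] : exists2 d : R, 0 < d & forall (e : gedge G) s s', 0 <= s <= 1 -> 0 <= s' <= 1 ->
    `|s - s'| < d -> `|carc e s - carc e s'| < me.
  apply: (@small_forall R (gedge G) (fun e d => forall s s', 0 <= s <= 1 -> 0 <= s' <= 1 ->
    `|s - s'| < d -> `|carc e s - carc e s'| < me)).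
    by move=> e d d' /andP[_ dd'] h s s' h1 h2 h3; apply: h => //; exact: lt_le_trans dd'.
  move=> e; have [d d0 hd] := unif_continuous01 (carc_continuous (e := e) contG) me0.
  by exists d.
have [N _ hN] := near_infty_natSinv_lt (PosNum d0).
have kap0 : 0 < mu / 32 by case/andP: mu01 => ? _; rewrite divr_gt0.
have kap12 : mu / 32 <= 12^-1 by case/andP: mu01 => _ ?; lra.
have [|||||g [tg cg gc len]] := @chord_polygon R G a (mu / 32) contG loopG a1 kap0 kap12 cone
   f s0 lam tf fv s0P fstr N eps M Delta (ltW M0).
- by rewrite /M; lra.
- move=> e e' s s' ee h h'; apply: le_trans (HD1 (e, e') s s' ee h h').
  by rewrite /Delta ge_min lexx.
- move=> e v s h; apply: le_trans (HD2 (e, v) s h).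
  by rewrite /Delta ge_min lexx orbT.
- move=> e s s' h h' ss'.
  have : `|carc e s - carc e s'| < me.
    by apply: hd => //; apply: le_lt_trans ss' _; exact: (hN N (leqnn N)).
  by rewrite lt_min => /andP[/ltW-> /ltW->].
- by move=> h; apply: ltW; case: (ends h).
exists (fun=> N.+2), (fine_cuts s0 N); split=> //.
- exact: fine_cutsP.
- exact: tame_homeo_isotopic tg gc.
Qed.

End ConeGraph.

(** * Simple polygonal lines *)

Section Polyline.
Variable R : realType.
Local Notation V := 'rV[R]_3.

Lemma crossing_segments (a b c d : V) (y y' : R) : 0 <= y <= 1 -> 0 <= y' <= 1 ->
  a + y *: (b - a) = c + y' *: (d - c) -> `|a - c| + `|b - d| <= `|a - b| + `|c - d|.
Proof.
move=> /andP[y0 y1] /andP[z0 z1] E; set x := a + y *: (b - a) in E.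
have ha : `|a - x| = y * `|a - b|.
  by rewrite /x opprD addrA subrr add0r normrN normrZ ger0_norm // distrC.
have hb : `|b - x| = (1 - y) * `|a - b|.
  have -> : b - x = (1 - y) *: (b - a) by rewrite /x; apply/rowP => i; rewrite !mxE; ring.
  by rewrite normrZ ger0_norm ?subr_ge0 // distrC.
have hc : `|c - x| = y' * `|c - d|.
  by rewrite E opprD addrA subrr add0r normrN normrZ ger0_norm // distrC.
have hd : `|d - x| = (1 - y') * `|c - d|.
  have -> : d - x = (1 - y') *: (d - c) by rewrite E; apply/rowP => i; rewrite !mxE; ring.
  by rewrite normrZ ger0_norm ?subr_ge0 // distrC.
have := ler_distD x a c; have := ler_distD x b d.
rewrite (distrC x c) (distrC x d) ha hb hc hd; lra.
Qed.

(** Two vectors of the same direction differ by at most the longer one, so consecutive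
    segments overlap only if their outer ends are close. *)
Lemma overlapping_segments (v w : V) (al be : R) : 0 < al -> 0 <= be -> v != 0 ->
  al *: v = be *: w -> `|v - w| <= `|v| \/ `|v - w| <= `|w|.
Proof.
move=> al0 be0 v0 E; have vE : v = (be / al) *: w.
  by rewrite mulrC -scalerA -E scalerA mulVf ?scale1r // gt_eqF.
set c := be / al in vE; have c0 : 0 <= c by rewrite divr_ge0 // ltW.
have -> : v - w = (c - 1) *: w by rewrite scalerBl scale1r -vE.
have -> : `|v| = c * `|w| by rewrite vE normrZ ger0_norm.
rewrite normrZ; have := normr_ge0 w.
case: (lerP c 1) => h w0; [right|left].
  by apply: ler_piMl => //; lra.
by apply: ler_wpM2r => //; lra.
Qed.

(** If any two non-consecutive vertices are further apart than the lengths allowed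
    for the edges next to them, no edges cross: two crossing segments are the
    diagonals of a quadrilateral, and the sum of two opposite sides is at most the
    sum of the diagonals. *)
Lemma polyline_simple (P : nat -> V) (L : nat -> R) (n : nat) :
  (forall k, (k <= n)%N -> P k != P k.+1 /\ `|P k - P k.+1| <= L k) ->
  (forall i j, (i.+2 <= j)%N -> (j <= n.+1)%N -> L i < `|P i - P j| /\ L j.-1 < `|P i - P j|) ->
  forall k k' (y y' : R), (k <= n)%N -> (k' <= n)%N -> 0 < y < 1 -> 0 <= y' <= 1 ->
    P k + y *: (P k.+1 - P k) = P k' + y' *: (P k'.+1 - P k') -> k = k' /\ y = y'.
Proof.
move=> short far.
have cross k k' (y y' : R) : (k <= n)%N -> (k' <= n)%N -> 0 <= y <= 1 -> 0 <= y' <= 1 ->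
    P k + y *: (P k.+1 - P k) = P k' + y' *: (P k'.+1 - P k') -> (k.+2 <= k')%N -> False.
  move=> kn kn' y01 y01' /(crossing_segments y01 y01') h kk.
  have [_ l1] := short k kn; have [_ l2] := short k' kn'.
  have [f1 _] := far k k' kk (leqW kn'); have [_ f2] := far k.+1 k'.+1 kk kn'.
  by move: f2 => /= f2; lra.
have next k (al be : R) : (k.+1 <= n)%N -> 0 <= al -> 0 <= be -> 0 < al \/ 0 < be ->
    al *: (P k - P k.+1) = be *: (P k.+2 - P k.+1) -> False.
  move=> kn al0 be0 pos E.
  have [n1 l1] := short k (ltnW kn); have [n2 l2] := short k.+1 kn.
  have [f1 f2] := far k k.+2 (leqnn _) kn; rewrite /= in f2.
  have V0 : P k - P k.+1 != 0 by rewrite subr_eq0.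
  have W0 : P k.+2 - P k.+1 != 0 by rewrite subr_eq0 eq_sym.
  have D : P k - P k.+2 = (P k - P k.+1) - (P k.+2 - P k.+1).
    by rewrite opprB addrA subrK.
  rewrite (distrC (P k.+1)) in l2; rewrite {}D in f1 f2.
  move: (P k - P k.+1) (P k.+2 - P k.+1) V0 W0 E l1 l2 f1 f2 => v w V0 W0 E l1 l2 f1 f2.
  case: pos => h; first by have [] := overlapping_segments h be0 V0 E; lra.
  by have [] := overlapping_segments h al0 W0 (esym E); rewrite distrC; lra.
move=> k k' y y' kn kn' y01 y01' E; have /andP[y0 y1] := y01; have /andP[z0 z1] := y01'.
have y01c : 0 <= y <= 1 by rewrite !ltW.
have [kk|kk|kk] := ltngtP k k'.
- move: kk; rewrite leq_eqVlt => /predU1P[kk|kk]; last by case: (cross _ _ _ _ kn kn' y01c y01' E).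
  subst k'; case: (next k (1 - y) y' kn') => //; first by rewrite subr_ge0 ltW.
    by left; rewrite subr_gt0.
  apply: (addrI (P k.+1)); rewrite -E; apply/rowP => i; rewrite !mxE; ring.
- move: kk; rewrite leq_eqVlt => /predU1P[kk|kk]; last by case: (cross _ _ _ _ kn' kn y01' y01c (esym E)).
  subst k; case: (next k' (1 - y') y kn) => //; [by rewrite subr_ge0|exact: ltW|by right|].
  apply: (addrI (P k'.+1)); rewrite E; apply/rowP => i; rewrite !mxE; ring.
- subst k'; split=> //; have [n1 _] := short k kn.
  have /eqP : (y - y') *: (P k.+1 - P k) = 0.
    by rewrite scalerBl; apply/eqP; rewrite subr_eq0; apply/eqP/(addrI (P k)).
  by rewrite scaler_eq0 !subr_eq0 (eq_sym (P k.+1)) (negbTE n1) orbF => /eqP.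
Qed.

(** A chain along an arc with steps of length at most [ep] and with as few points as
    possible has no two non-consecutive points at distance [ep] or less, since one could
    otherwise omit the points between them. *)
Lemma minimal_chain (f : R -> V) (x0 x1 ep : R) : continuous f -> 0 <= x0 -> x0 < x1 ->
  x1 <= 1 -> 0 < ep -> exists (m : nat) (u : nat -> R),
  [/\ u 0 = x0, u m = x1,
    forall k, (k < m)%N -> u k < u k.+1 /\ `|f (u k) - f (u k.+1)| <= ep &
    forall i j, (i.+2 <= j)%N -> (j <= m)%N -> ep < `|f (u i) - f (u j)|].
Proof.
move=> cf x00 x01 x11 ep0.
pose chain m := exists u : nat -> R, [/\ u 0 = x0, u m = x1 &
    forall k, (k < m)%N -> u k < u k.+1 /\ `|f (u k) - f (u k.+1)| <= ep].
have [d d0 hd] := unif_continuous01 cf ep0.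
have ex : exists m, `[< chain m >].
  have [N _ /(_ N (leqnn N))/= hN] := near_infty_natSinv_lt (PosNum d0).
  exists N.+1; apply/asboolP; exists (fun k => x0 + k%:R / N.+1%:R * (x1 - x0)).
  have i0 : 0 < N.+1%:R^-1 :> R by rewrite invr_gt0.
  have uk k : (k <= N.+1)%N -> 0 <= x0 + k%:R / N.+1%:R * (x1 - x0) <= 1.
    move=> kN; have q0 : 0 <= k%:R / N.+1%:R :> R by rewrite divr_ge0.
    have q1 : k%:R / N.+1%:R <= 1 :> R by rewrite ler_pdivrMr ?mul1r ?ler_nat.
    move: (k%:R / N.+1%:R) q0 q1 => q q0 q1; have x10 : 0 <= x1 - x0 by lra.
    have h1 : 0 <= q * (x1 - x0) by rewrite mulr_ge0.
    have h2 : q * (x1 - x0) <= x1 - x0 by rewrite ler_piMl.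
    by apply/andP; split; lra.
  split; first by rewrite !mul0r addr0.
    by rewrite mulfV ?pnatr_eq0 // mul1r addrC subrK.
  move=> k kN.
  have D : x0 + k.+1%:R / N.+1%:R * (x1 - x0) - (x0 + k%:R / N.+1%:R * (x1 - x0)) =
      N.+1%:R^-1 * (x1 - x0).
    by rewrite -[k.+1%:R]natr1; set q := N.+1%:R^-1; ring.
  have Dp : 0 < N.+1%:R^-1 * (x1 - x0) by rewrite mulr_gt0 // subr_gt0.
  split; first by rewrite -subr_gt0 D.
  apply: ltW; apply: hd; [exact: uk (ltnW kN)|exact: uk|].
  rewrite distrC D gtr0_norm //; apply: le_lt_trans hN.
  by rewrite ler_piMr ?(ltW i0) //; lra.
have [m /asboolP[u [u0 um us]] mmin] := ex_minnP ex.
exists m, u; split=> //.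
have inc i j : (i < j)%N -> (j <= m)%N -> u i < u j.
  elim: j => // j IH; rewrite ltnS leq_eqVlt => /predU1P[->|ij] jm.
    by case: (us j jm).
  by apply: lt_trans (IH ij (ltnW jm)) _; case: (us j jm).
move=> i j ij jm; rewrite ltNge; apply/negP => close.
pose c := (j - i.+1)%N.
have c0 : (0 < c)%N by rewrite subn_gt0.
have cj : (i.+1 + c = j)%N by rewrite subnKC // ltnW.
have cm : (c <= m)%N by apply: leq_trans (leq_subr _ _) jm.
have : (m <= m - c)%N.
  apply: mmin; apply/asboolP; exists (fun k => if (k <= i)%N then u k else u (k + c)%N).
  split=> //.
    rewrite ifF ?subnK //; apply/negbTE; rewrite -ltnNge ltn_subRL addnC -addSn cj.
    exact: jm.
  move=> k km; rewrite ltn_subRL addnC in km.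
  have [ki|ik] := leqP k i; last first.
    by rewrite ifF ?addSn; [exact: us|apply/negbTE; rewrite -ltnNge ltnW].
  have [ki'|ik'] := leqP k.+1 i.
    by apply: us; apply: leq_trans ki' (leq_trans _ jm); apply: leq_trans (ltnW ij).
  have -> : k = i by apply/eqP; rewrite eqn_leq ki.
  rewrite cj; split=> //; apply: inc => //.
  exact: ltnW.
rewrite leqNgt ltn_subLR // -[X in (X < _)%N]add0n ltn_add2r c0 //.
Qed.

End Polyline.

(** * Fine embedded inscribed polygons *)

Section FineChords.
Variable R : realType.
Local Notation V := 'rV[R]_3.

(** The last parameter at which the arc is in the ball of radius [rho] around its starting
    point. *)
Lemma exit_time (f : R -> V) (rho et : R) : continuous f -> 0 < rho -> et <= 1 ->
  (forall s, 0 <= s <= 1 -> `|f s - f 0| <= rho -> s < et) ->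
  exists s0, [/\ 0 < s0 < et, `|f s0 - f 0| = rho &
    forall s, s0 < s -> s <= 1 -> rho < `|f s - f 0|].
Proof.
move=> cf rho0 et1 near.
pose g s := `|f s - f 0|.
have cg : continuous g.
  move=> s; apply: dist_continuous => e e0; have [d d0 hd] := continuous_dist (cf s) e0.
  exists d => // y /hd sy; apply: le_lt_trans (ler_dist_dist _ _) _.
  by rewrite opprB addrA subrK.
pose K := `[0, 1]%classic `&` [set s | g s <= rho].
have K0 : K 0 by split; rewrite /= ?in_itv /= ?lexx ?ler01 // /g subrr normr0 ltW.
have cK : compact K.
  apply: (compact_closedI (@segment_compact R 0 1)).
  by apply: (@closed_comp R R g [set x | x <= rho]); [move=> z _; exact: cg|exact: closed_le].
have cid : continuous (fun s : R => s) by move=> s; exact: cvg_id.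
have [s0 s0K s0max] := compact_EVT_max (ex_intro _ 0 K0) cK (continuous_subspaceT cid).
move: s0K; rewrite inE => -[]; rewrite /= in_itv /= => s01 gs0.
have beyond s : s0 < s -> s <= 1 -> rho < g s.
  move=> h1 h2; rewrite ltNge; apply/negP => gs.
  have : s <= s0.
    apply: (s0max s); rewrite inE; split => //=; rewrite in_itv /= h2 andbT.
    by case/andP: s01 => h _; apply: le_trans h (ltW h1).
  by rewrite leNgt h1.
have s0et : s0 < et by apply: near.
have gE : g s0 = rho.
  apply/eqP; rewrite eq_le gs0 /= leNgt; apply/negP => lt.
  have s0lt1 : s0 < 1 by apply: lt_le_trans s0et et1.
  have [|s /andP[h1 h2] gs] := @IVT_itv R g s0 1 rho (ltW s0lt1) cg.
    by rewrite gs0 ltW // beyond.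
  move: h1; rewrite le_eqVlt => /predU1P[E|h1]; first by move: lt; rewrite E gs ltxx.
  by have := beyond s h1 h2; rewrite gs ltxx.
exists s0; split=> //; rewrite s0et andbT lt_neqAle; case/andP: s01 => -> _; rewrite andbT.
by apply/eqP => E; move: rho0; rewrite -gE -E /g subrr normr0 ltxx.
Qed.

Variable G : sgraph R.
Hypotheses (contG : continuous_graph G) (loopG : loopless G).

Let cc (r : R) : 0 < r < 1 -> 0 <= r <= 1. Proof. by move=> /andP[/ltW-> /ltW->]. Qed.

Let flip (b : bool) (s : R) : 0 <= s <= 1 -> 0 <= (if b then 1 - s else s) <= 1.
Proof. by case: b => // /andP[h1 h2]; apply/andP; split; lra. Qed.

(** In a small ball around a vertex there are only initial parts of the edges which end
    there. *)
Lemma small_balls (et : R) : 0 < et -> exists2 rho : R, 0 < rho &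
  [/\ forall v w : gvert G, v != w -> 2 * rho < `|gpos v - gpos w|,
    forall (h : gedge G * bool) s, 0 <= s <= 1 -> `|branch h s - gpos (gend h)| <= rho -> s < et &
    forall (e : gedge G) v s, 0 <= s <= 1 -> v != gend (e, false) -> v != gend (e, true) ->
      rho < `|carc e s - gpos v|].
Proof.
move=> et0; have [_ _ posI avoid _] := contG.
have [d1 d10 H1] : exists2 r : R, 0 < r & forall p : gvert G * gvert G,
    p.1 != p.2 -> 2 * r < `|gpos p.1 - gpos p.2|.
  apply: (@small_forall R (gvert G * gvert G)%type
    (fun p r => p.1 != p.2 -> 2 * r < `|gpos p.1 - gpos p.2|)).
    by move=> p d d' /andP[_ dd'] h /h; apply: le_lt_trans; rewrite ler_wpM2l.
  move=> [v w] /=; have [_|vw] := eqVneq v w; first by exists 1.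
  have vw0 : 0 < `|gpos v - gpos w|.
    by rewrite normr_gt0 subr_eq0; apply: contra vw => /eqP/posI/eqP.
  by exists (`|gpos v - gpos w| / 4) => //; [rewrite divr_gt0|move=> _; lra].
have [d2 d20 H2] : exists2 r : R, 0 < r & forall h : gedge G * bool,
    forall s, 0 <= s <= 1 -> `|branch h s - gpos (gend h)| <= r -> s < et.
  apply: (@small_forall R (gedge G * bool)%type (fun h r =>
    forall s, 0 <= s <= 1 -> `|branch h s - gpos (gend h)| <= r -> s < et)).
    by move=> h d d' /andP[_ dd'] H s s01 hs; apply: H => //; exact: le_trans dd'.
  move=> h.
  have inj s s' : 0 <= s <= 1 -> 0 <= s' <= 1 -> branch h s = branch h s' -> s = s'.
    case: h => e b h1 h2; rewrite /branch /= !carcE ?flip //.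
    move=> /(garc_inj contG loopG (flip b h1) (flip b h2)).
    by case: b => // E; lra.
  have [d d0 hd] := inverse_modulus (branch_continuous contG (h := h)) et0 inj.
  exists (d / 2); first by rewrite divr_gt0.
  move=> s s01; rewrite -(branch0 contG) => hs.
  have : `|s - 0| < et by apply: hd => //; [rewrite lexx ler01|lra].
  by rewrite subr0; apply: le_lt_trans; exact: ler_norm.
have [d3 d30 H3] : exists2 r : R, 0 < r & forall p : gedge G * gvert G,
    forall s, 0 <= s <= 1 -> p.2 != gend (p.1, false) -> p.2 != gend (p.1, true) ->
    r < `|carc p.1 s - gpos p.2|.
  apply: (@small_forall R (gedge G * gvert G)%type (fun p r =>
    forall s, 0 <= s <= 1 -> p.2 != gend (p.1, false) -> p.2 != gend (p.1, true) ->
    r < `|carc p.1 s - gpos p.2|)).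
    move=> p d d' /andP[_ dd'] h s s01 n1 n2; apply: le_lt_trans dd' _; exact: h.
  move=> [e v] /=; have [_|n1] := eqVneq v (gend (e, false)); first by exists 1.
  have [_|n2] := eqVneq v (gend (e, true)); first by exists 1.
  have [|d d0 hd] := @arcs_apart R (carc e) (fun=> gpos v) 0 1 (carc_continuous contG)
     (@cst_continuous _ _ _).
    move=> s _ s01 _ _; rewrite carcE //.
    have [->|sn0] := eqVneq s 0.
      by rewrite (garc01 contG e false) => /posI E; rewrite E eqxx in n1.
    have [->|sn1] := eqVneq s 1.
      by rewrite (garc01 contG e true) => /posI E; rewrite E eqxx in n2.
    apply: avoid; rewrite in_itv /= !lt_neqAle eq_sym sn0 sn1 /=.
    by case/andP: s01 => -> ->.
  exists (d / 2); first by rewrite divr_gt0.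
  move=> s s01 _ _; have := hd s 0 s01; rewrite lexx ler01 s01 => /(_ isT isT); lra.
exists (Num.min d1 (Num.min d2 d3)); first by rewrite !lt_min d10 d20.
split=> [v w vw|h s s01 hs|e v s s01 n1 n2].
- apply: le_lt_trans (H1 (v, w) vw); rewrite ler_wpM2l //.
  by rewrite ge_min lexx.
- by apply: (H2 h) => //; apply: le_trans hs _; rewrite !ge_min lexx orbT.
- by apply: le_lt_trans (H3 (e, v) s s01 n1 n2); rewrite !ge_min lexx !orbT.
Qed.

Section Setup.
Variables (rho : R) (s0 : gedge G * bool -> R).
Hypothesis rho0 : 0 < rho.
Hypothesis far_verts : forall v w : gvert G, v != w -> 2 * rho < `|gpos v - gpos w|.
Hypothesis far_edges : forall (e : gedge G) v s, 0 <= s <= 1 ->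
  v != gend (e, false) -> v != gend (e, true) -> rho < `|carc e s - gpos v|.
Hypothesis s0_itv : forall h, 0 < s0 h < 3^-1.
Hypothesis s0_rho : forall h, `|branch h (s0 h) - gpos (gend h)| = rho.
Hypothesis s0_out : forall h s, s0 h < s -> s <= 1 -> rho < `|branch h s - gpos (gend h)|.

Definition middle (e : gedge G) (s : R) := s0 (e, false) <= s <= 1 - s0 (e, true).

(** The segment from the vertex at [h] to the point where the edge leaves the ball. *)
Definition spoke (h : gedge G * bool) (y : R) : V :=
  gpos (gend h) + y *: (branch h (s0 h) - gpos (gend h)).

Lemma middle_oo e s : middle e s -> 0 < s < 1.
Proof.
have /andP[? ?] := s0_itv (e, false); have /andP[? ?] := s0_itv (e, true).
by move=> /andP[? ?]; apply/andP; split; lra.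
Qed.

Lemma carc_flip (e : gedge G) s : carc e s = branch (e, true) (1 - s).
Proof. by rewrite /branch /= opprB addrC subrK. Qed.

Lemma middle_far e s (v : gvert G) : middle e s -> rho <= `|carc e s - gpos v|.
Proof.
move=> ms; have /andP[m1 m2] := ms; have /andP[h0 h1] := middle_oo ms.
have [->|n1] := eqVneq v (gend (e, false)).
  move: m1; rewrite le_eqVlt => /predU1P[<-|m1].
    by rewrite -[carc _ _]/(branch (e, false) _) s0_rho.
  by apply/ltW; apply: (@s0_out (e, false)) => //; exact: ltW.
have [->|n2] := eqVneq v (gend (e, true)).
  rewrite carc_flip; have : s0 (e, true) <= 1 - s by lra.
  rewrite le_eqVlt => /predU1P[<-|m3]; first by rewrite s0_rho.
  by apply/ltW; apply: (@s0_out (e, true)) => //; lra.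
by apply/ltW; apply: far_edges => //; rewrite !ltW.
Qed.

Lemma spoke_dist h y : 0 <= y -> `|spoke h y - gpos (gend h)| = y * rho.
Proof. by move=> y0; rewrite /spoke addrC addKr normrZ s0_rho ger0_norm. Qed.

Lemma spoke_vert h y (v : gvert G) : 0 < y <= 1 -> spoke h y <> gpos v.
Proof.
move=> /andP[y0 y1] E; have D := spoke_dist h (ltW y0); rewrite E in D.
have yr : 0 < y * rho by rewrite mulr_gt0.
have [vE|vn] := eqVneq v (gend h); first by move: yr; rewrite -D vE subrr normr0 ltxx.
have := far_verts vn; rewrite D; have : y * rho <= rho by rewrite ler_piMl // ltW.
by have := rho0; lra.
Qed.

Lemma tip_oo h : exists2 s, 0 < s < 1 & branch h (s0 h) = garc h.1 s.
Proof.
have /andP[q1 q2] := s0_itv h.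
exists (if h.2 then 1 - s0 h else s0 h); last first.
  by rewrite /branch carcE //; case: h.2; apply/andP; split; lra.
by case: h.2; apply/andP; split; lra.
Qed.

(** Radii of one ball meet only at the centre, because their ends on the sphere are points
    of different edges. *)
Lemma spokes_meet h h' (y y' : R) : h.1 != h'.1 -> 0 < y <= 1 -> 0 <= y' <= 1 ->
  spoke h y <> spoke h' y'.
Proof.
move=> hh y01 /andP[z0 z1] E; have /andP[y0 y1] := y01.
have D := spoke_dist h (ltW y0); have D' := spoke_dist h' z0; rewrite -E in D'.
have [gg|gg] := eqVneq (gend h) (gend h'); last first.
  have := far_verts gg; have := ler_distD (spoke h y) (gpos (gend h)) (gpos (gend h')).
  rewrite (distrC (gpos (gend h)) (spoke h y)) D D'.
  have : y * rho <= rho by rewrite ler_piMl // ltW.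
  have : y' * rho <= rho by rewrite ler_piMl // ltW.
  lra.
have yy : y = y'.
  by apply: (mulIf (lt0r_neq0 rho0)); rewrite -D -D' gg.
have /scalerI tips : y *: (branch h (s0 h) - gpos (gend h)) = y *: (branch h' (s0 h') - gpos (gend h)).
  by apply: (addrI (gpos (gend h))); move: E; rewrite /spoke -yy -gg.
have /addIr := tips (lt0r_neq0 y0).
have [s s1 ->] := tip_oo h; have [s' s1' ->] := tip_oo h'.
move=> /(garc_interior_inj contG (cc s1) s1')[ee _].
by rewrite ee eqxx in hh.
Qed.

Lemma spoke_middle h e s y : h.1 != e -> middle e s -> 0 <= y <= 1 -> carc e s <> spoke h y.
Proof.
move=> he ms /andP[y0 y1] E; have := middle_far (gend h) ms; rewrite E spoke_dist //.
rewrite -{1}(mul1r rho) ler_pM2r // => y1'.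
have yE : y = 1 by apply/eqP; rewrite eq_le y1.
move: E; rewrite yE /spoke scale1r addrC subrK.
have [s' s1' ->] := tip_oo h; rewrite carcE ?cc ?(middle_oo ms) //.
move=> /(garc_interior_inj contG (cc (middle_oo ms)) s1')[ee _].
by rewrite ee eqxx in he.
Qed.

Lemma spoke_continuous h : continuous (spoke h).
Proof.
apply: (@lip_continuous _ _ _ _ `|branch h (s0 h) - gpos (gend h)|) => x y.
by rewrite /spoke opprD addrACA subrr add0r -scalerBl normrZ mulrC.
Qed.

Lemma apart_pieces : exists2 D : R, 0 < D &
  (forall h e s y, h.1 != e -> middle e s -> 0 <= y <= 1 -> D <= `|carc e s - spoke h y|) /\
  (forall e e' s s', e != e' -> middle e s -> middle e' s' -> D <= `|carc e s - carc e' s'|).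
Proof.
have [d1 d10 H1] : exists2 r : R, 0 < r & forall p : (gedge G * bool) * gedge G,
    forall s y, p.1.1 != p.2 -> middle p.2 s -> 0 <= y <= 1 -> r <= `|carc p.2 s - spoke p.1 y|.
  apply: (@small_forall R ((gedge G * bool) * gedge G)%type (fun p r =>
    forall s y, p.1.1 != p.2 -> middle p.2 s -> 0 <= y <= 1 -> r <= `|carc p.2 s - spoke p.1 y|)).
    by move=> p d d' /andP[_ dd'] H s y h1 h2 h3; apply: le_trans dd' _; exact: H.
  move=> [h e] /=; have [_|he] := eqVneq h.1 e; first by exists 1.
  have [|d d0 hd] := @arcs_apart R (carc e) (spoke h) (s0 (e, false)) (1 - s0 (e, true))
    (carc_continuous contG) (@spoke_continuous h).
    by move=> s y _ y01 ms; exact: spoke_middle.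
  by exists d => // s y _ ms y01; apply: hd => //; exact: cc (middle_oo ms).
have [d2 d20 H2] : exists2 r : R, 0 < r & forall p : gedge G * gedge G,
    forall s s', p.1 != p.2 -> middle p.1 s -> middle p.2 s' -> r <= `|carc p.1 s - carc p.2 s'|.
  apply: (@small_forall R (gedge G * gedge G)%type (fun p r =>
    forall s s', p.1 != p.2 -> middle p.1 s -> middle p.2 s' -> r <= `|carc p.1 s - carc p.2 s'|)).
    by move=> p d d' /andP[_ dd'] H s y h1 h2 h3; apply: le_trans dd' _; exact: H.
  move=> [e e'] /=; have [_|ee] := eqVneq e e'; first by exists 1.
  have [|d d0 hd] := @arcs_apart R (carc e) (carc e') (s0 (e, false)) (1 - s0 (e, true))
    (carc_continuous contG) (carc_continuous contG).
    move=> s s' s01 s01' ms; rewrite !carcE // => /esym.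
    by move=> /(garc_interior_inj contG s01' (middle_oo ms))[E _]; rewrite E eqxx in ee.
  exists d => // s y _ ms ms'; apply: hd => //.
    exact: cc (middle_oo ms).
  exact: cc (middle_oo ms').
exists (Num.min d1 d2); first by rewrite lt_min d10.
split=> [h e s y h1 h2 h3|e e' s s' h1 h2 h3].
  by apply: le_trans (H1 (h, e) s y h1 h2 h3); rewrite ge_min lexx.
by apply: le_trans (H2 (e, e') s s' h1 h2 h3); rewrite ge_min lexx orbT.
Qed.

Variables (D ep : R) (m : gedge G -> nat) (u : gedge G -> nat -> R).
Hypothesis ep0 : 0 < ep.
Hypothesis ep_rho : ep < rho.
Hypothesis ep_D : 2 * ep < D.
Hypothesis apart_spoke : forall h e s y, h.1 != e -> middle e s -> 0 <= y <= 1 ->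
  D <= `|carc e s - spoke h y|.
Hypothesis apart_middle : forall e e' s s', e != e' -> middle e s -> middle e' s' ->
  D <= `|carc e s - carc e' s'|.
Hypothesis u0 : forall e, u e 0 = s0 (e, false).
Hypothesis um : forall e, u e (m e) = 1 - s0 (e, true).
Hypothesis ustep : forall e k, (k < m e)%N ->
  u e k < u e k.+1 /\ `|carc e (u e k) - carc e (u e k.+1)| <= ep.
Hypothesis ufar : forall e i j, (i.+2 <= j)%N -> (j <= m e)%N ->
  ep < `|carc e (u e i) - carc e (u e j)|.

Definition chain_cuts (e : gedge G) (k : nat) : R :=
  if k == 0%N then 0 else if (k <= (m e).+1)%N then u e k.-1 else 1.

Local Notation n := (fun e : gedge G => (m e).+1).
Local Notation t := chain_cuts.

Let t0 e : t e 0 = 0. Proof. by []. Qed.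
Let tS e k : (k <= m e)%N -> t e k.+1 = u e k.
Proof. by move=> km; rewrite /t /= ltnS km. Qed.
Let tlast e : t e (m e).+2 = 1. Proof. by rewrite /t /= ltnn. Qed.

Let u_middle e k : (k <= m e)%N -> middle e (u e k).
Proof.
have inc i j : (i <= j)%N -> (j <= m e)%N -> u e i <= u e j.
  elim: j => [|j IH]; first by rewrite leqn0 => /eqP->.
  rewrite leq_eqVlt => /predU1P[->//|ij] jm.
  by apply: le_trans (IH ij (ltnW jm)) _; apply/ltW; case: (ustep jm).
by move=> km; rewrite /middle -(u0 e) -(um e) !inc.
Qed.

Lemma chain_cutsP : cuts n t.
Proof.
move=> e; split; [exact: t0|exact: tlast|].
move=> [_|k]; first by rewrite t0 tS // u0; case/andP: (s0_itv (e, false)).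
rewrite ltnS leq_eqVlt => /predU1P[->|km].
  by rewrite tS // tlast um; case/andP: (s0_itv (e, true)) => ? ?; lra.
by rewrite !tS //; [case: (ustep km)|exact: ltnW].
Qed.

Let ct := chain_cutsP.
Let P e k := carc e (t e k).

Let P0 e : P e 0 = gpos (gend (e, false)).
Proof. by rewrite /P t0 -[carc _ _]/(branch (e, false) 0) branch0. Qed.
Let PS e k : (k <= m e)%N -> P e k.+1 = carc e (u e k).
Proof. by move=> km; rewrite /P tS. Qed.
Let Plast e : P e (m e).+2 = gpos (gend (e, true)).
Proof. by rewrite /P tlast carc_flip subrr branch0. Qed.

Let carc_tip e : carc e (1 - s0 (e, true)) = branch (e, true) (s0 (e, true)).
Proof. by []. Qed.

Let pt e k y := P e k + y *: (P e k.+1 - P e k).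

(** The first and the last chord are spokes, and each of the others joins two points of the
    middle part at distance at most [ep]. *)
Let pt_cases e k y : (k <= n e)%N -> 0 <= y <= 1 ->
  (exists h y', [/\ h.1 = e, 0 <= y' <= 1, (0 < y < 1 -> 0 < y') & pt e k y = spoke h y']) \/
  (exists s, middle e s /\ `|pt e k y - carc e s| <= ep).
Proof.
move=> kn /andP[y0 y1]; case: k kn => [_|k].
  left; exists (e, false), y; split=> //; first by rewrite y0.
    by case/andP.
  by rewrite /pt P0 PS // u0.
rewrite ltnS leq_eqVlt => /predU1P[->|km].
  left; exists (e, true), (1 - y); split=> //.
  - by apply/andP; split; lra.
  - by move=> /andP[_ h]; lra.
  rewrite /pt Plast PS // um carc_tip /spoke.
  move: (branch _ _) (gpos _) => b p; apply/rowP => i; rewrite !mxE; ring.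
right; exists (u e k); split; first exact: u_middle (ltnW km).
rewrite /pt PS ?(ltnW km) // addrC addKr normrZ ger0_norm // PS //.
have [_ h] := ustep km; rewrite distrC; apply: le_trans h.
by rewrite ler_piMl.
Qed.

Let pt_other_edge e e' k k' y y' : e != e' -> (k <= n e)%N -> (k' <= n e')%N ->
  0 < y < 1 -> 0 <= y' <= 1 -> pt e k y <> pt e' k' y'.
Proof.
move=> ee kn kn' y01 y01' E.
have := pt_cases kn (cc y01); have := pt_cases kn' y01'; rewrite -E.
move=> [[h' [z' [he' z01' _ E']]]|[s' [ms' d']]] [[h [z [he z01 zp Ez]]]|[s [ms d]]].
- have z1 : 0 < z <= 1 by rewrite (zp y01); case/andP: z01.
  by apply: (@spokes_meet h h' z z') => //; [rewrite he he'|rewrite -Ez -E'].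
- have hn : h'.1 != e by rewrite he' eq_sym.
  have := apart_spoke hn ms z01'; rewrite -E' distrC.
  by have := ep_D; have := ep0; lra.
- have hn : h.1 != e' by rewrite he.
  have := apart_spoke hn ms' z01; rewrite -Ez distrC.
  by have := ep_D; have := ep0; lra.
- have := apart_middle ee ms ms'; have := ler_distD (pt e k y) (carc e s) (carc e' s').
  rewrite (distrC (carc e s) (pt e k y)); have := ep_D; lra.
Qed.

Let pt_same_edge e k k' y y' : (k <= n e)%N -> (k' <= n e)%N -> 0 < y < 1 -> 0 <= y' <= 1 ->
  pt e k y = pt e k' y' -> k = k' /\ y = y'.
Proof.
(* The first and the last segment are radii of balls around the vertices, with length
   [rho]; the others are steps of the chain. *)
pose L k := if (k == 0%N) || (k == (m e).+1) then rho else ep.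
have Lrho k0 : L k0 <= rho by rewrite /L; case: ifP => // _; exact: ltW.
apply: (@polyline_simple R (P e) L (m e).+1).
- move=> {k}k kn; split.
    have h1 : 0 <= t e k <= 1 by apply: (cut_itv ct); exact: leqW.
    have h2 : 0 <= t e k.+1 <= 1 by apply: (cut_itv ct).
    apply/eqP; rewrite /P !carcE // => /(garc_inj contG loopG h1 h2) E.
    by have := cut_lt ct (ltnSn k) (kn : (k.+1 <= (n e).+1)%N); rewrite E ltxx.
  rewrite /L; case: k kn => [_|k].
    by rewrite /= P0 PS // u0 distrC -[carc _ _]/(branch (e, false) _) s0_rho.
  rewrite ltnS leq_eqVlt => /predU1P[->|km].
    by rewrite eqxx orbT Plast PS // um carc_tip s0_rho.
  rewrite ifF ?PS //; [by case: (ustep km)|exact: ltnW|].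
  by rewrite /= eqSS ltn_eqF.
move=> i j ij jn.
suff : (rho < `|P e i - P e j|) \/ [/\ L i = ep, L j.-1 = ep & ep < `|P e i - P e j|].
  case=> [h|[-> -> //]]; split; exact: le_lt_trans (Lrho _) h.
case: i ij => [ij|i ij].
  left; rewrite P0 distrC; apply: (@s0_out (e, false)); last first.
    by case/andP: (cut_itv ct jn : 0 <= t e j <= 1).
  by rewrite -(u0 e) -(tS (leq0n _)); exact: (cut_lt ct ij jn).
move: jn; rewrite leq_eqVlt => /predU1P[jE|jm].
  left; rewrite jE Plast PS; last by move: ij; rewrite jE; lia.
  have im : (i.+1 <= m e)%N by move: ij; rewrite jE; lia.
  rewrite carc_flip; apply: (@s0_out (e, true)).
    have : u e i < u e (m e).
      have := @cut_lt _ _ _ _ ct e i.+1 (m e).+1 im (leqW (leqnn _)).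
      by rewrite !tS // ltnW.
    by rewrite um; lra.
  by have /andP[a1 a2] := u_middle (ltnW im); have /andP[b1 b2] := s0_itv (e, false); lra.
right; case: j ij jm => // j ij jm.
rewrite /L /= !eqSS; split.
- by rewrite ifF //; apply/negbTE; rewrite neq_ltn; apply/orP; left; lia.
- by rewrite ifF //; apply/negbTE; rewrite negb_or; apply/andP; split; lia.
- by rewrite !PS //; [apply: ufar|lia].
Qed.

Let chordE (E : gedge (chord_graph (subdivision n t))) y :
  garc (s := chord_graph (subdivision n t)) E y = pt (tag E) (tagged E) y.
Proof.
have nodeE e k : (k <= (n e).+1)%N -> @gpos _ (subdivision n t) (node n e k) = P e k.
  by move=> kN; rewrite (gpos_node contG ct) // /P carcE // (cut_itv ct).
case: E => e [k kN].
rewrite -[LHS]/((1 - y) *: @gpos _ (subdivision n t) (node n e (k + 0)) +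
   y *: @gpos _ (subdivision n t) (node n e (k + 1))).
rewrite addn0 addn1 !nodeE //; last exact: ltnW.
by rewrite /pt /=; apply/rowP => i; rewrite !mxE; ring.
Qed.

Lemma chain_chords : continuous_graph (chord_graph (subdivision n t)).
Proof.
have cross e e' k k' y y' : (k <= n e)%N -> (k' <= n e')%N -> 0 < y < 1 -> 0 <= y' <= 1 ->
    pt e k y = pt e' k' y' -> [/\ e = e', k = k' & y = y'].
  move=> kn kn' y01 y01' E; have [ee|ee] := eqVneq e e'.
    by subst e'; have [-> ->] := pt_same_edge kn kn' y01 y01' E.
  by case: (pt_other_edge ee kn kn' y01 y01' E).
apply: chord_graph_continuous; first exact: subdivision_continuous.
  move=> [e [k kN0]] y v y01; have kn : (k <= n e)%N := kN0; rewrite chordE /=.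
  case: v => [v|[e' j]] /= E.
    have [[h [z [_ z01 zp Ez]]]|[s [ms d]]] := pt_cases kn (cc y01).
      apply: (@spoke_vert h z v); last by rewrite -Ez.
      by rewrite (zp y01); case/andP: z01.
    have := middle_far v ms; rewrite -E distrC; have := ep_rho; lra.
  have jm : (j < (m e').+1)%N := ltn_ord j.
  have E0 : pt e k y = pt e' j.+1 0.
    by rewrite E /pt scale0r addr0 /P carcE // (cut_itv ct) // leqW.
  have z01 : 0 <= (0 : R) <= 1 by rewrite lexx ler01.
  have [_ _ yE] := cross _ _ _ _ _ _ kn jm y01 z01 E0.
  by move: y01; rewrite yE ltxx.
move=> [e [k kN]] [e' [k' kN']] y y' y01 y01'; rewrite !chordE /= => E.
have [ee kk yy] := cross _ _ _ _ _ _ (kN : (k <= n e)%N) (kN' : (k' <= n e')%N) y01 (cc y01') E.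
by split=> //; subst e' k'; congr (existT _ _ _); apply/val_inj.
Qed.

End Setup.

(** Inside small balls around the vertices the polygon is made of radii.  Outside them the
    edges are at positive distance from each other, and each carries a chain of minimal
    length with steps that are short compared with this distance. *)
Lemma fine_embedded_chords (eta : R) : 0 < eta ->
  exists (n : gedge G -> nat) (t : gedge G -> nat -> R),
  [/\ cuts n t, forall e k, (k <= n e)%N -> t e k.+1 - t e k < eta &
    continuous_graph (chord_graph (subdivision n t))].
Proof.
move=> eta0; pose et := Num.min eta 3^-1.
have et0 : 0 < et by rewrite lt_min eta0 invr_gt0 ltr0n.
have et_eta : et <= eta by rewrite ge_min lexx.
have et3 : et <= 3^-1 by rewrite ge_min lexx orbT.
have et1 : et <= 1 by apply: le_trans et3 _; lra.
have [rho rho0 [fv nearh fe]] := small_balls et0.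
have /choice[s0 s0P] (h : gedge G * bool) : exists s0, [/\ 0 < s0 < et, `|branch h s0 - gpos (gend h)| = rho &
    forall s, s0 < s -> s <= 1 -> rho < `|branch h s - gpos (gend h)|].
  rewrite -(branch0 contG); apply: exit_time => //.
    exact: branch_continuous.
  by rewrite branch0 //; exact: nearh.
have s0i h : 0 < s0 h < 3^-1.
  by case: (s0P h) => /andP[-> h2] _ _; exact: lt_le_trans et3.
have s0r h : `|branch h (s0 h) - gpos (gend h)| = rho by case: (s0P h).
have s0o h : forall s, s0 h < s -> s <= 1 -> rho < `|branch h s - gpos (gend h)| by case: (s0P h).
have [D D0 [aps apm]] := apart_pieces rho0 fe s0i s0r s0o.
have [dm dm0 Hm] : exists2 d : R, 0 < d & forall (e : gedge G) s s', 0 <= s <= 1 -> 0 <= s' <= 1 ->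
    `|carc e s - carc e s'| < d -> `|s - s'| < eta.
  apply: (@small_forall R (gedge G) (fun e d => forall s s', 0 <= s <= 1 -> 0 <= s' <= 1 ->
    `|carc e s - carc e s'| < d -> `|s - s'| < eta)).
    by move=> e d d' /andP[_ dd'] h s s' h1 h2 h3; apply: h => //; exact: lt_le_trans dd'.
  move=> e; have [|d d0 hd] := @inverse_modulus R (carc e) eta (carc_continuous contG) eta0.
    by move=> s s' h h'; rewrite !carcE //; exact: garc_inj.
  by exists d.
pose ep := Num.min (rho / 2) (Num.min (D / 4) (dm / 2)).
have ep0 : 0 < ep by rewrite !lt_min !divr_gt0.
have ep1 : ep <= rho / 2 by rewrite ge_min lexx.
have ep2 : ep <= D / 4 by rewrite !ge_min lexx orbT.
have ep3 : ep <= dm / 2 by rewrite !ge_min lexx !orbT.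
have /choice[m mP] (e : gedge G) : exists m, exists u : nat -> R,
  [/\ u 0%N = s0 (e, false), u m = 1 - s0 (e, true),
    forall k, (k < m)%N -> u k < u k.+1 /\ `|carc e (u k) - carc e (u k.+1)| <= ep &
    forall i j, (i.+2 <= j)%N -> (j <= m)%N -> ep < `|carc e (u i) - carc e (u j)|].
  have /andP[? ?] := s0i (e, false); have /andP[? ?] := s0i (e, true).
  by apply: minimal_chain => //; [exact: carc_continuous|exact: ltW|lra|lra].
have [u uP] := choice mP.
have q1 e : u e 0%N = s0 (e, false) by case: (uP e).
have q2 e : u e (m e) = 1 - s0 (e, true) by case: (uP e).
have q4 e k : (k < m e)%N -> u e k < u e k.+1 /\ `|carc e (u e k) - carc e (u e k.+1)| <= ep.
  by case: (uP e) => _ _ + _; apply.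
have q5 e i j : (i.+2 <= j)%N -> (j <= m e)%N -> ep < `|carc e (u e i) - carc e (u e j)|.
  by case: (uP e) => _ _ _; apply.
have ct := chain_cutsP s0i q1 q2 q4.
exists (fun e => (m e).+1), (chain_cuts m u); split=> //; last first.
  by apply: (@chain_chords rho s0 rho0 fv fe s0i s0r s0o D ep m u ep0 _ _ aps apm q1 q2 q4 q5); lra.
move=> e k kn; have c1 := cut_itv ct (leqW kn); have c2 := cut_itv ct (kn : (k.+1 <= (m e).+2)%N).
case: k kn c1 c2 => [_ _ _|k].
  rewrite subr0 /chain_cuts /= q1; case: (s0P (e, false)) => /andP[_ h] _ _.
  exact: lt_le_trans h et_eta.
rewrite ltnS leq_eqVlt => /predU1P[->|km] c1 c2.
  rewrite /chain_cuts /= ltnn leqnn q2 opprB addrC subrK.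
  by case: (s0P (e, true)) => /andP[_ h] _ _; exact: lt_le_trans h et_eta.
have [_ close] := q4 e k km.
apply: le_lt_trans (ler_norm _) _; rewrite distrC; apply: (Hm e) => //.
rewrite /chain_cuts /= !ltnS km (ltnW km).
by apply: le_lt_trans close _; lra.
Qed.

End FineChords.

(** * Cutting an arc into almost straight pieces *)

Section AlmostStraight.
Variable R : realType.
Local Notation V := 'rV[R]_3.

(** If [w] is close to [L *: u], then [enorm w] is equally close to [L]. *)
Lemma unitv_near (w u : V) (L kap : R) : w != 0 -> enorm u = 1 -> 0 < L ->
  enorm (w - L *: u) <= kap * L -> enorm (unitv w - u) <= 2 * kap.
Proof.
move=> w0 u1 L0 h; have wp : 0 < enorm w by rewrite enorm_gt0.
have h1 : `|enorm w - L| <= kap * L.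
  rewrite ler_norml; apply/andP; split.
    rewrite lerNl opprB; apply: le_trans h; rewrite enormB.
    by apply: le_trans (enorm_distD _ _); rewrite enormZ u1 mulr1 gtr0_norm.
  apply: le_trans h; apply: le_trans (enorm_distD _ _).
  by rewrite enormZ u1 mulr1 gtr0_norm.
have E : L *: (unitv w - u) = (w - L *: u) - (enorm w - L) *: unitv w.
  by rewrite scalerBl unitvK scalerBr opprB [RHS]addrC addrA subrK.
rewrite -(ler_pM2l L0) -[X in X * enorm _]gtr0_norm // -enormZ E.
apply: le_trans (enormD _ _) _; rewrite enormN enormZ enorm_unitv // mulr1.
lra.
Qed.

Variable g : R -> V.
Hypothesis gc : continuous g.
Hypothesis gI : forall s t, 0 <= s <= 1 -> 0 <= t <= 1 -> g s = g t -> s = t.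

Definition chord_dir s t := unitv (g t - g s).

Lemma chord_neq0 s t : 0 <= s -> s < t -> t <= 1 -> g t - g s != 0.
Proof.
move=> s0 st t1; rewrite subr_eq0; apply/eqP => E.
have := gI _ _ E; rewrite (le_trans s0 (ltW st)) t1 s0 (le_trans (ltW st) t1).
by move=> /(_ isT isT) ts; rewrite ts ltxx in st.
Qed.

Lemma chord_dir1 s t : 0 <= s -> s < t -> t <= 1 -> enorm (chord_dir s t) = 1.
Proof. by move=> s0 st t1; apply: enorm_unitv; exact: chord_neq0. Qed.

Lemma chord_dir_near s t e : 0 <= s -> s < t -> t <= 1 -> 0 < e -> exists2 d, 0 < d &
  forall x y, `|s - x| < d -> `|t - y| < d -> enorm (chord_dir s t - chord_dir x y) < e.
Proof.
move=> s0 st t1 e0.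
have e3 : 0 < e / 3 by rewrite divr_gt0.
have [d1 d10 h1] := continuous_dist (unitv_continuous (chord_neq0 s0 st t1)) e3.
have d2 : 0 < d1 / 2 by rewrite divr_gt0.
have [ds ds0 hs] := continuous_dist (@gc s) d2.
have [dt dt0 ht] := continuous_dist (@gc t) d2.
exists (Num.min ds dt); first by rewrite lt_min ds0.
move=> x y; rewrite !lt_min => /andP[xs _] /andP[_ yt].
apply: le_lt_trans (enorm_le_norm _) _; rewrite -ltr_pdivlMl // mulrC.
apply: h1.
have -> : g t - g s - (g y - g x) = (g t - g y) - (g s - g x).
  by rewrite !opprB addrACA [RHS]addrACA (addrC (- g s)).
apply: le_lt_trans (ler_normB _ _) _; rewrite (splitr d1); apply: ltrD; first exact: ht.
exact: hs.
Qed.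

(** The negation passes to smaller intervals, and says that all chords over [[a, b]] lie
    in a narrow cone. *)
Definition bent (kap a b : R) := exists s t s' t',
  [/\ a <= s, s < t & t <= b] /\ [/\ a <= s', s' < t', t' <= b &
    kap < enorm (chord_dir s t - chord_dir s' t')].

Lemma bent_subset kap a b a' b' : a' <= a -> b <= b' -> bent kap a b -> bent kap a' b'.
Proof.
move=> aa bb [s [t [s' [t' [[h1 h2 h3] [h4 h5 h6 h7]]]]]]; exists s, t, s', t'.
by split; split=> //; [exact: le_trans h1|exact: le_trans bb|exact: le_trans h4|exact: le_trans bb].
Qed.

(** The condition on the four parameters is open. *)
Lemma bent_open kap a b : 0 <= a -> b <= 1 -> bent kap a b ->
  exists s t s' t' d, [/\ 0 < d, [/\ a <= s, s + d < t - d & t <= b],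
    [/\ a <= s', s' + d < t' - d & t' <= b] &
    forall x y x' y', `|s - x| <= d -> `|t - y| <= d -> `|s' - x'| <= d -> `|t' - y'| <= d ->
      kap < enorm (chord_dir x y - chord_dir x' y')].
Proof.
move=> a0 b1 [s [t [s' [t' [[h1 h2 h3] [h4 h5 h6 h7]]]]]].
pose e := enorm (chord_dir s t - chord_dir s' t') - kap.
have e0 : 0 < e / 2 by rewrite divr_gt0 // subr_gt0.
have [d d0 hd] := chord_dir_near (le_trans a0 h1) h2 (le_trans h3 b1) e0.
have [d' d'0 hd'] := chord_dir_near (le_trans a0 h4) h5 (le_trans h6 b1) e0.
pose r := Num.min (Num.min d d') (Num.min (t - s) (t' - s')).
have r0 : 0 < r by rewrite !lt_min d0 d'0 !subr_gt0 h2 h5.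
have [r1 r2 r3 r4] : [/\ r <= d, r <= d', r <= t - s & r <= t' - s'].
  by split; rewrite !ge_min lexx ?orbT.
have rd : r / 3 < d by lra.
have rd' : r / 3 < d' by lra.
exists s, t, s', t', (r / 3); split; [by rewrite divr_gt0|split=> //; lra|split=> //; lra|].
move=> x y x' y' sx ty sx' ty'.
have D := hd x y (le_lt_trans sx rd) (le_lt_trans ty rd).
have D' := hd' x' y' (le_lt_trans sx' rd') (le_lt_trans ty' rd').
have tri (X Y X' Y' : V) :
    enorm (X - X') <= enorm (X - Y) + enorm (X' - Y') + enorm (Y - Y').
  rewrite [enorm (X' - Y')]enormB.
  have -> : X - X' = (X - Y) + (Y' - X') + (Y - Y').
    by rewrite [RHS]addrAC !addrA !subrK.
  by apply: le_trans (enormD _ _) _; rewrite lerD2r enormD.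
have := tri (chord_dir s t) (chord_dir x y) (chord_dir s' t') (chord_dir x' y').
move: D D'; rewrite /e; move: (enorm _) (enorm _) (enorm _) (enorm _) => p q u v; clear.
by lra.
Qed.

Lemma bent_shrink kap a b : 0 <= a -> b <= 1 -> bent kap a b ->
  exists a' b', [/\ a < a', b' < b & bent kap a' b'].
Proof.
move=> a0 b1 /(bent_open a0 b1)[s [t [s' [t' [d [d0 [h1 h2 h3] [h4 h5 h6] h]]]]]].
have n1 (x : R) : `|x - (x + d)| <= d by rewrite opprD addNKr normrN gtr0_norm.
have n2 (x : R) : `|x - (x - d)| <= d by rewrite subKr gtr0_norm.
exists (a + d), (b - d); split; [lra|lra|].
exists (s + d), (t - d), (s' + d), (t' - d); split; first by split=> //; lra.
by split=> //; [lra|lra|exact: h].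
Qed.

(** Instead of exterior angles the distances of unit vectors are added, since the triangle
    inequality applies to them. *)
Definition turning (n : nat) (t : nat -> R) (a b : R) : R :=
  \sum_(0 <= k < n | (a <= t k) && (t k.+2 <= b))
     enorm (chord_dir (t k.+1) (t k.+2) - chord_dir (t k) (t k.+1)).

Lemma turning_ge0 n t a b : 0 <= turning n t a b.
Proof. by apply: sumr_ge0 => k _; exact: enorm_ge0. Qed.

Lemma turning_subset n t a b a' b' : a' <= a -> b <= b' ->
  turning n t a b <= turning n t a' b'.
Proof.
move=> aa bb; rewrite /turning big_mkcond [leRHS]big_mkcond /=.
apply: ler_sum => k _; case: ifP => [/andP[h1 h2]|_].
  by rewrite (le_trans aa h1) (le_trans h2 bb).
by case: ifP => // _; exact: enorm_ge0.
Qed.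

Lemma turning_add n t a b b' : chain n t -> b <= b' -> a <= b ->
  turning n t a b + turning n t b b' <= turning n t a b'.
Proof.
move=> ct bb ab; rewrite /turning !(big_mkcond (fun k => _ && _)) /= -big_split /= !big_mkord.
apply: ler_sum => k _.
have kk : t k < t k.+2 by apply: (chain_lt ct) => //; have := ltn_ord k; lia.
case: ifP => [/andP[h1 h2]|_]; case: ifP => [/andP[h3 h4]|_].
- by have := lt_le_trans kk (le_trans h2 h3); rewrite ltxx.
- by rewrite addr0 h1 (le_trans h2 bb).
- by rewrite add0r (le_trans ab h3) h4.
- by rewrite addr0; case: ifP => // _; exact: enorm_ge0.
Qed.

(** The chord between two vertices of an inscribed polygon is a positive combination
    of the segments in between, whose directions differ from the first one by at most
    the turning. *)
Lemma chord_turning n t a b i0 i j : chain n t -> (i0 <= i)%N -> (i < j)%N -> (j <= n.+1)%N ->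
  a <= t i0 -> t j <= b ->
  enorm (chord_dir (t i) (t j) - chord_dir (t i0) (t i0.+1)) <= 2 * turning n t a b.
Proof.
move=> ct i0i ij jn ai jb; set u := chord_dir (t i0) _.
have t01 k : (k <= n.+1)%N -> 0 <= t k /\ t k <= 1.
  case: (ct) => <- <- _ kn; split; exact: (chain_le ct).
have dirs l : (i0 <= l)%N -> (l < j)%N ->
    enorm (chord_dir (t l) (t l.+1) - u) <= turning n t a b.
  move=> + lj; move=> /subnKC <-; move: {-1}(l - i0)%N (erefl (l - i0)%N) => m mE.
  have {mE} : (i0 + m < j)%N by case: leqP mE => //; lia.
  pose A l := \sum_(0 <= k < l | (a <= t k) && (t k.+2 <= b))
     enorm (chord_dir (t k.+1) (t k.+2) - chord_dir (t k) (t k.+1)).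
  move=> mj; have : enorm (chord_dir (t (i0 + m)%N) (t (i0 + m)%N.+1) - u) <= A (i0 + m)%N.
    elim: m mj => [|m IH] mj.
      by rewrite addn0 subrr enorm0; apply: sumr_ge0 => k _; exact: enorm_ge0.
    rewrite addnS in mj *; rewrite /A big_mkcond big_nat_recr //= -big_mkcond /= -/(A _).
    have -> : a <= t (i0 + m)%N by apply: le_trans ai _; apply: (chain_le ct); lia.
    have -> : t (i0 + m).+2 <= b by apply: le_trans jb; apply: (chain_le ct); lia.
    rewrite /= addrC; apply: le_trans (lerD (lexx _) (IH (ltnW mj))).
    exact: enorm_triangle.
  move=> /le_trans; apply; rewrite /turning (big_cat_nat (n := i0 + m)) //=; last by lia.
  by rewrite lerDl; apply: sumr_ge0 => k _; exact: enorm_ge0.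
have jn' : (i <= n.+1)%N by lia.
have [ti0 _] := t01 i jn'; have [_ tj1] := t01 j jn; have tij := chain_lt ct ij jn.
have un : enorm u = 1.
  have [h1 _] := t01 i0 ltac:(lia); have [_ h2] := t01 i0.+1 ltac:(lia).
  by apply: chord_dir1 => //; apply: (chain_lt ct) => //; lia.
pose L m := \sum_(i <= k < m) enorm (g (t k.+1) - g (t k)).
have Lpos m : (i < m)%N -> (m <= j)%N -> 0 < L m.
  move=> im mj; rewrite /L big_ltn // ltr_pwDl //; last first.
    by apply: sumr_ge0 => k _; exact: enorm_ge0.
  rewrite enorm_gt0; have [_ h2] := t01 i.+1 ltac:(lia).
  by apply: chord_neq0 => //; apply: (chain_lt ct) => //; lia.
apply: (unitv_near _ un (Lpos j ij (leqnn _))); first exact: chord_neq0.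
rewrite /L.
have -> : g (t j) - g (t i) = \sum_(i <= k < j) (g (t k.+1) - g (t k)).
  by rewrite telescope_sumr // ltnW.
rewrite scaler_suml -sumrB mulr_sumr; apply: le_trans (enorm_sum _ _ _) _.
rewrite big_nat [leRHS]big_nat; apply: ler_sum => k /andP[ik kj].
rewrite -{1}(unitvK (g (t k.+1) - g (t k))) -scalerBr enormZ ger0_norm ?enorm_ge0 //.
by rewrite mulrC ler_wpM2r ?enorm_ge0 //; apply: dirs => //; lia.
Qed.

(** A weight for parts of the arc which can be added over disjoint parts ([heavy_add]) and
    is bounded on the whole arc ([heavy_bounded]), while a bent part has weight at least
    [kap / 4] ([bent_heavy]). *)
Definition heavy (x a b : R) := exists2 eta, 0 < eta & forall n t, chain n t ->
  (forall k, (k <= n)%N -> t k.+1 - t k < eta) -> x <= turning n t a b.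

Lemma chain_point n t (eta x : R) : chain n t ->
  (forall k, (k <= n)%N -> t k.+1 - t k < eta) -> 0 <= x <= 1 ->
  exists2 i, (i <= n.+1)%N & x <= t i < x + eta.
Proof.
move=> [t0 t1 inc] mesh /andP[x0 x1].
have ex : exists i, x <= t i by exists n.+1; rewrite t1.
case: (ex_minnP ex) => i xi imin; exists i; first by apply: imin; rewrite t1.
rewrite xi /=; have e0 : 0 < eta by apply: lt_trans (mesh 0%N isT); rewrite subr_gt0 inc.
case: i xi imin => [|i] xi imin; first by rewrite t0; lra.
have xi' : t i < x by rewrite ltNge; apply/negP => /imin; rewrite ltnn.
have iN : (i <= n)%N by rewrite -ltnS; apply: imin; rewrite t1.
by have := mesh i iN; lra.
Qed.

(** By openness the four parameters can be replaced by vertices of a fine polygon; both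
    chords are then close to the direction of the first segment in the range unless the
    polygon turns. *)
Lemma bent_heavy kap a b : 0 <= a -> b <= 1 -> bent kap a b -> heavy (kap / 4) a b.
Proof.
move=> a0 b1 /(bent_open a0 b1)[s [t [s' [t' [d [d0 [h1 h2 h3] [h4 h5 h6] h]]]]]].
exists d => // n u cu mesh.
have near x : 0 <= x -> x <= 1 -> exists2 i, (i <= n.+1)%N & x <= u i < x + d.
  by move=> x0 x1; apply: chain_point cu mesh _; rewrite x0.
have [i iN /andP[i1 i2]] := near s ltac:(lra) ltac:(lra).
have [j jN /andP[j1 j2]] := near (t - d) ltac:(lra) ltac:(lra).
have [i' i'N /andP[i'1 i'2]] := near s' ltac:(lra) ltac:(lra).
have [j' j'N /andP[j'1 j'2]] := near (t' - d) ltac:(lra) ltac:(lra).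
have lt_index k l : (k <= n.+1)%N -> u k < u l -> (k < l)%N.
  by move=> kN; apply: contraTltn => lk; rewrite -leNgt; exact: chain_le cu lk kN.
have ij : (i < j)%N by apply: lt_index => //; lra.
have ij' : (i' < j')%N by apply: lt_index => //; lra.
have ai : a <= u (minn i i') by rewrite /minn; case: ifP => _; lra.
have B1 := chord_turning cu (geq_minl i i') ij jN ai (ltac:(lra) : u j <= b).
have B2 := chord_turning cu (geq_minr i i') ij' j'N ai (ltac:(lra) : u j' <= b).
have close (x y : R) : y <= x -> x < y + d -> `|y - x| <= d.
  by move=> p q; rewrite ler_norml; apply/andP; split; lra.
have close' (x y : R) : y - d <= x -> x < y -> `|y - x| <= d.
  by move=> p q; rewrite ler_norml; apply/andP; split; lra.
have := h (u i) (u j) (u i') (u j') (close _ _ i1 i2) (close' _ _ j1 ltac:(lra))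
  (close _ _ i'1 i'2) (close' _ _ j'1 ltac:(lra)).
have := enorm_triangle (chord_dir (u i) (u j))
  (chord_dir (u (minn i i')) (u (minn i i').+1)) (chord_dir (u i') (u j')).
move: B1 B2; rewrite (enormB (chord_dir (u i') _)).
by move: (enorm _) (enorm _) (enorm _) (turning _ _ _ _) => p q r v; clear; lra.
Qed.

Lemma heavy_subset x a b a' b' : a' <= a -> b <= b' -> heavy x a b -> heavy x a' b'.
Proof.
move=> aa bb [eta e0 h]; exists eta => // n t ct mesh.
exact: le_trans (h n t ct mesh) (turning_subset _ _ aa bb).
Qed.

Lemma heavy_add x y a b b' : a <= b -> b <= b' -> heavy x a b -> heavy y b b' ->
  heavy (x + y) a b'.
Proof.
move=> ab bb [e e0 h] [e' e'0 h']; exists (Num.min e e'); first by rewrite lt_min e0.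
move=> n t ct mesh; apply: le_trans (turning_add ct bb ab).
by apply: lerD; [apply: h|apply: h'] => // k kn; have := mesh k kn; rewrite lt_min => /andP[].
Qed.

Hypothesis bounded_turning : exists K, forall eta, 0 < eta -> exists n t,
  [/\ chain n t, forall k, (k <= n)%N -> t k.+1 - t k < eta & turning n t 0 1 <= K].

Lemma heavy_bounded : exists K, forall x, heavy x 0 1 -> x <= K.
Proof.
have [K hK] := bounded_turning; exists K => x [eta e0 h].
by have [n [t [ct mesh le_K]]] := hK eta e0; apply: le_trans le_K; exact: h.
Qed.

Lemma not_all_heavy kap a b : 0 < kap -> 0 <= a -> b <= 1 ->
  ~ forall N : nat, heavy (kap / 4 *+ N) a b.
Proof.
move=> kap0 a0 b1 h; have [K hK] := heavy_bounded.
have k4 : 0 < kap / 4 by rewrite divr_gt0.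
have := h (Num.bound `|K / (kap / 4)|) => /(heavy_subset a0 b1)/hK.
rewrite -mulr_natl leNgt -ltr_pdivrMr //.
by rewrite (le_lt_trans (ler_norm _) (archi_boundP (normr_ge0 _))).
Qed.

(** Otherwise bent arcs would accumulate at [p] from the right, and infinitely many of
    them could be chosen without overlap. *)
Lemma straight_right kap p : 0 < kap -> 0 <= p -> p < 1 ->
  exists q, [/\ p < q, q <= 1 & ~ bent kap p q].
Proof.
move=> kap0 p0 p1; apply: contrapT => no.
have allbent q : p < q -> q <= 1 -> bent kap p q.
  by move=> pq q1; apply: contrapT => nb; apply: no; exists q.
apply: (@not_all_heavy kap p 1 kap0 p0 (lexx _)) => N.
suff : forall q, p < q -> q <= 1 -> heavy (kap / 4 *+ N) p q by apply.
elim: N => [|N IH] q pq q1.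
  by exists 1 => // n t _ _; rewrite mulr0n; exact: turning_ge0.
have [a [b [pa bq ab]]] := bent_shrink p0 q1 (allbent q pq q1).
have aq : a < q by case: ab => s [t [s' [t' [[h1 h2 h3] _]]]]; lra.
rewrite mulrSr; apply: (@heavy_add _ _ p a q); [exact: ltW|exact: ltW|apply: IH; lra|].
by apply: bent_heavy; [lra|lra|apply: bent_subset ab => //; lra].
Qed.

Lemma straight_left kap q : 0 < kap -> 0 < q -> q <= 1 ->
  exists p, [/\ 0 <= p, p < q & ~ bent kap p q].
Proof.
move=> kap0 q0 q1; apply: contrapT => no.
have allbent p : 0 <= p -> p < q -> bent kap p q.
  by move=> p0 pq; apply: contrapT => nb; apply: no; exists p.
apply: (@not_all_heavy kap 0 q kap0 (lexx _) q1) => N.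
suff : forall p, 0 <= p -> p < q -> heavy (kap / 4 *+ N) p q by apply.
elim: N => [|N IH] p p0 pq.
  by exists 1 => // n t _ _; rewrite mulr0n; exact: turning_ge0.
have [a [b [pa bq ab]]] := bent_shrink p0 q1 (allbent p p0 pq).
have pb : p < b by case: ab => s [t [s' [t' [[h1 h2 h3] _]]]]; lra.
rewrite mulrS; apply: (@heavy_add _ _ p b q); [exact: ltW|exact: ltW| |apply: IH; lra].
by apply: bent_heavy; [lra|lra|apply: bent_subset ab => //; lra].
Qed.

(** The supremum of the parameters which can be reached from [0] by finitely many
    almost straight steps is itself reached, and cannot be less than [1]. *)
Lemma straight_chain kap : 0 < kap -> exists n t, chain n t /\
  forall k, (k <= n)%N -> ~ bent kap (t k) (t k.+1).
Proof.
move=> kap0.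
pose steps (n : nat) (t : nat -> R) x := [/\ t 0%N = 0, t n.+1 = x &
  forall k, (k <= n)%N -> t k < t k.+1 /\ ~ bent kap (t k) (t k.+1)].
pose reach x := exists n t, steps n t x.
have extend x y : reach x -> x < y -> ~ bent kap x y -> reach y.
  move=> [n [t [t0 tx st]]] xy nb; exists n.+1, (fun k => if (k <= n.+1)%N then t k else y).
  split=> //; first by rewrite ltnn.
  move=> k kn; rewrite kn ltnS; case: leqP => [kn'|kn']; first exact: st.
  by have -> : k = n.+1 by [lia|]; rewrite tx.
have start y : 0 < y -> ~ bent kap 0 y -> reach y.
  move=> y0 nb; exists 0%N, (fun k => if k is 0%N then 0 else y).
  by split=> // -[].
have [q [q0 q1 nbq]] := straight_right kap0 (lexx 0) ltr01.
pose E := [set x | x <= 1 /\ reach x].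
have Eq : E q by split=> //; exact: start.
have hE : has_sup E by split; [exists q|exists 1 => x []].
have supE : sup E <= 1 by apply: ge_sup; [exists q|move=> x []].
have qsup : q <= sup E by apply: ub_le_sup => //; case: hE.
have sup0 : 0 < sup E by exact: lt_le_trans qsup.
have [p [p0 psup nbp]] := straight_left kap0 sup0 supE.
have rsup : reach (sup E).
  have [x [x1 rx] px] := sup_adherent (ltac:(rewrite subr_gt0; exact: psup) : 0 < sup E - p) hE.
  rewrite subKr in px.
  have := ub_le_sup (proj2 hE) (conj x1 rx : E x).
  rewrite le_eqVlt => /predU1P[<-//|xs]; apply: extend rx xs _ => b.
  by apply: nbp; apply: bent_subset b => //; exact: ltW.
have : sup E = 1.
  apply/eqP; rewrite eq_le supE leNgt; apply/negP => s1.
  have [r [sr r1 nbr]] := straight_right kap0 (ltW sup0) s1.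
  have /(ub_le_sup (proj2 hE)) : E r by split=> //; exact: extend nbr.
  by rewrite leNgt sr.
move=> s1; move: rsup; rewrite s1 => -[n [t [t0 t1 st]]]; exists n, t.
by split=> [|k kn]; [split=> // k kn|]; case: (st k kn).
Qed.

End AlmostStraight.

(** * A lower bound for the curvature of inscribed polygons *)

Section Curvature.
Variable R : realType.
Local Notation V := 'rV[R]_3.

Lemma sin_le_id (y : R) : 0 <= y -> sin y <= y.
Proof.
rewrite le_eqVlt => /predU1P[<-|y0]; first by rewrite sin0.
have [x _ E] : exists2 x, x \in `]0, y[ & sin y - sin 0 = cos x * (y - 0).
  apply: MVT => //.
  by apply: continuous_subspaceT => x; exact: continuous_sin.
move: E; rewrite sin0 !subr0 => ->.
by rewrite ler_piMl ?(ltW y0) // cos_le1.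
Qed.

(** A chord of the unit sphere is at most as long as the arc; this compares [turning] with
    exterior angles. *)
Lemma chord_le_angle (a b : V) : enorm a = 1 -> enorm b = 1 ->
  enorm (a - b) <= acos (dotv a b).
Proof.
move=> a1 b1; have := normr_dotv_le a b; rewrite a1 b1 mulr1 ler_norml => ab.
have [/andP[th0 _] thE] := acos_def ab; set th := acos _ in th0 thE *.
rewrite -(@ler_pXn2r _ 2) ?nnegrE ?enorm_ge0 // enorm_sq.
have -> : dotv (a - b) (a - b) = 2 - 2 * cos th.
  by rewrite thE dotvBl !dotvBr -!enorm_sq a1 b1 (dotvC b); ring.
have -> : cos th = 1 - 2 * sin (th / 2) ^+ 2.
  rewrite {1}(_ : th = th / 2 + th / 2); last by field.
  by rewrite cosD -!expr2 cos2sin2; ring.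
have h0 : 0 <= th / 2 by rewrite divr_ge0.
have h1 : sin (th / 2) <= th / 2 by exact: sin_le_id.
have h2 : 0 <= sin (th / 2).
  apply: sin_ge0_pi; rewrite h0 /=; have [/andP[_ +] _] := acos_def ab; rewrite -/th => hp.
  by apply: le_trans hp; lra.
have : sin (th / 2) ^+ 2 <= (th / 2) ^+ 2 by rewrite lerXn2r ?nnegrE.
by rewrite expr_div_n; lra.
Qed.

Lemma acos_dotv_ge0 (a b : V) : enorm a = 1 -> enorm b = 1 -> 0 <= acos (dotv a b).
Proof. by move=> a1 b1; apply: le_trans (chord_le_angle a1 b1); exact: enorm_ge0. Qed.

Variable c : forall d, 'M[R]_(d, 3) -> R.
Hypothesis vc : vertex_curvature c.

(** The set of [d]-tuples of unit vectors is compact, and [c] is continuous on it. *)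
Lemma vertex_curvature_bounded d : exists M,
  forall T : 'M[R]_(d, 3), unit_rows T -> - M <= c T.
Proof.
have [cc _] := vc; move: (cc d) => {}cc.
pose W := 'rV[R]_(d * 3).
have mxc : continuous (vec_mx : W -> 'M[R]_(d, 3)).
  apply: (@lip_continuous R W 'M[R]_(d, 3) _ 1) => x y; rewrite mul1r -linearB /=.
  rewrite [leLHS]/Num.norm /= mx_normrE; apply/bigmax_leP; split=> // -[i j] _ /=.
  rewrite mxE [leRHS]/Num.norm /= mx_normrE.
  by apply/bigmax_geP; right; exists (0, mxvec_index i j).
pose K := [set w : W | unit_rows (vec_mx w : 'M[R]_(d, 3))].
have cK : compact K.
  apply: bounded_closed_compact.
    exists 1; split; first exact: num_real.
    move=> y y1 w Kw /=; apply: le_trans (ltW y1).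
    rewrite [leLHS]/Num.norm /= mx_normrE; apply/bigmax_leP; split=> // -[i k] _ /=.
    rewrite (ord1 i) -(vec_mxK w); case/mxvec_indexP: k => p q; rewrite mxvecE.
    by have := coord_enorm (row p (vec_mx w)) q; rewrite Kw mxE.
  have -> : K = \bigcap_(i in [set: 'I_d]) [set w : W | enorm (row i (vec_mx w : 'M[R]_(d, 3))) = 1].
    by apply/seteqP; split=> w h i; [move=> _; exact: h|exact: (h i)].
  apply: closed_bigI => i _.
  apply: (@closed_comp W R (fun w => enorm (row i (vec_mx w : 'M[R]_(d, 3)))) [set 1]); last exact: closed_eq.
  move=> w _.
  have rc : {for vec_mx w, continuous (fun T : 'M[R]_(d, 3) => enorm (row i T))}.
    apply: (@lip_continuous R 'M[R]_(d, 3) R _ 3) => x y.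
    apply: le_trans (enorm_lip _ _) _; rewrite ler_wpM2l // -linearB /=.
    rewrite [leLHS]/Num.norm /= mx_normrE; apply/bigmax_leP; split=> // -[k j] _ /=.
    rewrite mxE [leRHS]/Num.norm /= mx_normrE.
    by apply/bigmax_geP; right; exists (i, j).
  have mw : {for w, continuous (vec_mx : W -> 'M[R]_(d, 3))} by exact: mxc.
  exact: (@continuous_comp W 'M[R]_(d, 3) R vec_mx (fun T => enorm (row i T)) w mw rc).
have toK (T : 'M[R]_(d, 3)) : unit_rows T -> K (mxvec T) by rewrite /K /= mxvecK.
have [K0|noK] := pselect (K !=set0); last first.
  exists 0 => // T /toK KT; case: noK; by exists (mxvec T).
have cf : {within K, continuous (fun w : W => c (vec_mx w : 'M[R]_(d, 3)))}.
  apply/subspace_continuousP => w Kw.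
  move/subspace_continuousP: cc => /(_ (vec_mx w) Kw) cw.
  apply/cvgrPdist_lt => e e0; move/cvgrPdist_lt: cw => /(_ e e0).
  rewrite near_withinE => /nbhs_normP[r r0 hr]; rewrite near_withinE.
  have /cvgrPdist_lt/(_ r r0) := mxc w; apply: filterS => w' ww' Kw'.
  exact: hr.
have [w0 w0K w0min] := compact_EVT_min K0 cK cf.
exists `|c (vec_mx w0 : 'M[R]_(d, 3))| => // T uT.
have := w0min (mxvec T); rewrite mxvecK => h.
have {}h : c (vec_mx w0) <= c T by apply: h; rewrite inE; exact: toK.
by apply: le_trans h; rewrite lerNl -normrN ler_norm.
Qed.

Lemma curvature_degree2 d (T : 'M[R]_(d, 3)) (i j : 'I_d) : d = 2%N -> i != j ->
  unit_rows T -> c T = acos (dotv (row i T) (- row j T)).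
Proof.
move=> d2; subst d; have [_ h] := vc => ij /h ->.
have sym (a b : V) : dotv a (- b) = dotv b (- a) by rewrite !dotvNr dotvC.
have ord2 (k : 'I_2) : k = ord0 \/ k = ord_max.
  by case: k => -[|[|k]] hk //; [left|right]; apply/val_inj.
by case: (ord2 i) ij => ->; case: (ord2 j) => -> // _; rewrite sym.
Qed.

Lemma tangent_unit (P : sgraph R) (h : gedge P * bool) : injective (@gpos _ P) ->
  gend h != gend (h.1, ~~ h.2) -> enorm (tangent h) = 1.
Proof.
move=> gI hh; apply: enorm_unitv; rewrite subr_eq0; apply: contra hh.
by move=> /eqP/gI ->.
Qed.

Lemma tangents_unit (P : sgraph R) (v : gvert P) : injective (@gpos _ P) ->
  loopless P -> unit_rows (tangents v).
Proof.
move=> gI ll i.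
have -> : row i (tangents v) = tangent (enum_val (A := ends v) i).
  by apply/rowP => j; rewrite !mxE.
apply: tangent_unit => //; case: (enum_val i) => e b; have := ll e.
by case: b => //=; rewrite eq_sym.
Qed.

Lemma curvature_two_ends (P : sgraph R) (v : gvert P) (h1 h2 : gedge P * bool) :
  injective (@gpos _ P) -> loopless P -> degree v = 2%N -> gend h1 = v -> gend h2 = v ->
  h1 != h2 -> c (tangents v) = acos (dotv (tangent h1) (- tangent h2)).
Proof.
move=> gI ll d2 e1 e2 h12.
have i1 : h1 \in ends v by rewrite inE e1.
have i2 : h2 \in ends v by rewrite inE e2.
have rowE h (hin : h \in ends v) : row (enum_rank_in hin h) (tangents v) = tangent h.
  by apply/rowP => j; rewrite !mxE enum_rankK_in.
rewrite (curvature_degree2 (i := enum_rank_in i1 h1) (j := enum_rank_in i2 h2) d2) ?rowE //.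
  apply: contra h12 => /eqP E; apply/eqP.
  by rewrite -(enum_rankK_in i1 i1) E (enum_rankK_in i2 i2).
exact: tangents_unit.
Qed.

Variable G : sgraph R.
Hypotheses (contG : continuous_graph G) (loopG : loopless G).

(** The topological vertices of all inscribed polygons are the same, so that their
    contributions are bounded below by a constant; the other vertices contribute
    exterior angles. *)
Lemma polygonal_curvature_lower : exists M, forall n t, @cuts R G n t -> forall e,
  turning (carc e) (n e) (t e) 0 1 - M <= polygonal_curvature c (chord_graph (subdivision n t)).
Proof.
pose dir (t : gedge G -> nat -> R) e k := unitv (garc e (t e k.+1) - garc e (t e k)).
have [M MP] := choice vertex_curvature_bounded.
exists (\sum_(v : gvert G) M (degree v)) => n t ct e.
have -> : turning (carc e) (n e) (t e) 0 1 = \sum_(k < n e) enorm (dir t e k.+1 - dir t e k).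
  have t01 k : (k <= (n e).+1)%N -> 0 <= t e k <= 1 by exact: cut_itv.
  rewrite /turning big_mkord; apply: eq_big => k.
    by case/andP: (t01 k (leqW (ltnW (ltn_ord k)))) => -> _; case/andP: (t01 k.+2 (ltn_ord k)) => _ ->.
  move=> _; rewrite /chord_dir !carcE ?t01 //; move: (ltn_ord k); lia.
pose S := subdivision n t; pose P := chord_graph S.
have gI : injective (@gpos _ P) by have [_ _ h _ _] := subdivision_continuous contG ct.
have ll : loopless P by exact: (subdivision_loopless contG loopG ct).
rewrite /polygonal_curvature big_sumType /= addrC; apply: lerD; last first.
  rewrite -sumrN; apply: ler_sum => v _.
  have := MP _ _ (@tangents_unit P (inl v) gI ll).
  by apply: le_trans; rewrite lerN2 le_eqVlt; apply/orP; left; apply/eqP; congr M; exact: degree_old.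
have dir1 e' k : (k <= n e')%N ->
    enorm (dir t e' k) = 1.
  move=> kn; apply: enorm_unitv; rewrite subr_eq0; apply/eqP => E.
  have := garc_inj contG loopG (cut_itv ct (kn : (k.+1 <= (n e').+1)%N)) (cut_itv ct (leqW kn)) E.
  by move=> E'; have := cut_lt ct (ltnSn k) (kn : (k.+1 <= (n e').+1)%N); rewrite E' ltxx.
have angle e' (k : 'I_(n e')) :
    c (@tangents _ P (inr (existT (fun e => 'I_(n e)) e' k))) =
    acos (dotv (dir t e' k) (dir t e' k.+1)).
  pose h1 : gedge P * bool :=
    (existT (fun e => 'I_(n e).+1) e' (widen_ord (leqnSn _) k), true).
  pose h2 : gedge P * bool := (existT (fun e => 'I_(n e).+1) e' (lift ord0 k), false).
  have e1 : gend h1 = inr (existT _ e' k) by rewrite /= addn1 nodeS.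
  have e2 : gend h2 = inr (existT _ e' k) by rewrite /= addn0; exact: (nodeS k).
  have kn : (k <= n e')%N by exact: ltnW.
  have pos i : (i <= (n e').+1)%N -> @gpos _ S (node n e' i) = garc e' (t e' i).
    exact: gpos_node.
  have t1 : tangent h1 = - dir t e' k.
    rewrite -unitvN opprB; congr (unitv (_ - _)).
      by rewrite -[LHS]/(@gpos _ S (node n e' (k + 0))) addn0 pos // leqW.
    by rewrite -[LHS]/(@gpos _ S (node n e' (k + 1))) addn1 pos.
  have t2 : tangent h2 = dir t e' k.+1.
    congr (unitv (_ - _)).
      by rewrite -[LHS]/(@gpos _ S (node n e' (k.+1 + 1))) addn1 pos // ltnS.
    by rewrite -[LHS]/(@gpos _ S (node n e' (k.+1 + 0))) addn0 pos.
  rewrite (@curvature_two_ends P _ h1 h2 gI ll _ e1 e2) //.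
    by rewrite t1 t2 dotvNl dotvNr opprK.
    exact: degree_new.
  by apply/eqP => /(congr1 snd).
have angle_ge0 e' (k : 'I_(n e')) : 0 <= c (@tangents _ P (inr (existT (fun e => 'I_(n e)) e' k))).
  by rewrite angle; apply: acos_dotv_ge0; apply: dir1 => //; exact: ltnW.
rewrite (eq_bigr (fun x : {e : gedge G & 'I_(n e)} =>
  c (@tangents _ P (inr (existT (fun e => 'I_(n e)) (tag x) (tagged x)))))); last by case.
rewrite -(@sig_big_dep _ _ _ _ (fun e => 'I_(n e)) xpredT (fun _ _ => true)
  (fun e' (k : 'I_(n e')) => c (@tangents _ P (inr (existT (fun e => 'I_(n e)) e' k))))) /=.
rewrite (bigD1 e) //= -[leLHS]addr0; apply: lerD; last first.
  by apply: sumr_ge0 => e' _; apply: sumr_ge0 => k _; exact: angle_ge0.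
apply: ler_sum => k _; rewrite angle enormB; apply: chord_le_angle; apply: dir1 => //.
exact: ltnW.
Qed.

End Curvature.

(** * Graphs of finite total curvature *)

Section Assembly.
Variable R : realType.
Local Notation V := 'rV[R]_3.

(** A unit vector [d] close to a unit vector [u] lies in a narrow cone around [u], since
    [dotv d u = 1 - enorm (d - u) ^+ 2 / 2]. *)
Lemma bent_cone (g : R -> V) kap a b :
  (forall s t, 0 <= s <= 1 -> 0 <= t <= 1 -> g s = g t -> s = t) ->
  kap <= 1 -> 0 <= a -> a < b -> b <= 1 -> ~ bent g kap a b ->
  forall s t, a <= s -> s < t -> t <= b ->
    within_cone (chord_dir g a b) (4 * kap) (g t - g s).
Proof.
move=> gI kap1 a0 ab b1 nb s t as_ st tb.
have d1 : enorm (chord_dir g a b) = 1 by exact: chord_dir1.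
have d2 : enorm (chord_dir g s t) = 1 by apply: chord_dir1 => //; lra.
have close : enorm (chord_dir g s t - chord_dir g a b) <= kap.
  by rewrite leNgt; apply/negP => h; apply: nb; exists s, t, a, b.
rewrite -(unitvK (g t - g s)) -/(chord_dir g s t).
have [n0|n0] := eqVneq (enorm (g t - g s)) 0; first by rewrite n0 scale0r; exact: within_cone0.
apply: within_coneZ; first exact: enorm_ge0.
set d := chord_dir g s t in d2 close *; set u := chord_dir g a b in d1 close *.
have k0 : 0 <= kap by exact: le_trans (enorm_ge0 _) close.
have E : enorm (d - u) ^+ 2 = 2 - 2 * dotv d u.
  by rewrite enorm_sq dotvBl !dotvBr -!enorm_sq d1 d2 (dotvC u); ring.
have sq : enorm (d - u) ^+ 2 <= kap * kap.
  by rewrite expr2 ler_pM ?enorm_ge0.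
have pr : enorm (d - dotv d u *: u) <= enorm (d - u) + (1 - dotv d u).
  have -> : d - dotv d u *: u = (d - u) + (1 - dotv d u) *: u.
    by rewrite scalerBl scale1r addrA subrK.
  apply: le_trans (enormD _ _) _; rewrite lerD2l enormZ d1 mulr1 ger0_norm //.
  by rewrite subr_ge0; have := sqr_ge0 (enorm (d - u)); lra.
by rewrite /within_cone; apply: le_trans pr _; nra.
Qed.

(** Of [D + 1] distinct unit vectors at least one is far from the opposites of [D] given
    ones, for each of these can be close to only one of them. *)
Lemma spread_vectors (D : nat) : exists2 mu : R, 0 < mu <= 1 &
  forall (J : finType) (A : {set J}) (x : J -> V), (forall i, enorm (x i) = 1) ->
    (#|A| <= D)%N -> exists2 u, enorm u = 1 & forall i, i \in A -> mu - 1 <= dotv (x i) u.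
Proof.
pose z (j : 'I_D.+1) : V := \row_i (if i == 0 then 1 else if i == 1 then j%:R else 0).
have z0 j : z j != 0 by apply/eqP => /rowP/(_ 0); rewrite !mxE /= => /eqP; rewrite oner_eq0.
pose w j := unitv (z j).
have w1 j : enorm (w j) = 1 by exact: enorm_unitv.
have wI : injective w.
  move=> j k E.
  have /rowP/(_ 0) := E; rewrite !mxE /= !mulr1 => E0.
  have /rowP/(_ 1) := E; rewrite !mxE /= E0 => /mulfI E1.
  apply/val_inj/eqP; rewrite -(eqr_nat R); apply/eqP/E1.
  by rewrite invr_neq0 // gt_eqF // enorm_gt0.
have [sg sg0 sgP] : exists2 d : R, 0 < d & forall p : 'I_D.+1 * 'I_D.+1,
    p.1 != p.2 -> d <= enorm (w p.1 - w p.2).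
  apply: (@small_forall R _ (fun p d => p.1 != p.2 -> d <= enorm (w p.1 - w p.2))).
    by move=> p d d' /andP[_ dd'] h /h; exact: le_trans.
  move=> p; have [E|E] := eqVneq p.1 p.2; first by exists 1.
  exists (enorm (w p.1 - w p.2)) => //; rewrite enorm_gt0 subr_eq0.
  by apply: contra E => /eqP/wI ->.
(* [enorm (x + w) ^+ 2 = 2 + 2 * dotv x w], so [dotv x w < mu - 1] means that [w] is at
   distance less than [sg / 2] of [- x]. *)
pose mu := Num.min 1 (sg ^+ 2 / 8).
have mu_sg : mu <= sg ^+ 2 / 8 by rewrite ge_min lexx orbT.
exists mu; first by rewrite lt_min ltr01 divr_gt0 ?exprn_gt0 //= ge_min lexx.
move=> J A x x1 AD; apply: contrapT => no.
have /choice[f fP] j : exists i, i \in A /\ dotv (x i) (w j) < mu - 1.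
  apply: contrapT => h; apply: no; exists (w j) => // i iA.
  by rewrite leNgt; apply/negP => hi; apply: h; exists i.
have near j : enorm (w j + x (f j)) < sg / 2.
  have [_ h] := fP j; rewrite -(@ltr_pXn2r _ 2) ?nnegrE ?enorm_ge0 ?divr_ge0 ?(ltW sg0) //.
  rewrite enorm_sq dotvDl !dotvDr -!enorm_sq w1 x1 (dotvC (w j)); nra.
have fI : injective f.
  move=> j k fjk; apply/eqP; apply: contrapT => /negP jk.
  have := sgP (j, k) jk => /=; rewrite leNgt => /negP; apply.
  have -> : w j - w k = (w j + x (f j)) - (w k + x (f k)).
    by rewrite fjk opprD addrACA subrr addr0.
  apply: le_lt_trans (enormD _ _) _; rewrite enormN.
  by have := near j; have := near k; lra.
have : (#|codom f| <= #|A|)%N.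
  by apply: subset_leq_card; apply/fintype.subsetP => i /codomP[j ->]; case: (fP j).
by rewrite card_codom // card_ord leqNgt ltnS AD.
Qed.

Lemma midpoint_cuts (G : sgraph R) : @cuts R G (fun _ => 1%N) (fun _ k => k%:R / 2).
Proof.
move=> e; split=> [||k _]; first by rewrite mul0r.
  by rewrite divff.
by rewrite ltr_pM2r ?invr_gt0 // ltr_nat.
Qed.

Lemma midpoint_loopless (G : sgraph R) :
  loopless (@subdivision R G (fun _ => 1%N) (fun _ k => k%:R / 2)).
Proof.
case=> e [k hk]; set n := fun _ : gedge G => 1%N.
have mid : node n e 1 = inr (existT (fun e => 'I_(n e)) e ord0) := nodeS (ord0 : 'I_(n e)).
case: k hk => [|[|//]] hk.
  by rewrite -[X in _ != X]/(node n e 1) mid.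
by rewrite -[X in X != _]/(node n e 1) mid -[X in _ != X]/(node n e (n e).+1) node_last.
Qed.

Section StraightCuts.
Variable c : forall d, 'M[R]_(d, 3) -> R.
Hypothesis vc : vertex_curvature c.
Variable G : sgraph R.
Hypotheses (contG : continuous_graph G) (loopG : loopless G).
Hypothesis finG : total_curvature c G \is a fin_num.

(** The turning of the fine embedded polygons is bounded by the total curvature. *)
Lemma straight_cuts kap : 0 < kap -> exists n t, @cuts R G n t /\
  forall e k, (k <= n e)%N -> ~ bent (carc e) kap (t e k) (t e k.+1).
Proof.
move=> kap0; have [M MP] := polygonal_curvature_lower vc contG loopG.
have /choice[n nP] (e : gedge G) : exists n t, chain n t /\
    forall k, (k <= n)%N -> ~ bent (carc e) kap (t k) (t k.+1).
  apply: straight_chain => //; first exact: carc_continuous.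
    by move=> s s' s01 s'01; rewrite !carcE //; exact: garc_inj.
  exists (fine (total_curvature c G) + M) => eta eta0.
  have [n [t [ct mesh cP]]] := fine_embedded_chords contG loopG eta0.
  exists (n e), (t e); split; [exact: ct|exact: mesh|].
  rewrite -lerBlDr; apply: le_trans (MP n t ct e) _.
  rewrite -lee_fin fineK //; apply: ereal_sup_ubound.
  exists (chord_graph (subdivision n t)); split=> //.
  by apply: approximating_chord => //; exact: same_space_subdivision.
have [t P] := choice nP.
exists n, t; split=> [e|e k kn]; first by case: (P e).
by case: (P e) => _; apply.
Qed.

End StraightCuts.

Lemma degree_le (G : sgraph R) (v : gvert G) : (degree v <= #|{: gedge G * bool}|)%N.
Proof. exact: max_card. Qed.

(** The bound does not depend on the subdivision, so the opening of the cones can be fixed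
    before the edges are cut. *)
Lemma subdivision_degree (G : sgraph R) n t : continuous_graph G -> @cuts R G n t ->
  forall v : gvert (subdivision n t), (degree v <= #|{: gedge G * bool}| + 2)%N.
Proof.
move=> cG ct [v|x]; last by rewrite degree_new // leq_addl.
by rewrite degree_old // (leq_trans (degree_le _)) // leq_addr.
Qed.

Lemma loopless_polygon c (G : sgraph R) (eps : R) :
  vertex_curvature c -> continuous_graph G -> loopless G ->
  total_curvature c G \is a fin_num -> 0 < eps ->
  exists P : sgraph R, [/\ approximating G P, ambient_isotopic R (carrier G) (carrier P) &
    forall e : gedge P, edge_length e <= eps].
Proof.
move=> vc cG lG fG eps0.
have [mu /andP[mu0 mu1] spread] := spread_vectors (#|{: gedge G * bool}| + 2).
have kap0 : 0 < mu / 128 by rewrite divr_gt0.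
have [n [t [ct st]]] := straight_cuts vc cG lG fG kap0.
pose H := subdivision n t.
have GH : same_space G H by exact: same_space_subdivision.
have [cH eH _] := GH; have lH : loopless H by exact: subdivision_loopless.
have carcI e (s s' : R) : 0 <= s <= 1 -> 0 <= s' <= 1 -> carc (G := G) e s = carc e s' -> s = s'.
  by move=> h h'; rewrite !carcE //; exact: garc_inj.
pose a (E : gedge H) := chord_dir (carc (tag E)) (t (tag E) (tagged E)) (t (tag E) (tagged E).+1).
have a1 E : enorm (a E) = 1.
  case: E => e [k kn]; rewrite /a /=.
  have /andP[h1 _] := cut_itv ct (leqW kn : (k <= (n e).+1)%N).
  have /andP[_ h2] := cut_itv ct kn.
  by apply: chord_dir1 => //; [exact: carcI|exact: (cut_lt ct)].
have cone (E : gedge H) (s s' : R) : 0 <= s -> s < s' -> s' <= 1 ->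
    within_cone (a E) (mu / 32) (garc E s' - garc E s).
  case: E => e [k kn] s0 ss' s'1; rewrite /a /=.
  have /andP[h1 _] := cut_itv ct (leqW kn : (k <= (n e).+1)%N).
  have /andP[_ h2] := cut_itv ct kn.
  have d : 0 < t e k.+1 - t e k by rewrite subr_gt0; apply: (cut_lt ct).
  have /andP[p1 p2] : 0 <= t e k + s * (t e k.+1 - t e k) <= 1 by apply: (piece_in01 ct) => //; lra.
  have /andP[q1 q2] : 0 <= t e k + s' * (t e k.+1 - t e k) <= 1 by apply: (piece_in01 ct) => //; lra.
  rewrite -!(@carcE _ G e) ?p1 ?p2 ?q1 ?q2 //.
  have -> : mu / 32 = 4 * (mu / 128) by field.
  apply: bent_cone => //.
  - exact: carcI.
  - lra.
  - lra.
  - exact: st.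
  - by rewrite lerDl mulr_ge0 // ltW.
  - by rewrite ltrD2l ltr_pM2r.
  - nra.
have spreadH (v : gvert H) : exists2 u : V, enorm u = 1 &
    forall h, gend h = v -> mu - 1 <= dotv (end_axis a h) u.
  have [||u u1 hu] := spread _ (ends v) (end_axis a).
  - by move=> h; rewrite /end_axis; case: ifP => _; rewrite ?enormN.
  - exact: subdivision_degree.
  by exists u => // h hv; apply: hu; rewrite inE hv.
have mu01 : 0 < mu <= 1 by rewrite mu0.
have [n' [t' [ct' cP iso small]]] := cone_graph_polygon cH lH a1 mu01 cone spreadH eps0.
exists (chord_graph (subdivision n' t')); split=> //; last by rewrite -eH.
apply: approximating_chord => //; apply: same_space_trans GH _.
exact: same_space_subdivision.
Qed.

End Assembly.

Theorem theorem3 (R : realType) (c : forall d : nat, 'M[R]_(d, 3) -> R)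
    (G : sgraph R) (eps : R) :
  vertex_curvature c ->
  continuous_graph G ->
  total_curvature c G \is a fin_num ->
  0 < eps ->
  exists P : sgraph R,
    [/\ approximating G P,
        ambient_isotopic R (carrier G) (carrier P),
        forall e : gedge P, edge_length e <= eps
      & ((polygonal_curvature c P)%:E <= total_curvature c G)%E].
Proof.
move=> vc cG fG eps0; have ct := @midpoint_cuts R G.
have GH := same_space_subdivision cG ct; have [cH eH _] := GH.
have [|P [aP iso small]] := @loopless_polygon R c _ eps vc cH (@midpoint_loopless R G) _ eps0.
  by rewrite (total_curvature_same_space c cG GH).
have {}aP : approximating G P by exact: approximating_same_space aP.
exists P; split=> //; first by rewrite -eH.
by apply: ereal_sup_ubound; exists P.
Qed.
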